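(* Let $d\ge1$ be an integer, let $1<p,s<\infty$ and $d+1<\alpha<d+2$ with $\frac1s+\frac1p+\alpha<d+2$, and let $C_1$ be the best (smallest) constant $C$ such that $$\left|\int_{\mathbb{B}^d}\int_{\mathbb{B}^d}\frac{f(w)g(z)}{|1-\langle z,w\rangle|^\alpha}\,dv(w)\,dv(z)\right|\le C\,\|f\|_{L^p}\|g\|_{L^s}\quad\text{for all } f\in L^p(\mathbb{B}^d),\ g\in L^s(\mathbb{B}^d).$$ Then $$C_1\le\frac{\Gamma(d+1)^{2-\frac1s-\frac1p}\,\Gamma(\alpha-(d+1))\,\Gamma\!\left(\frac{1}{1-s^{-1}-p^{-1}}(d+1-\alpha)+1\right)^{1-\frac1s-\frac1p}}{\Gamma\!\left(\frac{\alpha}{2}\right)^2\,\Gamma\!\left(\frac{1}{1-s^{-1}-p^{-1}}(d+1-\alpha)+d+1\right)^{1-\frac1s-\frac1p}}.$$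
   Context: $\mathbb{B}^d$ is the open unit ball of $\mathbb{C}^d$ with Lebesgue measure $dv$ normalized so that $v(\mathbb{B}^d)=1$; $\langle z,w\rangle=\sum_j z_j\overline{w_j}$; $L^p(\mathbb{B}^d)=L^p(\mathbb{B}^d,dv)$. $\Gamma$ is the Gamma function. *)

(* Defs.v *)
From HB Require Import structures.
From mathcomp Require Import all_boot all_order all_algebra.
From mathcomp Require Import all_classical all_reals all_analysis.
From mathcomp Require Import measurable_realfun complex zify.
Set Implicit Arguments.
Unset Strict Implicit.
Unset Printing Implicit Defensive.
Import Order.TTheory GRing.Theory Num.Theory.
Import numFieldNormedType.Exports.
Import ComplexField.Normc.
Local Open Scope classical_set_scope.
Local Open Scope ring_scope.
Local Open Scope complex_scope.

(* The sigma-algebra of C is transported from R * R, whose sigma-algebra is the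
   product of the Borel ones, so that it is the Borel sigma-algebra of C. C^n is
   represented by [n.-tuple R[i]], with the product sigma-algebra. The type
   [measurableTypeR R] is R, with the display that [lebesgue_measure] uses. *)
Definition complex_pair (R : realType) (z : R[i]) :
    measurableTypeR R * measurableTypeR R :=
  (complex.Re z, complex.Im z).
Definition pair_complex (R : realType)
    (p : measurableTypeR R * measurableTypeR R) : R[i] :=
  p.1 +i* p.2.

HB.instance Definition _ (R : realType) := isPointed.Build R[i] 0.

HB.instance Definition _ (R : realType) :=
  Measurable.copy R[i] (g_sigma_algebra_preimageType (@complex_pair R)).

Lemma measurable_complex_pair (R : realType) :
  measurable_fun [set: R[i]] (@complex_pair R).
Proof. by move=> _ B mB; exists B. Qed.

Lemma measurable_Re (R : realType) :
  measurable_fun [set: R[i]] (@complex.Re R : R[i] -> R).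
Proof. exact: (measurableT_comp measurable_fst (@measurable_complex_pair R)). Qed.

Lemma measurable_Im (R : realType) :
  measurable_fun [set: R[i]] (@complex.Im R : R[i] -> R).
Proof. exact: (measurableT_comp measurable_snd (@measurable_complex_pair R)). Qed.

Lemma measurable_pair_complex (R : realType) :
  measurable_fun setT (@pair_complex R).
Proof.
move=> _ _ [B mB <-]; rewrite !setTI.
by rewrite (_ : _ @^-1` _ = B)//; apply/seteqP; split => -[].
Qed.

Definition cons_pair (T : Type) n (p : T * n.-tuple T) : n.+1.-tuple T :=
  [tuple of p.1 :: p.2].

Definition uncons_pair (T : Type) n (t : n.+1.-tuple T) : T * n.-tuple T :=
  (thead t, [tuple of behead t]).

Lemma cons_pairK (T : Type) n : cancel (@cons_pair T n) (@uncons_pair T n).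
Proof. by move=> [x t]; congr pair; exact/val_inj. Qed.

Lemma measurable_cons_pair d (T : measurableType d) n :
  measurable_fun [set: T * n.-tuple T] (@cons_pair T n).
Proof. exact: measurable_cons. Qed.

Lemma measurable_uncons_pair d (T : measurableType d) n :
  measurable_fun [set: n.+1.-tuple T] (@uncons_pair T n).
Proof.
by apply/measurable_fun_pair; [exact: measurable_tnth|exact: measurable_behead].
Qed.

Lemma sigma_finite_product d1 d2 (T1 : measurableType d1)
    (T2 : measurableType d2) (R : realType)
    (m1 : {sigma_finite_measure set T1 -> \bar R})
    (m2 : {sigma_finite_measure set T2 -> \bar R}) :
  sigma_finite setT (m1 \x m2)%E.
Proof.
have /sigma_finiteP[F [TF ndF Foo]] := sigma_finiteT m1.
have /sigma_finiteP[G [TG ndG Goo]] := sigma_finiteT m2.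
exists (fun n => F n `*` G n); last first.
  move=> k; have [mF Fk] := Foo k; have [mG Gk] := Goo k.
  split; first exact: measurableX.
  by rewrite product_measure1E// lte_mul_pinfty// ge0_fin_numE.
apply/seteqP; split=> [[x y] _|//].
have [n _ Fnx] : (\bigcup_i F i) x by rewrite -TF.
have [k _ Gky] : (\bigcup_i G i) y by rewrite -TG.
exists (maxn n k) => //; split.
- by move: x Fnx; exact/subsetPset/ndF/leq_maxl.
- by move: y Gky; exact/subsetPset/ndG/leq_maxr.
Qed.

Section image_measure.
Context d1 d2 (T1 : measurableType d1) (T2 : measurableType d2) (R : realType).
Variables (mu : {measure set T1 -> \bar R}) (f : T1 -> T2) (g : T2 -> T1).

Lemma pushforward_sigma_additive :
  measurable_fun setT f -> semi_sigma_additive (pushforward mu f).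
Proof. by move=> mf; exact: measure_semi_sigma_additive. Qed.

Lemma sigma_finite_pushforward : measurable_fun setT g -> cancel f g ->
  sigma_finite setT mu -> sigma_finite setT (pushforward mu f).
Proof.
move=> mg fK [F FT mF].
exists (fun i => g @^-1` F i); first by rewrite -preimage_bigcup -FT.
move=> i; have [mFi Fioo] := mF i; split.
  by rewrite -[X in measurable X]setTI; exact: mg.
by rewrite /pushforward -comp_preimage (_ : g \o f = id)//; apply/funext.
Qed.

End image_measure.

Section lebesgue_measure_complex.
Context (R : realType).
Local Open Scope ereal_scope.

Definition lebesgue_measure_C : set R[i] -> \bar R :=
  pushforward (@lebesgue_measure R \x @lebesgue_measure R) (@pair_complex R).

Let lebesgue_measure_C0 : lebesgue_measure_C set0 = 0.
Proof. by rewrite /lebesgue_measure_C /pushforward preimage_set0 measure0. Qed.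

Let lebesgue_measure_C_ge0 A : 0 <= lebesgue_measure_C A.
Proof. by rewrite /lebesgue_measure_C /pushforward measure_ge0. Qed.

Let lebesgue_measure_C_sigma_additive : semi_sigma_additive lebesgue_measure_C.
Proof.
exact: (pushforward_sigma_additive (mu := _ \x _)
  (@measurable_pair_complex R)).
Qed.

HB.instance Definition _ := isMeasure.Build _ _ _ lebesgue_measure_C
  lebesgue_measure_C0 lebesgue_measure_C_ge0 lebesgue_measure_C_sigma_additive.

Let lebesgue_measure_C_sigma_finite : sigma_finite setT lebesgue_measure_C.
Proof.
apply: (sigma_finite_pushforward (mu := _ \x _) (@measurable_complex_pair R)); first by case.
exact: sigma_finite_product.
Qed.

HB.instance Definition _ := Measure_isSigmaFinite.Build _ _ _
  lebesgue_measure_C lebesgue_measure_C_sigma_finite.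

End lebesgue_measure_complex.

Section lebesgue_measure_Cn.
Context (R : realType).
Local Open Scope ereal_scope.

Section cons_measure.
Variables (n : nat) (mu : {sigma_finite_measure set (n.-tuple R[i]) -> \bar R}).

Definition cons_measure : set (n.+1.-tuple R[i]) -> \bar R :=
  pushforward (@lebesgue_measure_C R \x mu) (@cons_pair R[i] n).

Let cons_measure0 : cons_measure set0 = 0.
Proof. by rewrite /cons_measure /pushforward preimage_set0 measure0. Qed.

Let cons_measure_ge0 A : 0 <= cons_measure A.
Proof. by rewrite /cons_measure /pushforward measure_ge0. Qed.

Let cons_measure_sigma_additive : semi_sigma_additive cons_measure.
Proof.
exact: (pushforward_sigma_additive (mu := _ \x _)
  (@measurable_cons_pair _ R[i] n)).
Qed.

HB.instance Definition _ := isMeasure.Build _ _ _ cons_measure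
  cons_measure0 cons_measure_ge0 cons_measure_sigma_additive.

Let cons_measure_sigma_finite : sigma_finite setT cons_measure.
Proof.
apply: (sigma_finite_pushforward (mu := _ \x _)).
- exact: measurable_uncons_pair.
- exact: cons_pairK.
- exact: sigma_finite_product.
Qed.

HB.instance Definition _ := Measure_isSigmaFinite.Build _ _ _
  cons_measure cons_measure_sigma_finite.

End cons_measure.

Fixpoint lebesgue_measure_Cn n :
    {sigma_finite_measure set (n.-tuple R[i]) -> \bar R} :=
  match n with
  | 0%N => \d_[tuple]
  | n'.+1 => cons_measure (lebesgue_measure_Cn n')
  end.

End lebesgue_measure_Cn.

Section polybox.
Context (R : realType).
Local Open Scope ereal_scope.

Definition polybox (A : set R[i]) n : set (n.-tuple R[i]) :=
  [set t | forall i, A (tnth t i)].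
Arguments polybox A n : clear implicits.

Lemma polyboxS (A : set R[i]) n :
  polybox A n.+1 = [set t | A (thead t) /\ polybox A n [tuple of behead t]].
Proof.
apply/seteqP; split=> [t tA|t [At tA] i].
  by split=> [|i]; [exact: tA|rewrite tnth_behead; exact: tA].
have [->//|i0] := eqVneq i ord0.
have [j ->] : exists j, i = lift ord0 j.
  by case: (unliftP ord0 i) i0 => [j ->|->]; [exists j|rewrite eqxx].
have := tA j; rewrite tnth_behead; congr (A (tnth _ _)).
by apply/val_inj; rewrite /= inordK// ltnS.
Qed.

Lemma measurable_polybox (A : set R[i]) n :
  measurable A -> measurable (polybox A n).
Proof.
move=> mA; rewrite (_ : polybox A n =
    \big[setI/setT]_(i < n) ((fun t => tnth t i) @^-1` A)); last first.
  apply/seteqP; split=> t; rewrite -bigcap_seq /=.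
    by move=> h i _; exact: h.
  by move=> h i; apply: h; rewrite /= mem_index_enum.
apply: bigsetI_measurable => i _.
by rewrite -[X in measurable X]setTI; exact: measurable_tnth.
Qed.

Lemma lebesgue_measure_Cn_polybox (A : set R[i]) n : measurable A ->
  lebesgue_measure_Cn R n (polybox A n) = lebesgue_measure_C A ^+ n.
Proof.
move=> mA; elim: n => [|n IH].
  by rewrite /= diracE mem_set//; case.
rewrite expeS /= /cons_measure /pushforward.
rewrite (_ : _ @^-1` _ = A `*` polybox A n); last first.
  rewrite polyboxS; apply/seteqP; split=> -[x t] /=; rewrite theadE => -[Ax tA].
    by split=> //=; move: tA; congr polybox; exact/val_inj.
  by split=> //=; move: tA; congr polybox; exact/val_inj.
by rewrite product_measure1E ?IH//; exact: measurable_polybox.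
Qed.

Definition csquare (r : R) : set R[i] :=
  [set z | (`|complex.Re z| <= r)%R /\ (`|complex.Im z| <= r)%R].

Lemma csquareE r :
  @pair_complex R @^-1` csquare r = `[(- r)%R, r] `*` `[(- r)%R, r].
Proof.
by apply/seteqP; split=> -[a b] /= [];
  rewrite /= !in_itv/= -?ler_norml => ? ?; split;
  rewrite /= ?in_itv/= -?ler_norml.
Qed.

Lemma measurable_csquare r : measurable (csquare r).
Proof.
exists (`[(- r)%R, r] `*` `[(- r)%R, r]).
  by apply: measurableX; exact: measurable_itv.
by rewrite setTI -csquareE; apply/seteqP; split => -[].
Qed.

Lemma lebesgue_measure_C_csquare r : (0 < r)%R ->
  lebesgue_measure_C (csquare r) = ((r *+ 2) ^+ 2)%:E.
Proof.
move=> r0; rewrite /lebesgue_measure_C /pushforward csquareE.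
have lr : lebesgue_measure `[(- r)%R, r]%classic = (r *+ 2)%:E.
  by rewrite lebesgue_measure_itv/= lte_fin gtrN// -EFinD opprK -mulr2n.
rewrite product_measure1E; [|exact: measurable_itv..].
by rewrite /= lr -EFinM expr2.
Qed.

End polybox.
Arguments polybox {R} A n _.

Section complex_ball.
Context (R : realType) (d : nat).
Local Notation Cd := (d.-tuple R[i]).
Local Notation lambda := (lebesgue_measure_Cn R d).

Definition inner (z w : Cd) : R[i] := \sum_(j < d) tnth z j * (tnth w j)^*.

Definition cball : set Cd := [set z | \sum_(j < d) normc (tnth z j) ^+ 2 < 1].

Lemma sqr_normcE (z : R[i]) :
  normc z ^+ 2 = complex.Re z ^+ 2 + complex.Im z ^+ 2.
Proof. by case: z => a b; rewrite /= sqr_sqrtr// addr_ge0 ?sqr_ge0. Qed.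

Lemma measurable_sqr_normc : measurable_fun setT (fun z : R[i] => normc z ^+ 2).
Proof.
under eq_fun do rewrite sqr_normcE.
apply: measurable_funD; apply: measurable_funX.
- exact: measurable_Re.
- exact: measurable_Im.
Qed.

Lemma measurable_cball : measurable cball.
Proof.
have mf : measurable_fun setT
    (fun z : Cd => \sum_(j < d) normc (tnth z j) ^+ 2).
  apply: measurable_sum => j.
  exact: (measurableT_comp measurable_sqr_normc (measurable_tnth j)).
have := mf measurableT _ (measurable_itv `]-oo, 1[).
by rewrite setTI; congr measurable; apply/seteqP; split => z /=;
  rewrite in_itv.
Qed.

Lemma lambda_cball_fin : (lambda cball < +oo)%E.
Proof.
have /le_lt_trans : (lambda cball <= lambda (polybox (csquare 1) d))%E.
  apply: le_measure; rewrite ?inE; [exact: measurable_cball| |].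
    exact: (measurable_polybox (measurable_csquare 1)).
  move=> z zB i.
  have : normc (tnth z i) ^+ 2 < 1.
    apply: le_lt_trans zB; rewrite (bigD1 i)//= lerDl.
    by apply: sumr_ge0 => j _; exact: sqr_ge0.
  rewrite sqr_normcE => h; split;
    rewrite -(@expr_le1 _ 2)// real_normK ?num_real// (le_trans _ (ltW h))// ?lerDl ?lerDr ?sqr_ge0//.
apply; rewrite lebesgue_measure_Cn_polybox; last exact: measurable_csquare.
by rewrite lebesgue_measure_C_csquare// -EFin_expe ltry.
Qed.

Lemma lambda_cball_gt0 : (0 < lambda cball)%E.
Proof.
pose r : R := (2 * d.+1%:R)^-1.
have r0 : 0 < r by rewrite invr_gt0 mulr_gt0.
have /lt_le_trans : (0 < lambda (polybox (csquare r) d))%E.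
  rewrite lebesgue_measure_Cn_polybox; last exact: measurable_csquare.
  by rewrite lebesgue_measure_C_csquare// -EFin_expe lte_fin !exprn_gt0// mulrn_wgt0.
apply; apply: le_measure; rewrite ?inE; [|exact: measurable_cball|].
  exact: (measurable_polybox (measurable_csquare r)).
move=> z zA; rewrite /cball/=.
apply: (@le_lt_trans _ _ (\sum_(j < d) (r ^+ 2 + r ^+ 2))).
  apply: ler_sum => j _; rewrite sqr_normcE.
  by have [hr hi] := zA j;
    rewrite -(real_normK (num_real (complex.Re _)))
      -(real_normK (num_real (complex.Im _))) lerD// lerXn2r// ?nnegrE// ltW.
rewrite sumr_const card_ord -mulr2n -mulrnA -mulr_natr exprVn mulrC.
rewrite ltr_pdivrMr ?exprn_gt0 ?mulr_gt0// mul1r -natrM -natrX ltr_nat.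
by rewrite expnMn -!mulnn; nia.
Qed.

Let cball_scale_ge0 : 0 <= (fine (lambda cball))^-1.
Proof. by rewrite invr_ge0 fine_ge0// ltW// lambda_cball_gt0. Qed.

(* The measure dv, seen as a measure on C^d that does not charge the
   complement of the ball. *)
Definition vball : set Cd -> \bar R :=
  mscale (NngNum cball_scale_ge0) (mrestr lambda measurable_cball).

HB.instance Definition _ := Measure.on vball.

Let vball_setT : vball setT = 1%E.
Proof.
have lfin : lambda cball \is a fin_num.
  by rewrite ge0_fin_numE ?lambda_cball_fin// ltW// lambda_cball_gt0.
have mE : mrestr lambda measurable_cball setT = (fine (lambda cball))%:E.
  by rewrite /mrestr setTI fineK.
rewrite /vball /mscale [X in (_ * X)%E]mE -EFinM/= mulVf//.
by rewrite gt_eqF// fine_gt0// lambda_cball_gt0 lambda_cball_fin.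
Qed.

HB.instance Definition _ := Measure_isProbability.Build _ _ _ vball vball_setT.

Lemma vball_cball : vball cball = 1%E.
Proof.
rewrite -vball_setT /vball /mscale; congr (_ * _)%E.
by transitivity (lambda cball); rewrite /= /mrestr ?setIid ?setTI.
Qed.

End complex_ball.

Section best_constant.
Context (R : realType) (d : nat).
Local Notation Cd := (d.-tuple R[i]).
Local Notation dv := (@vball R d).

Definition cintegral (F : Cd -> R[i]) : R[i] :=
  (\int[dv]_z complex.Re (F z))%R +i* (\int[dv]_z complex.Im (F z))%R.

(* Elements of L^p(B^d) are represented by measurable functions on C^d; their
   values outside the ball are irrelevant. *)
Definition Lpnorm (p : R) (f : Cd -> R[i]) : \bar R :=
  'N[dv]_p%:E[(fun z => (normc (f z))%:E)]%E.

Definition in_Lp (p : R) (f : Cd -> R[i]) : Prop :=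
  measurable_fun setT f /\ (Lpnorm p f < +oo)%E.

Definition integrand (alpha : R) (f g : Cd -> R[i]) (z w : Cd) : R[i] :=
  f w * g z / (normc (1 - inner z w) `^ alpha)%:C.

(* The first conjunct says that the double integral converges absolutely:
   without it, the second one would be about an integral that has no meaning,
   which [fine] would turn into 0. *)
Definition bilinear_bound (p s alpha C : R) : Prop :=
  forall f g : Cd -> R[i], in_Lp p f -> in_Lp s g ->
    (\int[dv]_z \int[dv]_w (normc (integrand alpha f g z w))%:E < +oo)%E /\
    ((normc (cintegral (fun z => cintegral (integrand alpha f g z))))%:E <=
      C%:E * Lpnorm p f * Lpnorm s g)%E.

(* The value is +oo if no constant works. *)
Definition best_constant (p s alpha : R) : \bar R :=
  ereal_inf [set C%:E | C in bilinear_bound p s alpha].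

Lemma Lpnorm_cst1 p : Lpnorm p (cst 1) = 1%E.
Proof.
have -> : Lpnorm p (cst 1) = 'N[dv]_p%:E[cst 1%E]%E.
  by apply: eq_Lnorm => z; rewrite normc1.
rewrite Lnorm_cst1 [X in (X `^ _)%E](_ : _ = 1%E) ?poweR1r//.
exact: probability_setT.
Qed.

Lemma bilinear_bound_ge0 p s alpha C : bilinear_bound p s alpha C -> 0 <= C.
Proof.
move=> /(_ (cst 1) (cst 1)) []; rewrite /in_Lp ?Lpnorm_cst1 ?ltry//.
move=> _; rewrite !mule1 lee_fin => /(le_trans _); apply.
by rewrite /normc; case: cintegral => a b; exact: sqrtr_ge0.
Qed.

(* As soon as some constant works, there is a smallest one. *)
Lemma best_constantP p s alpha : (best_constant p s alpha < +oo)%E ->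
  exists2 C, bilinear_bound p s alpha C & best_constant p s alpha = C%:E.
Proof.
move=> infoo; have [_ [C hC _] _] := ereal_inf_lt infoo.
have inf_ge0 : (0 <= best_constant p s alpha)%E.
  apply: le_ereal_inf_tmp => _ [D hD <-]; rewrite lee_fin.
  exact: bilinear_bound_ge0 hD.
have inf_fin : best_constant p s alpha \is a fin_num by rewrite ge0_fin_numE.
exists (fine (best_constant p s alpha)); last by rewrite fineK.
move=> f g fp gs; split; first by have [] := hC f g fp gs.
have Lfin q h : in_Lp q h -> Lpnorm q h \is a fin_num.
  by move=> [_ hq]; rewrite ge0_fin_numE// Lnorm_ge0.
pose n := fine (Lpnorm p f) * fine (Lpnorm s g).
have nE D : (D%:E * Lpnorm p f * Lpnorm s g)%E = (D * n)%:E.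
  by rewrite -(fineK (Lfin _ _ fp)) -(fineK (Lfin _ _ gs)) -!EFinM mulrA.
have n0 : 0 <= n by rewrite mulr_ge0// fine_ge0// Lnorm_ge0.
rewrite nE lee_fin; move: n0; rewrite le_eqVlt => /orP[/eqP n0|n0].
  by have [_] := hC f g fp gs; rewrite nE -n0 !mulr0.
rewrite -ler_pdivrMr// -lee_fin fineK//.
apply: le_ereal_inf_tmp => _ [D hD <-]; rewrite lee_fin ler_pdivrMr//.
by have [_] := hD f g fp gs; rewrite nE.
Qed.

End best_constant.

Definition Gamma (R : realType) (x : R) : R :=
  \int[lebesgue_measure]_(t in `]0, +oo[) (t `^ (x - 1) * expR (- t)).

(* Main.v *)
(** Put theta = 1 - 1/s - 1/p and b = alpha - d - 1.  The kernel satisfies the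
    Forelli-Rudin bound
      int |1 - <z,w>|^(-alpha) dv(w) <= C0 (1 - |z|^2)^(-b),
      C0 = Gamma(d+1) Gamma(b) / Gamma(alpha/2)^2.
    Indeed |1 - u|^(-alpha) = |sum_k c_k u^k|^2, where the c_k are the binomial
    coefficients of (1 - u)^(-alpha/2).  Averaging over the rotations of w by
    roots of unity removes the cross terms, the remaining moments are
    int |<z,w>|^(2k) dv(w) = |z|^(2k) k! d! / (d+k)!, and the log-convexity
    inequality Gamma(alpha/2+k)^2 <= Gamma(b+k) Gamma(d+1+k) compares the
    resulting power series in |z|^2 with that of (1 - |z|^2)^(-b).

    Let q = 1/(1 - theta), so that 1/q = 1/p + 1/s.  Young's inequality
    FG <= (q/p) F^(p/q) + (q/s) G^(s/q) and the bound above reduce the bilinear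
    form to integrals of F^(p/q) (1 - |z|^2)^(-b), and Young's inequality with
    the exponents q and 1/theta then gives the constant
    C0 (int (1 - |z|^2)^(-b/theta) dv)^theta.  All integrals over the ball come
    from Gaussian integrals by homogeneity, so that neither polar coordinates
    nor the value of pi is needed. *)
Require Import Defs.
From mathcomp Require Import all_boot all_order all_algebra.
From mathcomp Require Import all_classical all_reals all_analysis.
From mathcomp Require Import measurable_realfun complex ring lra zify.
From mathcomp Require cyclic separable cyclotomic.
Set Implicit Arguments.
Unset Strict Implicit.
Unset Printing Implicit Defensive.
Import Order.TTheory GRing.Theory Num.Theory.
Import numFieldNormedType.Exports.
Import ComplexField.Normc.
Local Open Scope classical_set_scope.
Local Open Scope ring_scope.

(** * Integrals of nonnegative functions *)

Section integral_real.
Local Open Scope ereal_scope.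
Context d (T : measurableType d) (R : realType).
Variable mu : {measure set T -> \bar R}.

(** The hypothesis 1/s + 1/p + alpha < d + 2 says b < theta, that is -b/theta > -1, which is the
    integrability of (1 - |z|^2)^(-b/theta) over the ball. Since 1/p + 1/s + theta = 1, the two uses
    of Young's inequality together play the part of Hoelder's inequality with three exponents; used
    pointwise, they only leave integrals of sums to estimate. As the kernel is symmetric, one weight
    bounds it in both variables. The power series can be compared coefficient by coefficient because
    alpha = b + d + 1, so that alpha/2 + k is the midpoint of b + k and d + 1 + k. Only finite sums
    are integrated: N roots of unity make the first N monomials orthogonal, and Fatou's lemma passes
    from partial sums to the kernel, which is enough for an upper bound. Working with the squared
    modulus avoids complex powers. Integrals stay in the extended reals until finiteness is proved,
    so that Tonelli's theorem applies at once, and cutoffs such as t > 0 or |w| < 1 are written as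
    factors 0 or 1, so that integrals range over whole spaces. *)

Lemma ge0_integralZ (k : R) (f : T -> R) : (0 <= k)%R ->
  measurable_fun setT f -> (forall x, 0 <= f x)%R ->
  \int[mu]_x (k * f x)%:E = k%:E * \int[mu]_x (f x)%:E.
Proof.
move=> k0 mf f0; under eq_integral do rewrite EFinM.
apply: ge0_integralZl_EFin k0; first exact: measurableT.
  by move=> x _; rewrite lee_fin.
exact: measurableT_comp.
Qed.

Lemma ge0_integralZ_ereal (k : \bar R) (f : T -> R) : 0 <= k ->
  measurable_fun setT f -> (forall x, 0 <= f x)%R ->
  \int[mu]_x (k * (f x)%:E) = k * \int[mu]_x (f x)%:E.
Proof.
move=> k0 mf f0; apply: ge0_integralZl k0; first exact: measurableT.
  exact: measurableT_comp.
by move=> x _; rewrite lee_fin.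
Qed.

Lemma ge0_integralDR (f g : T -> R) : measurable_fun setT f ->
  (forall x, 0 <= f x)%R -> measurable_fun setT g -> (forall x, 0 <= g x)%R ->
  \int[mu]_x (f x + g x)%:E = \int[mu]_x (f x)%:E + \int[mu]_x (g x)%:E.
Proof.
move=> mf f0 mg g0; under eq_integral do rewrite EFinD.
apply: ge0_integralD; first exact: measurableT.
- by move=> x _; rewrite lee_fin.
- exact: measurableT_comp.
- by move=> x _; rewrite lee_fin.
- exact: measurableT_comp.
Qed.

Lemma ge0_le_integralR (f g : T -> R) : measurable_fun setT f ->
  (forall x, 0 <= f x)%R -> measurable_fun setT g -> (forall x, f x <= g x)%R ->
  \int[mu]_x (f x)%:E <= \int[mu]_x (g x)%:E.
Proof.
move=> mf f0 mg fg; apply: ge0_le_integral; first exact: measurableT.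
- by move=> x _; rewrite lee_fin.
- exact: measurableT_comp.
- exact: measurableT_comp.
- by move=> x _; rewrite lee_fin.
Qed.

Lemma ge0_integral_sumR n (f : nat -> T -> R) :
  (forall k, measurable_fun setT (f k)) -> (forall k x, 0 <= f k x)%R ->
  \int[mu]_x (\sum_(k < n) f k x)%:E = \sum_(k < n) \int[mu]_x (f k x)%:E.
Proof.
move=> mf f0; under eq_integral do rewrite -sumEFin.
rewrite ge0_integral_sum; [by []|exact: measurableT| |].
  by move=> k; exact: measurableT_comp.
by move=> k x _; rewrite lee_fin.
Qed.

End integral_real.

Lemma ge0_fubini d1 d2 (T1 : measurableType d1) (T2 : measurableType d2)
    (R : realType) (m1 : {sigma_finite_measure set T1 -> \bar R})
    (m2 : {sigma_finite_measure set T2 -> \bar R}) (f : T1 -> T2 -> R) :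
  measurable_fun setT (fun p => f p.1 p.2) -> (forall x y, 0 <= f x y) ->
  (\int[m1]_x \int[m2]_y (f x y)%:E = \int[m2]_y \int[m1]_x (f x y)%:E)%E.
Proof.
move=> mf f0; apply: (fubini_tonelli (fun p => (f p.1 p.2)%:E)).
  exact/measurable_EFinP.
by move=> p; rewrite lee_fin.
Qed.

(** * Affine changes of variable on the real line *)

Section affine.
Context (R : realType).
Local Notation mu := (@lebesgue_measure R).

(** Half-open intervals are enough to characterise Lebesgue measure. For a < 0 the preimage is
    closed on the left and open on the right, which does not change its length. *)
Lemma lebesgue_measure_affine_preimage (a b l r : R) : a != 0 ->
  mu `]l, r] = (`|a|%:E *
    mu ((fun x : measurableTypeR R => (a * x + b)%R) @^-1` `]l, r]))%E.
Proof.
move=> a0; have [a_lt0|a_gt0|a00] := ltgtP a 0; last by rewrite a00 eqxx in a0.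
- have -> : (fun x : measurableTypeR R => a * x + b) @^-1` `]l, r] =
      `[(r - b) / a, (l - b) / a[%classic.
    apply/seteqP; split => x; rewrite /= !in_itv/= ler_ndivrMr// ltr_ndivlMr//;
      by rewrite -lerBrDr -ltrBlDr mulrC andbC.
  rewrite !lebesgue_measure_itv/= !lte_fin ltr_ndivlMr// mulfVK//.
  rewrite ltrBlDr subrK; case: ifPn => [lr|_]; last by rewrite mule0.
  by rewrite ltr0_norm// -!EFinB -EFinM; congr EFin; field; rewrite ltr0_neq0.
- have -> : (fun x : measurableTypeR R => a * x + b) @^-1` `]l, r] =
      `](l - b) / a, (r - b) / a]%classic.
    apply/seteqP; split => x; rewrite /= !in_itv/= ltr_pdivrMr// ler_pdivlMr//;
      by rewrite -lerBrDr -ltrBlDr mulrC.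
  rewrite !lebesgue_measure_itv/= !lte_fin ltr_pdivlMr// mulfVK//.
  rewrite ltrBlDr subrK; case: ifPn => [lr|_]; last by rewrite mule0.
  by rewrite gtr0_norm// -!EFinB -EFinM; congr EFin; field; rewrite lt0r_neq0.
Qed.

Lemma ge0_integral_affine (a b : R) (f : R -> \bar R) : a != 0 ->
  measurable_fun setT f -> (forall x, 0 <= f x)%E ->
  (\int[mu]_x f (a * x + b)%R = (`|a|^-1)%:E * \int[mu]_x f x)%E.
Proof.
move=> a0 mf f0; have a_ge0 : 0 <= `|a| by [].
pose phi (x : measurableTypeR R) : measurableTypeR R := a * x + b.
have mphi : measurable_fun setT phi.
  by apply: measurable_funD => //; exact: measurable_funM.
have -> : (\int[mu]_x f x = `|a|%:E * \int[mu]_x f (a * x + b)%R)%E.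
  have fE : (\int[mu]_x f (a * x + b)%R = \int[mu]_(x in phi @^-1` setT) (f \o phi) x)%E by [].
  rewrite fE -(ge0_integral_pushforward mphi)//.
  rewrite -[X in (X%:E * _)%E]/((NngNum a_ge0)%:num) -ge0_integral_mscale//.
  (* By uniqueness of Lebesgue measure, |a| times its image under x -> a x + b is Lebesgue measure
     again. *)
  apply: eq_measure_integral => A mA _.
  apply: lebesgue_measure_unique => //= _ [[l r]] _ <-.
  exact: lebesgue_measure_affine_preimage.
rewrite muleA -EFinM mulVf ?normr_eq0// mul1e//.
Qed.

End affine.

Lemma ge0_integral_affineR (R : realType) (a b : R) (f : R -> R) : a != 0 ->
  measurable_fun setT f -> (forall x, 0 <= f x) ->
  (\int[lebesgue_measure]_x (f (a * x + b))%:E =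
   (`|a|^-1)%:E * \int[lebesgue_measure]_x (f x)%:E)%E.
Proof.
move=> a0 mf f0; apply: (@ge0_integral_affine R a b (EFin \o f)) => //.
exact: measurableT_comp.
Qed.

(** * The Gamma function *)

Section gamma.
Context (R : realType).
Local Notation mu := (@lebesgue_measure R).

Lemma measurable_ltr_nat d (T : measurableType d) (f g : T -> R) :
  measurable_fun setT f -> measurable_fun setT g ->
  measurable_fun setT (fun x => (f x < g x)%R%:R : R).
Proof.
move=> mf mg.
have -> : (fun x => (f x < g x)%R%:R : R) = (fun b : bool => b%:R) \o (fun x => f x < g x)%R by [].
apply: measurableT_comp => //.
exact: measurable_fun_ltr.
Qed.

Lemma measurable_powRx d (T : measurableType d) (f : T -> R) p :
  measurable_fun setT f -> measurable_fun setT (fun x => f x `^ p).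
Proof. by move=> mf; apply: (measurableT_comp (measurable_powR p)). Qed.

Lemma measurable_expRx d (T : measurableType d) (f : T -> R) :
  measurable_fun setT f -> measurable_fun setT (fun x => expR (f x)).
Proof. by move=> mf; apply: (measurableT_comp (@measurable_expR R)). Qed.

(** The extended-real version of [Gamma]: its recursion is proved by Tonelli's theorem before its
    finiteness is known, and is then used to prove it. *)
Definition Gammae (x : R) : \bar R :=
  (\int[mu]_t ((0 < t)%R%:R * (t `^ (x - 1) * expR (- t)))%:E)%E.

Lemma GammaE x : Gamma x = fine (Gammae x).
Proof.
rewrite /Gamma /Rintegral integral_mkcond; congr fine; apply: eq_integral => t _.
rewrite patchE; case: ifPn.
  by rewrite inE/= in_itv/= andbT => ->; rewrite mul1r.
by rewrite notin_setE/= in_itv/= andbT => /negP/negbTE ->; rewrite mul0r.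
Qed.

Lemma Gammae_ge0 x : (0 <= Gammae x)%E.
Proof.
by apply: integral_ge0 => t _; rewrite lee_fin !mulr_ge0 ?ler0n ?powR_ge0 ?expR_ge0.
Qed.

Lemma measurable_gamma_integrand (x s : R) :
  measurable_fun setT (fun t : R => (0 < t)%R%:R * (t `^ (x - 1) * expR (- (s * t)))).
Proof.
apply: measurable_funM; first exact: measurable_ltr_nat.
apply: measurable_funM; first exact: measurable_powR.
by apply: measurable_expRx; apply: measurableT_comp => //; exact: measurable_funM.
Qed.

Lemma integral_powR_expR (x s : R) : 0 < s ->
  (\int[mu]_t ((0 < t)%R%:R * (t `^ (x - 1) * expR (- (s * t))))%:E =
  (s `^ (- x))%:E * Gammae x)%E.
Proof.
move=> s0; rewrite /Gammae.
pose f (t : R) : \bar R := ((0 < t)%R%:R * (t `^ (x - 1) * expR (- t)))%:E.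
have mf : measurable_fun setT f.
  by apply/measurable_EFinP; have := measurable_gamma_integrand x 1; under eq_fun do rewrite mul1r.
have f0 t : (0 <= f t)%E by rewrite lee_fin !mulr_ge0 ?ler0n ?powR_ge0 ?expR_ge0.
(* The factor s^(1-x) compensates (st)^(x-1); the Jacobian 1/s will turn it into s^(-x). The term +
   0 matches the affine substitution lemma. *)
transitivity (\int[mu]_t ((s `^ (1 - x))%:E * f (s * t + 0)%R)%E)%E.
  apply: eq_integral => t _; rewrite /f addr0 -EFinM pmulr_rgt0//.
  congr EFin; have [t0|] := ltP 0 t; last by rewrite !(mul0r,mulr0).
  rewrite !mul1r powRM ?(ltW s0) ?(ltW t0)// !mulrA -powRD ?(gt_eqF s0) ?implybT//.
  by rewrite addrA subrK subrr powRr0 mul1r.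
have mg : measurable_fun setT (fun t : R => f (s * t + 0)%R).
  by apply: measurableT_comp => //; apply: measurable_funD => //; exact: measurable_funM.
rewrite (ge0_integralZl_EFin mu measurableT _ mg (powR_ge0 _ _)); last by move=> *; exact: f0.
rewrite ge0_integral_affine ?gt_eqF// muleA -EFinM gtr0_norm//.
rewrite -powR_inv1 ?(ltW s0)// -powRD ?(gt_eqF s0) ?implybT//.
by congr ((_ `^ _)%:E * _)%E; ring.
Qed.

End gamma.

(** * Tail integrals of exponentials and powers *)

Section tails.
Context (R : realType).
Local Notation mu := (@lebesgue_measure R).

Lemma cvgy_powRN (x : R) : 0 < x -> t `^ (- x) @[t --> +oo] --> 0.
Proof.
move=> x0; apply/cvgrPdist_lt => e e0.
near=> t; rewrite sub0r normrN ger0_norm ?powR_ge0//.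
have t0 : 0 < t by near: t; exact: nbhs_pinfty_gt.
rewrite powRN invf_plt ?posrE ?powR_gt0//.
have -> : e^-1 = (e^-1 `^ x^-1) `^ x.
  by rewrite -powRrM mulVf ?gt_eqF// powRr1// invr_ge0 ltW.
apply: gt0_ltr_powR; rewrite ?nnegrE ?powR_ge0 ?(ltW t0)//.
Unshelve. all: by end_near. Qed.

Lemma ge0_integral_tail (f F : R -> R) (a : R) :
  (forall x, a <= x -> 0 <= f x) -> measurable_fun setT f ->
  {in `[a, +oo[, continuous f} -> F x @[x --> +oo] --> 0 ->
  (forall x : R, a <= x -> is_derive x (1 : R) F (f x)) ->
  (\int[mu]_t ((a < t)%R%:R * f t)%:E = (- F a)%:E)%E.
Proof.
move=> f0 mf cf Fy dF.
rewrite (_ : (- F a)%:E = (0%:E - (F a)%:E)%E); last by rewrite sub0e.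
rewrite -(ge0_continuous_FTC2y f0 _ Fy); first last.
- by move=> x; rewrite in_itv/= andbT => ax; rewrite derive1E; apply: derive_val; exact/dF/ltW.
- apply: cvg_at_right_filter; apply: differentiable_continuous.
  apply/derivable1_diffP; apply: ex_derive; exact: dF.
- by move=> x ax; apply: ex_derive; exact/dF/ltW.
- by apply: continuous_in_subspaceT => x; rewrite inE/=; exact: cf.
rewrite -integral_itv_obnd_cbnd; last exact: measurable_funTS (measurableT_comp _ mf).
rewrite [RHS]integral_mkcond; apply: eq_integral => t _.
rewrite patchE; case: ifPn.
  by rewrite inE/= in_itv/= andbT => ->; rewrite mul1r.
by rewrite notin_setE/= in_itv/= andbT => /negP/negbTE ->; rewrite mul0r.
Qed.

Lemma integral_expR_tail (s : R) :
  (\int[mu]_t ((s < t)%R%:R * expR (- t))%:E = (expR (- s))%:E)%E.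
Proof.
have dF (x : R) : s <= x -> is_derive x (1 : R) (fun t => - expR (- t)) (expR (- x)).
  by move=> _; apply: is_derive_eq; rewrite /GRing.scale/=; ring.
rewrite (ge0_integral_tail _ _ _ _ dF) ?opprK//.
- exact: measurable_expRx.
- move=> x _; apply: continuous_comp; [exact: opp_continuous|exact: continuous_expR].
- by rewrite -[0]oppr0; apply: cvgN; exact: cvgr_expR.
Qed.

Lemma integral_powR_tail (x : R) : 0 < x ->
  (\int[mu]_t ((1 < t)%R%:R * t `^ (- x - 1))%:E = (x^-1)%:E)%E.
Proof.
move=> x0.
have dF (t : R) : 1 <= t -> is_derive t (1 : R) (fun t => - (x^-1 * t `^ (- x))) (t `^ (- x - 1)).
  move=> t1; have t0 := lt_le_trans ltr01 t1.
  have ? := is_derive1_powR (- x) t0.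
  by apply: is_derive_eq; rewrite /GRing.scale/=; field; rewrite gt_eqF.
rewrite (ge0_integral_tail _ _ _ _ dF) ?powR1 ?opprK ?mulr1//.
- by move=> t _; exact: powR_ge0.
- move=> t; rewrite in_itv/= andbT => t1; have t0 := lt_le_trans ltr01 t1.
  apply: differentiable_continuous; apply/derivable1_diffP; apply: ex_derive.
  exact: is_derive1_powR.
- rewrite (_ : 0 = - (x^-1 * 0)); last by rewrite mulr0 oppr0.
  by apply: cvgN; apply: cvgMr => //; exact: cvgy_powRN.
Qed.

End tails.

(** * Recursion, finiteness, log-convexity and positivity of Gamma *)

Section gamma_rec.
Context (R : realType).
Local Notation mu := (@lebesgue_measure R).

Lemma measurable_natmul_lt (a : R) (f : R -> R) : measurable_fun setT f ->
  measurable_fun setT (fun t => (a < t)%R%:R * f t).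
Proof. by move=> mf; apply: measurable_funM => //; exact: measurable_ltr_nat. Qed.

(* Integrating the scaling law [Gamma x * s^-x = int t^(x-1) e^(-st) dt] over s > 1. *)
Lemma Gammae_rec (x : R) : 0 < x -> (Gammae (x + 1) = x%:E * Gammae x)%E.
Proof.
move=> x0.
pose F (s t : R) : R := (1 < s)%R%:R * ((0 < t)%R%:R *
  (t `^ (x + 1 - 1) * expR (- (s * t)))).
have mF : measurable_fun setT (fun p : R * R => F p.1 p.2).
  apply: measurable_funM.
    by apply: measurable_ltr_nat => //; exact: measurable_fst.
  apply: measurable_funM.
    by apply: measurable_ltr_nat => //; exact: measurable_snd.
  apply: measurable_funM; first by apply: measurable_powRx; exact: measurable_snd.
  apply: measurable_expRx; apply: measurableT_comp => //.
  by apply: measurable_funM; [exact: measurable_fst|exact: measurable_snd].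
have F0 s t : 0 <= F s t by rewrite !mulr_ge0 ?ler0n ?powR_ge0 ?expR_ge0.
have E : (\int[mu]_s \int[mu]_t (F s t)%:E = \int[mu]_t \int[mu]_s (F s t)%:E)%E.
  exact: (ge0_fubini mu mu mF F0).
have E1 : (\int[mu]_s \int[mu]_t (F s t)%:E = (x^-1)%:E * Gammae (x + 1))%E.
  transitivity (\int[mu]_s (Gammae (x + 1) * ((1 < s)%R%:R * s `^ (- x - 1))%:E))%E.
    apply: eq_integral => s _.
    rewrite /F ge0_integralZ; [|exact: ler0n|exact: measurable_gamma_integrand|].
    - have [s1|] := ltP 1 s; last by rewrite !mul0r mul0e mule0.
      rewrite (integral_powR_expR _ (lt_trans ltr01 s1)).
      rewrite -[true%:R]/(1 : R) mul1r mul1e muleC.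
      by rewrite opprD.
    - by move=> t; rewrite !mulr_ge0 ?ler0n ?powR_ge0 ?expR_ge0.
  rewrite ge0_integralZ_ereal; [|exact: Gammae_ge0|by apply: measurable_natmul_lt;
    exact: measurable_powR|].
  - by rewrite (integral_powR_tail x0) muleC.
  - by move=> s; rewrite mulr_ge0 ?ler0n ?powR_ge0.
have E2 : (\int[mu]_t \int[mu]_s (F s t)%:E = Gammae x)%E.
  apply: eq_integral => t _.
  have [t0|t0] := ltP 0 t; last first.
    rewrite -[false%:R]/(0 : R) mul0r; apply: integral0_eq => s _.
    by rewrite /F (ltNge 0 t) t0 mul0r mulr0.
  pose G (u : R) := (t < u)%R%:R * expR (- u).
  have mG : measurable_fun setT G.
    by apply: measurable_natmul_lt; exact: measurable_expRx.
  have G0 u : 0 <= G u by rewrite mulr_ge0 ?ler0n ?expR_ge0.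
  (* The substitution u = t s turns the cutoff s > 1 into u > t, so that the inner integral is an
     exponential tail. *)
  have FG s : F s t = t `^ x * G (t * s + 0).
    have ts : (t < t * s) = (1 < s) by rewrite -[X in X < _]mulr1 ltr_pM2l.
    rewrite /F /G t0 addrK addr0 (mulrC s t) ts -[true%:R]/(1 : R); ring.
  under eq_integral do rewrite FG.
  have mt : measurable_fun setT (fun s : R => t * s + 0).
    by apply: measurable_funD => //; exact: measurable_funM.
  have mGt : measurable_fun setT (fun s => G (t * s + 0)) := measurableT_comp mG mt.
  rewrite ge0_integralZ; [|exact: powR_ge0|exact: mGt|by move=> s; exact: G0].
  rewrite (ge0_integral_affineR _ (lt0r_neq0 t0) mG G0).
  rewrite integral_expR_tail (gtr0_norm t0) -!EFinM; congr EFin.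
  rewrite -[true%:R]/(1 : R) mul1r mulrA -(powR_inv1 (ltW t0)) -powRD;
    last by rewrite (gt_eqF t0) implybT.
  by congr (_ `^ _ * _); ring.
move: (etrans (esym E1) (etrans E E2)); set a := Gammae (x + 1); set b := Gammae x => <-.
rewrite muleA -EFinM (divff (lt0r_neq0 x0)) mul1e; reflexivity.
Qed.

Lemma Gammae1 : Gammae (1 : R) = 1%E.
Proof.
rewrite /Gammae; under eq_integral do rewrite subrr powRr0 mul1r.
by rewrite integral_expR_tail oppr0 expR0.
Qed.

Lemma Gammae_nat (n : nat) : Gammae (n.+1%:R : R) = (n`!%:R)%:E.
Proof.
elim: n => [|n IH]; first exact: Gammae1.
by rewrite -natr1 (Gammae_rec (ltr0Sn _ _)) IH -EFinM -natrM factS.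
Qed.

(** For y >= 1 the integrand is at most the sum of those at 1 and at an integer above y (t^(y-1) is
    at most 1 for t < 1, and at most the integer power for t >= 1), where the values are factorials.
    Below 1, finiteness of x * Gamma x = Gamma (x + 1) forces that of Gamma x. *)
Lemma Gammae_fin (x : R) : 0 < x -> (Gammae x < +oo)%E.
Proof.
have H (y : R) : 1 <= y -> (Gammae y < +oo)%E.
  move=> y1; pose n := (Num.bound y).+1.
  have yn : y <= n.+1%:R.
    rewrite (le_trans (ltW (archi_boundP (le_trans ler01 y1))))//.
    by rewrite ler_nat /n; lia.
  apply: (@le_lt_trans _ _ (Gammae 1 + Gammae n.+1%:R)%E); last first.
    by rewrite Gammae1 Gammae_nat -EFinD ltry.
  have mI z : measurable_fun setT (fun t : R => (0 < t)%R%:R * (t `^ (z - 1) * expR (- t))).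
    by have := measurable_gamma_integrand z 1; under eq_fun do rewrite mul1r.
  have I0 z (t : R) : 0 <= (0 < t)%R%:R * (t `^ (z - 1) * expR (- t)).
    by rewrite !mulr_ge0 ?ler0n ?powR_ge0 ?expR_ge0.
  rewrite /Gammae -(ge0_integralD mu measurableT); first last.
  - exact: measurableT_comp (mI _).
  - by move=> t _; rewrite lee_fin.
  - exact: measurableT_comp (mI _).
  - by move=> t _; rewrite lee_fin.
  apply: ge0_le_integral => //.
  - by move=> t _; rewrite lee_fin.
  - exact: measurableT_comp (mI _).
  - by apply: emeasurable_funD; exact: measurableT_comp (mI _).
  - move=> t _; rewrite -EFinD lee_fin -mulrDr -mulrDl.
    apply: ler_wpM2l => //; apply: ler_wpM2r; first exact: expR_ge0.
    have [t1|t1] := leP 1 t.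
      by rewrite ler_wpDl ?powR_ge0// ler_powR// lerD2r.
    rewrite ler_wpDr ?powR_ge0// subrr powRr0.
    rewrite /powR; case: ifP => _; first by rewrite lern1 leq_b1.
    by rewrite -[leRHS]expR0 ler_expR mulr_ge0_le0 ?subr_ge0// ln_le0// ltW.
move=> x0; have := H (x + 1); rewrite lerDr (ltW x0) (Gammae_rec x0) => /(_ isT).
rewrite !ltey; apply: contra => /eqP ->.
by rewrite gt0_muley ?lte_fin.
Qed.

Lemma Gammae_Gamma (x : R) : 0 < x -> Gammae x = (Gamma x)%:E.
Proof. by move=> x0; rewrite GammaE fineK// ge0_fin_numE ?Gammae_ge0 ?Gammae_fin. Qed.

Lemma Gamma_rec (x : R) : 0 < x -> Gamma (x + 1) = x * Gamma x.
Proof. by move=> x0; rewrite GammaE (Gammae_rec x0) (Gammae_Gamma x0). Qed.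

Lemma Gamma_nat (n : nat) : Gamma (n.+1%:R : R) = n`!%:R.
Proof. by rewrite GammaE Gammae_nat. Qed.

Lemma Gamma_ge0 (x : R) : 0 <= Gamma x.
Proof. by rewrite GammaE fine_ge0// Gammae_ge0. Qed.

(** The discriminant argument: l = m / x is the minimiser. If x = 0 and m > 0, the inequality 2 l m
    <= y already fails at l = (y + 1) / m. *)
Lemma sqr_le_of_quadratic (m x y : R) : 0 <= m -> 0 <= x -> 0 <= y ->
  (forall l, 0 < l -> 2 * l * m <= l ^+ 2 * x + y) -> m ^+ 2 <= x * y.
Proof.
move=> m0 x0 y0 key; move: m0; rewrite le_eqVlt => /predU1P[<-|m0].
  by rewrite expr0n mulr_ge0.
move: x0; rewrite le_eqVlt => /predU1P[x0|x0].
  have := key ((y + 1) / m); rewrite divr_gt0 ?ltr_wpDl// => /(_ isT).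
  have -> : 2 * ((y + 1) / m) * m = 2 * (y + 1) by field; rewrite gt_eqF.
  by rewrite -x0; lra.
have := key (m / x); rewrite divr_gt0// => /(_ isT).
rewrite -(ler_pM2r x0).
have -> : 2 * (m / x) * m * x = 2 * m ^+ 2 by field; rewrite gt_eqF.
have -> : ((m / x) ^+ 2 * x + y) * x = m ^+ 2 + x * y by field; rewrite gt_eqF.
lra.
Qed.

(* AM-GM in the integrand: 2 l t^(m-1) <= l^2 t^(x-1) + t^(y-1). *)
Lemma Gammae_amgm (m x y l : R) : x + y = m + m -> 0 < l ->
  ((2 * l)%:E * Gammae m <= (l ^+ 2)%:E * Gammae x + Gammae y)%E.
Proof.
move=> xym l0.
pose g z (t : R) : R := (0 < t)%R%:R * (t `^ (z - 1) * expR (- t)).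
have mg z : measurable_fun setT (g z).
  by have := measurable_gamma_integrand z 1; under eq_fun do rewrite mul1r.
have g0 z t : 0 <= g z t by rewrite !mulr_ge0 ?ler0n ?powR_ge0 ?expR_ge0.
have l2 : 0 <= 2 * l by rewrite mulr_ge0// ltW.
have le : 0 <= l ^+ 2 by rewrite sqr_ge0.
have mZ z k : measurable_fun setT (fun t => k * g z t) by exact: measurable_funM.
rewrite /Gammae -(ge0_integralZ mu l2 (mg m) (g0 m)) -(ge0_integralZ mu le (mg x) (g0 x)).
rewrite -(ge0_integralDR mu (mZ x _) _ (mg y) (g0 y)); last by move=> t; rewrite mulr_ge0.
apply: ge0_le_integralR; first exact: mZ.
- by move=> t; rewrite mulr_ge0.
- by apply: measurable_funD; [exact: mZ|exact: mg].
- move=> t; rewrite /g.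
  have [t0|t0] := ltP 0 t; last by rewrite !mul0r !mulr0 addr0.
  rewrite !mul1r !mulrA -mulrDl; apply: ler_wpM2r; first exact: expR_ge0.
  set a := t `^ ((x - 1) / 2); set b := t `^ ((y - 1) / 2).
  have tr p : t `^ p = t `^ (p / 2) ^+ 2.
    by rewrite -powR_mulrn ?powR_ge0// -powRrM divfK.
  rewrite (tr (x - 1)) (tr (y - 1)) -/a -/b.
  have -> : t `^ (m - 1) = a * b.
    rewrite /a /b -powRD; last by rewrite (gt_eqF t0) implybT.
    by congr (_ `^ _); lra.
  by rewrite -subr_ge0 (_ : _ - _ = (l * a - b) ^+ 2) ?sqr_ge0//; ring.
Qed.

(** The Cauchy-Schwarz inequality for t^((x-1)/2) and t^((y-1)/2) with weight e^(-t), obtained by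
    optimising [Gammae_amgm] over l. *)
Lemma Gamma_midpoint (m x y : R) : x + y = m + m -> 0 < m -> 0 < x -> 0 < y ->
  Gamma m ^+ 2 <= Gamma x * Gamma y.
Proof.
move=> xym m0 x0 y0; apply: sqr_le_of_quadratic; [exact: Gamma_ge0..|move=> l l0].
have := Gammae_amgm xym l0.
by rewrite (Gammae_Gamma m0) (Gammae_Gamma x0) (Gammae_Gamma y0).
Qed.

(** An integer n + 1 > x is the midpoint of x and 2 (n + 1) - x, so Gamma x = 0 would give n!^2 <= 0
    by log-convexity. *)
Lemma Gamma_gt0 (x : R) : 0 < x -> 0 < Gamma x.
Proof.
move=> x0; rewrite lt_def Gamma_ge0 andbT; apply/eqP => G0.
pose n := Num.bound x.
have xn : x < n.+1%:R.
  by rewrite (lt_trans (archi_boundP (ltW x0)))// ltr_nat.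
have y0 : 0 < n.+1%:R * 2 - x by lra.
have xy : x + (n.+1%:R * 2 - x) = n.+1%:R + n.+1%:R by ring.
have := Gamma_midpoint xy (ltr0Sn _ _) x0 y0.
rewrite G0 mul0r Gamma_nat.
by apply/negP; rewrite -ltNge exprn_gt0// ltr0n fact_gt0.
Qed.

End gamma_rec.

(** * The binomial series *)

Section binomial_series.
Context (R : realType).
Local Notation mu := (@lebesgue_measure R).

(** The coefficient of x^k in (1 - x)^(-b). *)
Definition binom_coef (b : R) (k : nat) : R := \prod_(i < k) (b + i%:R) / k`!%:R.

Lemma binom_coef_ge0 (b : R) k : 0 < b -> 0 <= binom_coef b k.
Proof.
move=> b0; rewrite /binom_coef divr_ge0// prodr_ge0// => i _.
by rewrite addr_ge0// ltW.
Qed.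

Lemma Gamma_addn (b : R) k : 0 < b -> Gamma (b + k%:R) = k`!%:R * binom_coef b k * Gamma b.
Proof.
move=> b0; rewrite /binom_coef [_%:R * _]mulrC divfK; last by rewrite pnatr_eq0 -lt0n fact_gt0.
elim: k => [|k IH]; first by rewrite addr0 big_ord0 mul1r.
have bk : 0 < b + k%:R by rewrite ltr_wpDr.
by rewrite -natr1 addrA (Gamma_rec bk) IH big_ord_recr/= -!mulrA mulrCA.
Qed.

Lemma sum_expR_le (x : R) n : 0 <= x -> \sum_(k < n) x ^+ k / k`!%:R <= expR x.
Proof.
move=> x0; have := nondecreasing_cvgn_le _ (is_cvg_series_exp_coeff x) n.
rewrite /series/= big_mkord; apply.
apply/nondecreasing_seqP => m; rewrite big_nat_recr//= lerDl.
exact: exp_coeff_ge0.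
Qed.

(** After multiplication by Gamma b, the k-th term is the integral of ((t x)^k / k!) t^(b-1) e^(-t).
    The partial sums of exp (t x) stay below exp (t x), and the integral of t^(b-1) e^(-(1-x)t) is
    (1 - x)^(-b) Gamma b. *)
Lemma sum_binom_coef_le (b x : R) n : 0 < b -> 0 <= x < 1 ->
  \sum_(k < n) binom_coef b k * x ^+ k <= (1 - x) `^ (- b).
Proof.
move=> b0 /andP[x0 x1]; rewrite -(ler_pM2r (Gamma_gt0 b0)) mulr_suml.
pose g z (t : R) : R := (0 < t)%R%:R * (t `^ (z - 1) * expR (- t)).
have mg z : measurable_fun setT (g z).
  by have := measurable_gamma_integrand z 1; under eq_fun do rewrite mul1r.
have g0 z t : 0 <= g z t by rewrite !mulr_ge0 ?ler0n ?powR_ge0 ?expR_ge0.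
have x10 : 0 < 1 - x by rewrite subr_gt0.
rewrite -lee_fin EFinM -(Gammae_Gamma b0) -(integral_powR_expR _ x10).
have -> : (\sum_(k < n) binom_coef b k * x ^+ k * Gamma b)%:E =
    (\int[mu]_t (\sum_(k < n) x ^+ k / k`!%:R * g (b + k%:R)%R t)%:E)%E.
  have xk k : 0 <= x ^+ k / k`!%:R by rewrite divr_ge0// exprn_ge0.
  rewrite (@ge0_integral_sumR _ _ _ mu n (fun k t => x ^+ k / k`!%:R * g (b + k%:R)%R t));
    last 2 first.
  - by move=> k; apply: measurable_funM; [exact: measurable_cst|exact: mg].
  - by move=> k t; rewrite mulr_ge0.
  rewrite -sumEFin; apply: eq_bigr => k _.
  rewrite (ge0_integralZ mu (xk k) (mg _) (g0 _)).
  have bk : 0 < b + k%:R by rewrite ltr_wpDr.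
  rewrite -/(Gammae (b + k%:R)) (Gammae_Gamma bk) -EFinM; congr EFin.
  rewrite Gamma_addn//; field.
  by rewrite pnatr_eq0 -lt0n fact_gt0.
apply: ge0_le_integralR.
- by apply: measurable_sum => k; apply: measurable_funM; [exact: measurable_cst|exact: mg].
- by move=> t; apply: sumr_ge0 => k _; rewrite mulr_ge0// divr_ge0// exprn_ge0.
- exact: measurable_gamma_integrand.
- move=> t; rewrite /g; have [t0|t0] := ltP 0 t; last first.
    by rewrite mul0r big1// => k _; rewrite mul0r mulr0.
  have -> : \sum_(k < n) x ^+ k / k`!%:R * (true%:R * (t `^ (b + k%:R - 1) * expR (- t))) =
     (\sum_(k < n) (t * x) ^+ k / k`!%:R) * (t `^ (b - 1) * expR (- t)).
    rewrite mulr_suml; apply: eq_bigr => k _.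
    have -> : t `^ (b + k%:R - 1) = t `^ (b - 1) * t ^+ k.
      rewrite -(powR_mulrn k (ltW t0)) -powRD; last by rewrite (gt_eqF t0) implybT.
      by congr (_ `^ _); ring.
    rewrite exprMn -[true%:R]/(1 : R); ring.
  rewrite -[true%:R]/(1 : R) mul1r.
  have -> : t `^ (b - 1) * expR (- ((1 - x) * t)) = expR (t * x) * (t `^ (b - 1) * expR (- t)).
    by rewrite mulrCA -expRD; congr (_ * expR _); ring.
  apply: ler_wpM2r; first by rewrite mulr_ge0 ?powR_ge0 ?expR_ge0.
  by apply: sum_expR_le; rewrite mulr_ge0// ltW.
Qed.

End binomial_series.

(** * The squared modulus of the binomial series at a complex point *)

Section modulus_binomial_series.
Context (R : realType).
Local Open Scope complex_scope.

Lemma normc_ge0 (z : R[i]) : 0 <= ComplexField.Normc.normc z.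
Proof. by case: z => x y; exact: sqrtr_ge0. Qed.

Lemma normcX (z : R[i]) n :
  ComplexField.Normc.normc (z ^+ n) = ComplexField.Normc.normc z ^+ n.
Proof.
elim: n => [|n IH]; first by rewrite !expr0 normc1.
by rewrite !exprS normcM IH.
Qed.

Lemma normr_Re_le (z : R[i]) : `|complex.Re z| <= ComplexField.Normc.normc z.
Proof.
by case: z => x y; rewrite /= -sqrtr_sqr ler_sqrt ?lerDl ?addr_ge0 ?sqr_ge0.
Qed.

Lemma normr_Im_le (z : R[i]) : `|complex.Im z| <= ComplexField.Normc.normc z.
Proof.
by case: z => x y; rewrite /= -sqrtr_sqr ler_sqrt ?lerDr ?addr_ge0 ?sqr_ge0.
Qed.

(** Coefficient form of the derivative of (1 - x)^(-b), which is b (1 - x)^(-b-1). *)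
Lemma binom_coefS (b : R) k : k.+1%:R * binom_coef b k.+1 = b * binom_coef (b + 1) k.
Proof.
rewrite /binom_coef big_ord_recl/= addr0 factS natrM.
have -> : \prod_(i < k) (b + (lift ord0 i)%:R) = \prod_(i < k) (b + 1 + i%:R).
  by apply: eq_bigr => i _; rewrite /= /bump/= natrD; ring.
have : k.+1%:R != 0 :> R by rewrite pnatr_eq0.
have : k`!%:R != 0 :> R by rewrite pnatr_eq0 -lt0n fact_gt0.
by move: (k.+1%:R : R) (k`!%:R : R) => K F F0 K0; field; rewrite F0 K0.
Qed.

(** Coefficient form of (1 - x) (1 - x)^(-b-1) = (1 - x)^(-b). *)
Lemma binom_coef_diff (b : R) k :
  binom_coef (b + 1) k.+1 - binom_coef (b + 1) k = binom_coef b k.+1.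
Proof.
have k0 : k.+1%:R != 0 :> R by rewrite pnatr_eq0.
apply: (mulfI k0); rewrite binom_coefS mulrBr.
have -> : k.+1%:R * binom_coef (b + 1) k.+1 = (b + 1 + k%:R) * binom_coef (b + 1) k.
  rewrite /binom_coef big_ord_recr/= factS natrM.
  have : k`!%:R != 0 :> R by rewrite pnatr_eq0 -lt0n fact_gt0.
  by move: (k.+1%:R : R) (k`!%:R : R) k0 => K F K0 F0; field; rewrite F0 K0.
by rewrite -natr1; ring.
Qed.

Lemma pseries_binom_cvg (f : R^nat) (C b r x : R) : 0 < b -> 0 <= r ->
  `|x| * r < 1 -> (forall k, `|f k| <= C * (binom_coef b k * r ^+ k)) ->
  cvgn (pseries f x).
Proof.
move=> b0 r0 xr1 fC; apply: normed_cvg.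
have C0 : 0 <= C.
  have := le_trans (normr_ge0 _) (fC 0%N).
  by rewrite /binom_coef big_ord0 fact0 expr0 divr1 !mulr1.
apply: nondecreasing_is_cvgn.
  by apply: nondecreasing_series => n _ _; exact: normr_ge0.
exists (C * (1 - `|x| * r) `^ (- b)) => _ [n _ <-].
rewrite (_ : [normed _] n = \sum_(0 <= k < n) `|f k * x ^+ k|)// big_mkord.
apply: (@le_trans _ _ (C * (\sum_(k < n) binom_coef b k * (`|x| * r) ^+ k))).
  rewrite mulr_sumr; apply: ler_sum => k _.
  rewrite normrM normrX exprMn mulrC.
  rewrite [leRHS](_ : _ = `|x| ^+ k * (C * (binom_coef b k * r ^+ k))); last by ring.
  apply: ler_wpM2l; first exact: exprn_ge0.
  exact: fC.
apply: ler_wpM2l => //; apply: sum_binom_coef_le => //.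
by rewrite xr1 mulr_ge0.
Qed.

(** Differentiation keeps this type of domination and only raises b by 1. Hence the first and second
    derived series, whose convergence termwise differentiation requires, are handled by the same
    convergence criterion. *)
Lemma binom_coef_bound_diffs (f : R^nat) (C b r : R) : 0 < b -> 0 <= r ->
  (forall k, `|f k| <= C * (binom_coef b k * r ^+ k)) ->
  forall k, `|pseries_diffs f k| <= (C * b * r) * (binom_coef (b + 1) k * r ^+ k).
Proof.
move=> b0 r0 fC k; rewrite /pseries_diffs normrM normr_nat.
rewrite [leRHS](_ : _ = k.+1%:R * (C * (binom_coef b k.+1 * r ^+ k.+1))).
  exact: ler_wpM2l.
rewrite exprS [RHS](_ : _ = C * (k.+1%:R * binom_coef b k.+1) * (r * r ^+ k)); last by ring.
by rewrite binom_coefS; ring.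
Qed.

Section norm_constant.
Variables (u : R[i]) (hu : ComplexField.Normc.normc u < 1).
Local Notation a := (complex.Re u).
Local Notation b := (complex.Im u).
Local Notation r := (ComplexField.Normc.normc u).

(* [hc be] and [hs be] are the real and imaginary parts of the coefficients of
   (1 - t u)^(-be) as a power series in the real variable t.  The sum of the
   series is identified through the derivative of
   |(1 - t u)^(-be)|^2 |1 - t u|^(2 be), which vanishes.  [K > 1] keeps t = 1
   inside the disc of convergence. *)
Let hc (be : R) (k : nat) : R := binom_coef be k * complex.Re (u ^+ k).
Let hs (be : R) (k : nat) : R := binom_coef be k * complex.Im (u ^+ k).
Let K : R := 2 / (1 + r).

Let r0 : 0 <= r. Proof. exact: normc_ge0. Qed.
Let r1 : 0 < 1 + r. Proof. by rewrite ltr_wpDr. Qed.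
Let K0 : 0 < K. Proof. exact: divr_gt0. Qed.
Let K1 : 1 < K.
Proof. by rewrite /K (ltr_pdivlMr _ _ r1) mul1r (_ : 2 = 1 + 1)// ltrD2l. Qed.
Let Kr (x : R) : `|x| <= `|K| -> `|x| * r < 1.
Proof.
move=> xK; apply: (@le_lt_trans _ _ (K * r)).
  by rewrite ler_wpM2r// (le_trans xK)// gtr0_norm.
by rewrite /K mulrAC (ltr_pdivrMr _ _ r1) mul1r (_ : 2 * r = r + r) ?ltrD2r//; ring.
Qed.

Let hcP be : 0 < be -> forall k, `|hc be k| <= 1 * (binom_coef be k * r ^+ k).
Proof.
move=> be0 k; rewrite mul1r /hc normrM (ger0_norm (binom_coef_ge0 k be0)).
by apply: ler_wpM2l; [exact: binom_coef_ge0|rewrite -normcX; exact: normr_Re_le].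
Qed.

Let hsP be : 0 < be -> forall k, `|hs be k| <= 1 * (binom_coef be k * r ^+ k).
Proof.
move=> be0 k; rewrite mul1r /hs normrM (ger0_norm (binom_coef_ge0 k be0)).
by apply: ler_wpM2l; [exact: binom_coef_ge0|rewrite -normcX; exact: normr_Im_le].
Qed.

Let ReS k : complex.Re (u ^+ k.+1) = a * complex.Re (u ^+ k) - b * complex.Im (u ^+ k).
Proof. by rewrite exprS; case: (u) (u ^+ k) => ? ? [? ?]. Qed.

Let ImS k : complex.Im (u ^+ k.+1) = a * complex.Im (u ^+ k) + b * complex.Re (u ^+ k).
Proof. by rewrite exprS; case: (u) (u ^+ k) => ? ? [? ?]. Qed.

(** With [dhs], the real and imaginary parts of d/dt (1 - t u)^(-be) = be u (1 - t u)^(-be-1). *)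
Let dhc be : pseries_diffs (hc be) = fun k => be * (a * hc (be + 1) k - b * hs (be + 1) k).
Proof.
apply/funext => k; rewrite /pseries_diffs /hc /hs mulrA binom_coefS ReS; ring.
Qed.

Let dhs be : pseries_diffs (hs be) = fun k => be * (a * hs (be + 1) k + b * hc (be + 1) k).
Proof.
apply/funext => k; rewrite /pseries_diffs /hc /hs mulrA binom_coefS ImS; ring.
Qed.

Let H (f : R^nat) (t : R) : R := limn (pseries f t).

Let H_cvg (f : R^nat) C be t : 0 < be ->
  (forall k, `|f k| <= C * (binom_coef be k * r ^+ k)) -> `|t| <= `|K| ->
  pseries f t n @[n --> \oo] --> H f t.
Proof. by move=> be0 fC tK; exact: (pseries_binom_cvg be0 r0 (Kr tK) fC). Qed.

Let H_derive (f : R^nat) C be t : 0 < be ->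
  (forall k, `|f k| <= C * (binom_coef be k * r ^+ k)) -> `|t| < `|K| ->
  is_derive t (1 : R) (H f) (H (pseries_diffs f) t).
Proof.
move=> be0 fC tK.
have be1 : 0 < be + 1 by rewrite addr_gt0.
have fC1 := binom_coef_bound_diffs be0 r0 fC.
have fC2 := binom_coef_bound_diffs be1 r0 fC1.
apply: (@pseries_snd_diffs R f K) => //.
- exact: (pseries_binom_cvg be0 r0 (Kr (lexx _)) fC).
- exact: (pseries_binom_cvg be1 r0 (Kr (lexx _)) fC1).
- by apply: (pseries_binom_cvg _ r0 (Kr (lexx _)) fC2); rewrite addr_gt0.
Qed.

Let pseriesS (f : R^nat) t n : pseries f t n.+1 = pseries f t n + f n * t ^+ n.
Proof. by rewrite /pseries /series/= big_nat_recr. Qed.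

(** With [rec_s], the identity (1 - t u) (1 - t u)^(-be-1) = (1 - t u)^(-be) at the level of partial
    sums. Taking n + 1 terms in the first sum and n in the one multiplied by t u makes it exact,
    without remainder. *)
Let rec_c be t n : pseries (hc (be + 1)) t n.+1 -
  t * (a * pseries (hc (be + 1)) t n - b * pseries (hs (be + 1)) t n) =
  pseries (hc be) t n.+1.
Proof.
elim: n => [|n IH].
  by rewrite /pseries /series/= !big_nat1 !big_geq// /hc /binom_coef !big_ord0; ring.
rewrite pseriesS (pseriesS (hc be)) -IH.
rewrite [in LHS](pseriesS (hc (be + 1)) t n) [in LHS](pseriesS (hs (be + 1)) t n).
rewrite [in RHS](pseriesS (hc (be + 1)) t n).
rewrite /hc /hs -(binom_coef_diff be n) ReS exprS; ring.
Qed.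

Let rec_s be t n : pseries (hs (be + 1)) t n.+1 -
  t * (a * pseries (hs (be + 1)) t n + b * pseries (hc (be + 1)) t n) =
  pseries (hs be) t n.+1.
Proof.
elim: n => [|n IH].
  by rewrite /pseries /series/= !big_nat1 !big_geq// /hs /binom_coef !big_ord0; ring.
rewrite pseriesS (pseriesS (hs be)) -IH.
rewrite [in LHS](pseriesS (hc (be + 1)) t n) [in LHS](pseriesS (hs (be + 1)) t n).
rewrite [in RHS](pseriesS (hs (be + 1)) t n).
rewrite /hc /hs -(binom_coef_diff be n) ImS exprS; ring.
Qed.

Variables (be : R) (be0 : 0 < be).
Let be1 : 0 < be + 1. Proof. by rewrite addr_gt0. Qed.

Let X t := H (hc (be + 1)) t.
Let Y t := H (hs (be + 1)) t.
Let A t := H (hc be) t.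
Let B t := H (hs be) t.

Let AE t : `|t| <= `|K| -> A t = X t - t * (a * X t - b * Y t).
Proof.
move=> tK; have cX := H_cvg be1 (hcP be1) tK; have cY := H_cvg be1 (hsP be1) tK.
have cA := H_cvg be0 (hcP be0) tK.
have cA1 : (fun n => pseries (hc (be + 1)) t n.+1 - t * (a * pseries (hc (be + 1)) t n
    - b * pseries (hs (be + 1)) t n)) @ \oo --> A t.
  by rewrite (funext (rec_c be t)) (cvg_shiftS (pseries (hc be) t)).
apply: (cvg_unique _ cA1); first exact: norm_hausdorff.
apply: cvgB; first by rewrite (cvg_shiftS (pseries (hc (be + 1)) t)).
by apply: cvgMr; apply: cvgB; apply: cvgMr.
Qed.

Let BE t : `|t| <= `|K| -> B t = Y t - t * (a * Y t + b * X t).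
Proof.
move=> tK; have cX := H_cvg be1 (hcP be1) tK; have cY := H_cvg be1 (hsP be1) tK.
have cA := H_cvg be0 (hsP be0) tK.
have cA1 : (fun n => pseries (hs (be + 1)) t n.+1 - t * (a * pseries (hs (be + 1)) t n
    + b * pseries (hc (be + 1)) t n)) @ \oo --> B t.
  by rewrite (funext (rec_s be t)) (cvg_shiftS (pseries (hs be) t)).
apply: (cvg_unique _ cA1); first exact: norm_hausdorff.
apply: cvgB; first by rewrite (cvg_shiftS (pseries (hs (be + 1)) t)).
by apply: cvgMr; apply: cvgD; apply: cvgMr.
Qed.

Let dAE t : `|t| < `|K| -> is_derive t (1 : R) A (be * (a * X t - b * Y t)).
Proof.
move=> tK; have := H_derive be0 (hcP be0) tK; rewrite dhc.
congr (is_derive _ _ _ _); apply: cvg_lim => //.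
have cX := H_cvg be1 (hcP be1) (ltW tK); have cY := H_cvg be1 (hsP be1) (ltW tK).
rewrite (_ : pseries _ t = fun n => be * (a * pseries (hc (be + 1)) t n - b * pseries (hs (be +
  1)) t n)).
  by apply: cvgMr; apply: cvgB; apply: cvgMr.
apply/funext => n; rewrite /pseries /series/= !mulr_sumr -sumrB mulr_sumr.
by apply: eq_bigr => k _; ring.
Qed.

Let dBE t : `|t| < `|K| -> is_derive t (1 : R) B (be * (a * Y t + b * X t)).
Proof.
move=> tK; have := H_derive be0 (hsP be0) tK; rewrite dhs.
congr (is_derive _ _ _ _); apply: cvg_lim => //.
have cX := H_cvg be1 (hcP be1) (ltW tK); have cY := H_cvg be1 (hsP be1) (ltW tK).
rewrite (_ : pseries _ t = fun n => be * (a * pseries (hs (be + 1)) t n + b * pseries (hc (be +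
  1)) t n)).
  by apply: cvgMr; apply: cvgD; apply: cvgMr.
apply/funext => n; rewrite /pseries /series/= !mulr_sumr -big_split/= mulr_sumr.
by apply: eq_bigr => k _; ring.
Qed.

(** This is |1 - t u|^2. *)
Let q t : R := (1 - t * a) ^+ 2 + (t * b) ^+ 2.

Let q0 t : `|t| <= `|K| -> 0 < q t.
Proof.
move=> tK; rewrite /q ltr_wpDr ?sqr_ge0// exprn_gt0// subr_gt0.
apply: (le_lt_trans (ler_norm _)); apply: le_lt_trans (Kr tK).
by rewrite normrM ler_wpM2l// normr_Re_le.
Qed.

Let phi t : R := (A t ^+ 2 + B t ^+ 2) * q t `^ be.

Let dphi t : `|t| < `|K| -> is_derive t (1 : R) phi 0.
Proof.
move=> tK; have dA := dAE tK; have dB := dBE tK.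
have qt := q0 (ltW tK).
have dq : is_derive t (1 : R) q (- 2 * (a - t * (a ^+ 2 + b ^+ 2))).
  by apply: is_derive_eq; rewrite /GRing.scale/=; ring.
have dqb : is_derive t (1 : R) (fun t => q t `^ be)
    (be * q t `^ (be - 1) * (- 2 * (a - t * (a ^+ 2 + b ^+ 2)))).
  exact: (is_derive1_comp (is_derive1_powR be qt) dq).
apply: is_derive_eq; rewrite /GRing.scale/=.
(* Both terms of the derivative then share the factor q^(be-1); once A and B are expressed through X
   and Y, its vanishing is a polynomial identity. *)
have -> : q t `^ be = q t * q t `^ (be - 1).
  rewrite -{2}(powRr1 (ltW qt)) -powRD; last by rewrite (gt_eqF qt) implybT.
  by congr (_ `^ _); ring.
rewrite (AE (ltW tK)) (BE (ltW tK)) {2}/q.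
move: (X t) (Y t) (q t `^ (be - 1)) => x y z; ring.
Qed.

Let phi1 : phi 1 = phi 0.
Proof.
have t1 t : t \in `[0, 1] -> `|t| < `|K|.
  rewrite in_itv/= => /andP[t0 t1]; rewrite ger0_norm// gtr0_norm//.
  exact: le_lt_trans K1.
have [||t _ e] := @MVT_segment R phi (cst 0) 0 1 ler01.
- by move=> t t01; apply/dphi/t1; apply: subset_itv_oo_cc.
- apply: continuous_in_subspaceT => t; rewrite inE/= => t01.
  apply: differentiable_continuous; apply/derivable1_diffP.
  by apply: ex_derive; apply/dphi/t1.
- by apply/eqP; rewrite -subr_eq0 e mul0r.
Qed.

Let pseries0 (f : R^nat) : H f 0 = f 0%N.
Proof.
apply: cvg_lim => //; apply: cvg_near_cst; near=> n.
have n0 : (0 < n)%N by near: n; exact: nbhs_infty_gt.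
rewrite -(prednK n0); elim: n.-1 => [|k IH];
  first by rewrite pseriesS /pseries /series/= big_geq// expr0 mulr1 add0r.
by rewrite pseriesS IH expr0n mulr0 addr0.
Unshelve. all: by end_near. Qed.

(** Since [phi] is constant on [0, 1] and equals 1 at 0, its value at t = 1 identifies the sum. A
    real power of |1 - u|^2 is all that occurs, so no branch of a complex power has to be chosen. *)
Lemma cvg_sqr_normc_binomial : (fun n => ComplexField.Normc.normc
    (\sum_(k < n) (binom_coef be k)%:C * u ^+ k) ^+ 2) @ \oo -->
  (ComplexField.Normc.normc (1 - u) ^+ 2) `^ (- be).
Proof.
have K1' : `|1 : R| <= `|K| by rewrite normr1 gtr0_norm// ltW.
have phi0 : phi 0 = 1.
  rewrite /phi /A /B !pseries0 /hc /hs /q/= !mul0r subr0 expr1n expr0n addr0 powR1.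
  by rewrite /binom_coef big_ord0 fact0 divr1; ring.
have qE : q 1 = ComplexField.Normc.normc (1 - u) ^+ 2.
  by rewrite /q sqr_normcE; case: (u) => x y /=; ring.
have -> : (ComplexField.Normc.normc (1 - u) ^+ 2) `^ (- be) = A 1 ^+ 2 + B 1 ^+ 2.
  have qb : q 1 `^ be != 0 by rewrite gt_eqF// powR_gt0 ?q0.
  rewrite -qE powRN; apply: (mulIf qb); rewrite (mulVf qb).
  exact: (esym (etrans phi1 phi0)).
rewrite (_ : (fun n => _) = fun n => pseries (hc be) 1 n ^+ 2 + pseries (hs be) 1 n ^+ 2).
  by apply: cvgD; apply: cvgM; [exact: H_cvg be0 (hcP be0) K1'..|exact: H_cvg be0 (hsP be0) K1'|
    exact: H_cvg be0 (hsP be0) K1'].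
apply/funext => n; rewrite sqr_normcE; congr (_ ^+ 2 + _ ^+ 2).
- rewrite raddf_sum /pseries /series/= big_mkord; apply: eq_bigr => k _.
  by rewrite /hc expr1n mulr1; case: (u ^+ k) => x y /=; ring.
- rewrite raddf_sum /pseries /series/= big_mkord; apply: eq_bigr => k _.
  by rewrite /hs expr1n mulr1; case: (u ^+ k) => x y /=; ring.
Qed.

End norm_constant.

End modulus_binomial_series.

(** * Dilations of complex space *)

Section complex_scaling.
Context (R : realType).
Local Open Scope complex_scope.
Local Notation mu := (@lebesgue_measure R).
Local Notation muC := (@lebesgue_measure_C R).
Local Notation normc := ComplexField.Normc.normc.

Lemma measurable_mkC d (T : measurableType d) (f g : T -> R) :
  measurable_fun setT f -> measurable_fun setT g ->
  measurable_fun setT (fun x => f x +i* g x : R[i]).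
Proof.
move=> mf mg.
exact: (measurableT_comp (@measurable_pair_complex R) (measurable_fun_pair mf mg)).
Qed.

Lemma measurable_ReP d (T : measurableType d) (f : T -> R[i]) :
  measurable_fun setT f -> measurable_fun setT (fun x => complex.Re (f x)).
Proof. by move=> mf; exact: (measurableT_comp (@measurable_Re R) mf). Qed.

Lemma measurable_ImP d (T : measurableType d) (f : T -> R[i]) :
  measurable_fun setT f -> measurable_fun setT (fun x => complex.Im (f x)).
Proof. by move=> mf; exact: (measurableT_comp (@measurable_Im R) mf). Qed.

Lemma measurable_complexP d (T : measurableType d) (f : T -> R[i]) :
  measurable_fun setT (fun x => complex.Re (f x)) ->
  measurable_fun setT (fun x => complex.Im (f x)) -> measurable_fun setT f.
Proof.
move=> mr mi; have := measurable_mkC mr mi.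
by congr measurable_fun; apply/funext => x; case: (f x).
Qed.

Lemma measurable_mulC d (T : measurableType d) (f g : T -> R[i]) :
  measurable_fun setT f -> measurable_fun setT g ->
  measurable_fun setT (fun x => f x * g x).
Proof.
move=> mf mg.
have -> : (fun x => f x * g x) = (fun x =>
  (complex.Re (f x) * complex.Re (g x) - complex.Im (f x) * complex.Im (g x)) +i*
  (complex.Re (f x) * complex.Im (g x) + complex.Im (f x) * complex.Re (g x))).
  by apply/funext => x; case: (f x) (g x) => ? ? [? ?].
have mfr := measurable_ReP mf; have mfi := measurable_ImP mf.
have mgr := measurable_ReP mg; have mgi := measurable_ImP mg.
by apply: measurable_mkC; [apply: measurable_funB|apply: measurable_funD]; exact: measurable_funM.
Qed.

Lemma measurable_normc d (T : measurableType d) (f : T -> R[i]) :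
  measurable_fun setT f -> measurable_fun setT (fun x => normc (f x)).
Proof.
move=> mf; have -> : (fun x => normc (f x)) = fun x => (normc (f x) ^+ 2) `^ 2^-1.
  by apply/funext => x; rewrite powR12_sqrt ?sqr_ge0// sqrtr_sqr ger0_norm// normc_ge0.
apply: measurable_powRx.
exact: (measurableT_comp (@measurable_sqr_normc R) mf).
Qed.

Lemma ge0_integral_C (f : R[i] -> R) : measurable_fun setT f -> (forall z, 0 <= f z) ->
  (\int[muC]_z (f z)%:E = \int[mu]_x \int[mu]_y (f (x +i* y))%:E)%E.
Proof.
move=> mf f0.
transitivity (\int[(mu \x mu)%E]_p ((EFin \o f) (pair_complex p)))%E.
  have -> : (\int[(mu \x mu)%E]_p ((EFin \o f) (pair_complex p)) =
     \int[(mu \x mu)%E]_(p in @pair_complex R @^-1` setT) (((EFin \o f) \o @pair_complex R) p))%E.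
    by rewrite preimage_setT.
  rewrite -(ge0_integral_pushforward (@measurable_pair_complex R) (mu \x mu)%E); first last.
  - by move=> x _; rewrite lee_fin.
  - exact: measurableT_comp.
  - exact: measurableT.
  by apply: eq_measure_integral; first exact: measurable_pair_complex.
rewrite (fubini_tonelli1 (m1 := mu) (m2 := mu)); first by [].
- apply: measurableT_comp; first exact: measurableT_comp.
  exact: measurable_pair_complex.
- by move=> p; rewrite lee_fin.
Qed.

(** Multiplication by a + ib is split into two one-dimensional affine substitutions: x' = a x - b y
    for fixed y, after which a y + b x = (a + b^2/a) y + (b/a) x' for fixed x'. The product of the
    Jacobians |a| and |a + b^2/a| is |c|^2; this is where a must be nonzero. *)
Lemma ge0_integral_C_mul_Re (c : R[i]) (f : R[i] -> R) : complex.Re c != 0 ->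
  measurable_fun setT f -> (forall z, 0 <= f z) ->
  (\int[muC]_z (f (c * z))%:E = (normc c ^- 2)%:E * \int[muC]_z (f z)%:E)%E.
Proof.
case: c => a b /= a0 mf f0.
have mf2 (g h : measurableTypeR R * measurableTypeR R -> R) : measurable_fun setT g ->
  measurable_fun setT h ->
    measurable_fun setT (fun p => f (g p +i* h p)).
  by move=> mg mh; apply: (measurableT_comp mf); exact: measurable_mkC.
have mlin (k l : R) : measurable_fun setT (fun p : measurableTypeR R * measurableTypeR R => k *
  p.1 + l * p.2).
  by apply: measurable_funD; apply: measurable_funM;
    [exact: measurable_cst|exact: measurable_fst|exact: measurable_cst|exact: measurable_snd].
have e0 : a + b ^+ 2 / a != 0.
  have -> : a + b ^+ 2 / a = (a ^+ 2 + b ^+ 2) / a by field.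
  by rewrite mulf_neq0 ?invr_eq0// gt_eqF// ltr_wpDr ?sqr_ge0// exprn_even_gt0.
have mcf : measurable_fun setT (fun z => f ((a +i* b) * z)).
  by apply: (measurableT_comp mf); apply: measurable_mulC; [exact: measurable_cst|
    exact: measurable_id].
set k := normc (a +i* b) ^- 2.
have kE : k = `|a|^-1 * `|a + b ^+ 2 / a|^-1.
  rewrite -invfM -normrM; congr (_^-1).
  have -> : a * (a + b ^+ 2 / a) = a ^+ 2 + b ^+ 2 by field.
  by rewrite sqr_normcE/= ger0_norm// addr_ge0 ?sqr_ge0.
have k0 : 0 <= k by rewrite kE mulr_ge0.
rewrite -(ge0_integralZ _ k0 mf f0) (ge0_integral_C mcf (fun=> f0 _)).
rewrite (@ge0_integral_C (fun z => k * f z)); first last.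
- by move=> z; rewrite mulr_ge0.
- by apply: measurable_funM; [exact: measurable_cst|exact: mf].
pose g1 (x y : measurableTypeR R) : R := f ((a * x - b * y) +i* (a * y + b * x)).
pose g2 (y x : measurableTypeR R) : R :=
  `|a|^-1 * f (x +i* ((a + b ^+ 2 / a) * y + b / a * x)).
have mg2 : measurable_fun setT (fun p => g2 p.1 p.2).
  apply: measurable_funM; first exact: measurable_cst.
  by apply: mf2; [exact: measurable_snd|exact: mlin].
have g20 x y : 0 <= g2 x y by rewrite mulr_ge0.
have mg1 : measurable_fun setT (fun p => g1 p.1 p.2).
  apply: mf2; first by have := mlin a (- b); under eq_fun do rewrite mulNr.
  by have := mlin b a; under eq_fun do rewrite addrC.
transitivity (\int[mu]_x \int[mu]_y (g1 x y)%:E)%E; first by [].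
transitivity (\int[mu]_y \int[mu]_x (g1 x y)%:E)%E.
  by apply: (ge0_fubini mu mu mg1) => x y; exact: f0.
transitivity (\int[mu]_y \int[mu]_x (g2 y x)%:E)%E.
  apply: eq_integral => y _.
  pose h (x : R) := f (x +i* ((a + b ^+ 2 / a) * y + b / a * x)).
  have mh : measurable_fun setT h.
    have m2 : measurable_fun setT (fun x : measurableTypeR R => (y, x)).
      by apply: measurable_fun_pair; [exact: measurable_cst|exact: measurable_id].
    exact: (measurableT_comp (mf2 _ _ measurable_snd (mlin (a + b ^+ 2 / a) (b / a))) m2).
  have h0 x : 0 <= h x by exact: f0.
  have a0' : 0 <= `|a|^-1 by rewrite invr_ge0.
  transitivity (`|a|^-1%:E * \int[mu]_x (h x)%:E)%E.
    rewrite -(ge0_integral_affineR (- (b * y)) a0 mh h0).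
    apply: eq_integral => x _; rewrite /g1 /h; congr (f (_ +i* _))%:E.
    by field.
  exact/esym/(ge0_integralZ mu a0' mh h0).
transitivity (\int[mu]_x \int[mu]_y (g2 y x)%:E)%E.
  exact: (ge0_fubini mu mu mg2 g20).
apply: eq_integral => x _.
pose h (y : R) := `|a|^-1 * f (x +i* y).
have mfx : measurable_fun setT (fun y : R => f (x +i* y)).
  by apply: (measurableT_comp mf); apply: measurable_mkC; [exact: measurable_cst|
    exact: measurable_id].
have mh : measurable_fun setT h.
  by apply: measurable_funM; first exact: measurable_cst.
have h0 y : 0 <= h y by rewrite mulr_ge0.
transitivity (\int[mu]_y (h ((a + b ^+ 2 / a) * y + b / a * x))%:E)%E; first by [].
rewrite (ge0_integral_affineR _ e0 mh h0) -(ge0_integralZ mu _ mh h0) ?invr_ge0//.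
by apply: eq_integral => y _; rewrite kE /h; congr EFin; ring.
Qed.

Lemma ge0_integral_C_mul (c : R[i]) (f : R[i] -> R) : c != 0 ->
  measurable_fun setT f -> (forall z, 0 <= f z) ->
  (\int[muC]_z (f (c * z))%:E = (normc c ^- 2)%:E * \int[muC]_z (f z)%:E)%E.
Proof.
move=> c0 mf f0; have [Rec|] := eqVneq (complex.Re c) 0; last first.
  by move=> Rec; exact: ge0_integral_C_mul_Re.
have Imc : complex.Im c != 0.
  by apply: contra c0 => /eqP Imc; apply/eqP; case: c Rec Imc => x y /= -> ->.
(* a purely imaginary c is a product of two factors with nonzero real parts *)
pose e : R[i] := 1 +i* 1; pose e' : R[i] := (complex.Im c / 2) +i* (complex.Im c / 2).
have ce : c = e' * e.
  by rewrite /e /e'; case: c Rec {c0 Imc e'} => x y /= ->; simpc; congr (_ +i* _); field.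
have mf1 : measurable_fun setT (fun z => f (e' * z)).
  by apply: (measurableT_comp mf); apply: measurable_mulC; [exact: measurable_cst|
    exact: measurable_id].
transitivity (\int[muC]_z (f (e' * (e * z)))%:E)%E.
  by apply: eq_integral => z _; rewrite ce mulrA.
rewrite (@ge0_integral_C_mul_Re e _ _ mf1 (fun=> f0 _)) ?oner_neq0//.
rewrite (@ge0_integral_C_mul_Re e' _ _ mf f0); last by rewrite mulf_neq0 ?invr_eq0.
by rewrite muleA -EFinM -invfM -exprMn -normcM [e * e']mulrC -ce.
Qed.

End complex_scaling.

(** * Iterated integrals on C^n, complex dilations, norm and inner product *)

Section Cn_scaling.
Context (R : realType).
Local Open Scope complex_scope.
Local Notation muC := (@lebesgue_measure_C R).
Local Notation lam := (lebesgue_measure_Cn R).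
Local Notation normc := ComplexField.Normc.normc.

Lemma ge0_integral_Cn0 (f : 0.-tuple R[i] -> R) : measurable_fun setT f ->
  (\int[lam 0]_t (f t)%:E = (f [tuple])%:E)%E.
Proof.
move=> mf; rewrite /= integral_dirac//; last exact: measurableT_comp.
by rewrite diracT mul1e.
Qed.

Lemma ge0_integral_CnS n (f : n.+1.-tuple R[i] -> R) :
  measurable_fun setT f -> (forall t, 0 <= f t) ->
  (\int[lam n.+1]_t (f t)%:E =
   \int[muC]_x \int[lam n]_t (f (cons_pair (x, t)))%:E)%E.
Proof.
move=> mf f0.
transitivity (\int[(muC \x lam n)%E]_p ((EFin \o f) (cons_pair p)))%E.
  have -> : (\int[(muC \x lam n)%E]_p ((EFin \o f) (cons_pair p)) =
     \int[(muC \x lam n)%E]_(p in @cons_pair R[i] n @^-1` setT) (((EFin \o f) \o @cons_pair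
       R[i] n) p))%E.
    by rewrite preimage_setT.
  rewrite -(ge0_integral_pushforward (@measurable_cons_pair _ R[i] n) (muC \x lam n)%E); first last.
  - by move=> x _; rewrite lee_fin.
  - exact: measurableT_comp.
  - exact: measurableT.
  by apply: eq_measure_integral; first exact: measurable_cons_pair.
rewrite (fubini_tonelli1 (m1 := muC) (m2 := lam n)); first by [].
- apply: measurableT_comp; first exact: measurableT_comp.
  exact: measurable_cons_pair.
- by move=> p; rewrite lee_fin.
Qed.

Definition cscale n (c : R[i]) (t : n.-tuple R[i]) : n.-tuple R[i] :=
  [tuple of map (fun z => c * z) t].

Lemma tnth_cscale n c (t : n.-tuple R[i]) i : tnth (cscale c t) i = c * tnth t i.
Proof. by rewrite tnth_map. Qed.

Lemma cscale_cons n c x (t : n.-tuple R[i]) :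
  cscale c (cons_pair (x, t)) = cons_pair (c * x, cscale c t).
Proof. exact: val_inj. Qed.

Lemma measurable_cscale n c : measurable_fun setT (@cscale n c).
Proof.
apply/measurable_fun_tnthP => i.
have -> : (tnth (T:=R[i]))^~ i \o cscale c = fun t : n.-tuple R[i] => c * tnth t i.
  by apply/funext => t; rewrite /= tnth_cscale.
by apply: measurable_mulC; [exact: measurable_cst|exact: measurable_tnth].
Qed.

Lemma measurable_cons_pair2 d (T : measurableType d) n (f : T -> R[i])
    (g : T -> n.-tuple R[i]) : measurable_fun setT f -> measurable_fun setT g ->
  measurable_fun setT (fun x => cons_pair (f x, g x)).
Proof.
move=> mf mg.
exact: (measurableT_comp (@measurable_cons_pair _ R[i] n) (measurable_fun_pair mf mg)).
Qed.

Lemma ge0_integral_Cn_scale n (c : R[i]) (f : n.-tuple R[i] -> R) : c != 0 ->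
  measurable_fun setT f -> (forall t, 0 <= f t) ->
  (\int[lam n]_t (f (cscale c t))%:E =
   ((normc c ^- 2) ^+ n)%:E * \int[lam n]_t (f t)%:E)%E.
Proof.
move=> c0; have k0 m : 0 <= (normc c ^- 2) ^+ m.
  by rewrite exprn_ge0// invr_ge0 sqr_ge0.
elim: n f => [|n IH] f mf f0.
  rewrite ge0_integral_Cn0; last exact: measurableT_comp (measurable_cscale c).
  by rewrite ge0_integral_Cn0// mul1e; congr (f _)%:E; apply/val_inj.
have mfc : measurable_fun setT (fun t => f (cscale c t)).
  exact: measurableT_comp mf (measurable_cscale c).
rewrite -(ge0_integralZ _ (k0 _) mf f0).
rewrite (ge0_integral_CnS mfc (fun=> f0 _)).
rewrite (@ge0_integral_CnS _ (fun t => (normc c ^- 2) ^+ n.+1 * f t)); first last.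
- by move=> t; rewrite mulr_ge0.
- by apply: measurable_funM; [exact: measurable_cst|exact: mf].
pose g1 (x : R[i]) t := (normc c ^- 2) ^+ n * f (cons_pair (c * x, t)).
pose g2 (x : R[i]) t := (normc c ^- 2) ^+ n.+1 * f (cons_pair (x, t)).
have mf2 d (T : measurableType d) (p : T -> R[i]) (q : T -> n.-tuple R[i]) : measurable_fun
  setT p ->
    measurable_fun setT q -> measurable_fun setT (fun x => f (cons_pair (p x, q x))).
  by move=> mp mq; apply: (measurableT_comp mf); exact: measurable_cons_pair2.
have mfx x : measurable_fun setT (fun t => f (cons_pair (x, t))).
  by apply: mf2; [exact: measurable_cst|exact: measurable_id].
have mft t : measurable_fun setT (fun x => f (cons_pair (x, t))).
  by apply: mf2; [exact: measurable_id|exact: measurable_cst].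
transitivity (\int[muC]_x \int[lam n]_t (g1 x t)%:E)%E.
  apply: eq_integral => x _.
  under eq_integral do rewrite cscale_cons.
  by rewrite (IH _ (mfx _) (fun=> f0 _)) -(ge0_integralZ _ (k0 _) (mfx _) (fun=> f0 _)).
(* The tail has been scaled by induction; exchanging the integrals lets the first coordinate be
   scaled with the tail fixed. *)
transitivity (\int[lam n]_t \int[muC]_x (g1 x t)%:E)%E.
  apply: (ge0_fubini (lebesgue_measure_C (R:=R)) (lam n)).
    apply: measurable_funM; first exact: measurable_cst.
    apply: mf2; last exact: measurable_snd.
    by apply: measurable_mulC; [exact: measurable_cst|exact: measurable_fst].
  by move=> x y; rewrite mulr_ge0.
transitivity (\int[lam n]_t \int[muC]_x (g2 x t)%:E)%E.
  apply: eq_integral => t _.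
  pose h x := (normc c ^- 2) ^+ n * f (cons_pair (x, t)).
  have mh : measurable_fun setT h.
    by apply: measurable_funM; first exact: measurable_cst.
  have h0 x : 0 <= h x by rewrite mulr_ge0.
  have k1 := k0 1%N; rewrite expr1 in k1.
  rewrite (ge0_integral_C_mul c0 mh h0) -(ge0_integralZ _ k1 mh h0).
  by apply: eq_integral => x _; rewrite /h /g2 mulrA -exprS.
apply/esym; apply: (ge0_fubini (lebesgue_measure_C (R:=R)) (lam n)).
  apply: measurable_funM; first exact: measurable_cst.
  by apply: mf2; [exact: measurable_fst|exact: measurable_snd].
by move=> x y; rewrite mulr_ge0.
Qed.

Definition nrm2 n (t : n.-tuple R[i]) : R := \sum_(j < n) normc (tnth t j) ^+ 2.

Lemma nrm2_ge0 n (t : n.-tuple R[i]) : 0 <= nrm2 t.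
Proof. by apply: sumr_ge0 => j _; exact: sqr_ge0. Qed.

Lemma measurable_nrm2 n : measurable_fun setT (@nrm2 n).
Proof.
apply: measurable_sum => j.
exact: (measurableT_comp (@measurable_sqr_normc R) (measurable_tnth j)).
Qed.

Lemma nrm2_cscale n c (t : n.-tuple R[i]) : nrm2 (cscale c t) = normc c ^+ 2 * nrm2 t.
Proof.
by rewrite /nrm2 mulr_sumr; apply: eq_bigr => j _; rewrite tnth_cscale normcM exprMn.
Qed.

Lemma nrm2_cons n x (t : n.-tuple R[i]) : nrm2 (cons_pair (x, t)) = normc x ^+ 2 + nrm2 t.
Proof.
rewrite /nrm2 big_ord_recl tnth0; congr (_ + _).
by apply: eq_bigr => j _; rewrite tnthS.
Qed.

Lemma inner_cons n x y (t s : n.-tuple R[i]) :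
  inner (cons_pair (x, t)) (cons_pair (y, s)) = x * y^* + inner t s.
Proof.
rewrite /inner big_ord_recl !tnth0; congr (_ + _).
by apply: eq_bigr => j _; rewrite !tnthS.
Qed.

Lemma inner_cscale n c (t s : n.-tuple R[i]) : inner t (cscale c s) = c^* * inner t s.
Proof.
rewrite /inner mulr_sumr; apply: eq_bigr => j _.
by rewrite tnth_cscale rmorphM mulrCA.
Qed.

End Cn_scaling.

(** * Moments of the ball *)

Section gaussian_to_ball.
Context (R : realType).
Local Open Scope complex_scope.
Local Notation mu := (@lebesgue_measure R).
Local Notation lam := (lebesgue_measure_Cn R).
Local Notation normc := ComplexField.Normc.normc.

Lemma normcR (x : R) : normc x%:C = `|x|.
Proof. by rewrite /= expr0n addr0 sqrtr_sqr. Qed.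

(* Both sides equal the integral of [H w (t-|w|^2)^e e^(-t)] over [|w|^2 < t]. *)
Lemma gaussian_ball n k (e : R) (H : n.-tuple R[i] -> R) :
  measurable_fun setT H -> (forall w, 0 <= H w) ->
  (forall x w, 0 < x -> H (cscale x%:C w) = x ^+ (2 * k) * H w) ->
  (Gammae (e + 1) * \int[lam n]_w (H w * expR (- nrm2 w))%:E =
   Gammae ((n + k)%:R + e + 1) *
     \int[lam n]_w ((nrm2 w < 1)%R%:R * (H w * (1 - nrm2 w) `^ e))%:E)%E.
Proof.
move=> mH H0 Hh.
pose g (s : R) : R := (0 < s)%R%:R * (s `^ (e + 1 - 1) * expR (- s)).
have mg : measurable_fun setT g.
  by have := measurable_gamma_integrand (e + 1) 1; under eq_fun do rewrite mul1r.
have g0 t : 0 <= g t by rewrite !mulr_ge0 ?ler0n ?powR_ge0 ?expR_ge0.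
(* The cutoff in [g] restricts to |w|^2 < t, and its exponential combines with expR (- nrm2 w) into
   e^(-t). *)
pose F (w : n.-tuple R[i]) (t : measurableTypeR R) : R := (H w * expR (- nrm2 w)) * g (1 * t +
  (- nrm2 w)).
have mF : measurable_fun setT (fun p => F p.1 p.2).
  have m1 : measurable_fun setT (fun p : n.-tuple R[i] * measurableTypeR R => - nrm2 p.1).
    by apply: measurableT_comp => //;
      exact: (measurableT_comp (@measurable_nrm2 R n) measurable_fst).
  apply: measurable_funM; first apply: measurable_funM.
  - exact: (measurableT_comp mH measurable_fst).
  - exact: measurable_expRx.
  - apply: (measurableT_comp mg); apply: measurable_funD => //.
    by under eq_fun do rewrite mul1r; exact: measurable_snd.
have F0 w t : 0 <= F w t by rewrite mulr_ge0// mulr_ge0// expR_ge0.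
have E : (\int[lam n]_w \int[mu]_t (F w t)%:E = \int[mu]_t \int[lam n]_w (F w t)%:E)%E.
  exact: (ge0_fubini (lam n) mu mF F0).
have mHe : measurable_fun setT (fun w => H w * expR (- nrm2 w)).
  apply: measurable_funM => //; apply: measurable_expRx; apply: measurableT_comp => //.
  exact: measurable_nrm2.
have He0 w : 0 <= H w * expR (- nrm2 w) by rewrite mulr_ge0// expR_ge0.
have E1 : (\int[lam n]_w \int[mu]_t (F w t)%:E =
    Gammae (e + 1) * \int[lam n]_w (H w * expR (- nrm2 w))%:E)%E.
  rewrite -(ge0_integralZ_ereal _ (Gammae_ge0 _) mHe He0).
  apply: eq_integral => w _.
  have mgt : measurable_fun setT (fun t : R => g (1 * t + (- nrm2 w))).
    by apply: (measurableT_comp mg); apply: measurable_funD.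
  rewrite (ge0_integralZ mu (He0 w) mgt (fun=> g0 _)).
  rewrite (ge0_integral_affineR _ (oner_neq0 _) mg g0) normr1 invr1 mul1e muleC.
  by [].
pose f (w : n.-tuple R[i]) : R := (nrm2 w < 1)%R%:R * (H w * (1 - nrm2 w) `^ e).
have mf : measurable_fun setT f.
  apply: measurable_funM; first by apply: measurable_ltr_nat => //; exact: measurable_nrm2.
  apply: measurable_funM => //; apply: measurable_powRx; apply: measurable_funB => //.
  exact: measurable_nrm2.
have f0 w : 0 <= f w by rewrite !mulr_ge0// powR_ge0.
have E2 : (\int[mu]_t \int[lam n]_w (F w t)%:E =
    Gammae ((n + k)%:R + e + 1) * \int[lam n]_w (f w)%:E)%E.
  pose gg (t : R) : R := (0 < t)%R%:R * (t `^ ((n + k)%:R + e + 1 - 1) * expR (- t)).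
  have mgg : measurable_fun setT gg.
    by have := measurable_gamma_integrand ((n + k)%:R + e + 1) 1; under eq_fun do rewrite mul1r.
  have gg0 t : 0 <= gg t by rewrite !mulr_ge0 ?ler0n ?powR_ge0 ?expR_ge0.
  transitivity (\int[mu]_t ((\int[lam n]_w (f w)%:E) * (gg t)%:E))%E; last first.
    have J0 : (0 <= \int[lam n]_w (f w)%:E)%E by apply: integral_ge0 => w _; rewrite lee_fin.
    by apply: (etrans (ge0_integralZ_ereal mu J0 mgg gg0)); rewrite muleC.
  apply: eq_integral => t _.
  have [t0|t0] := leP t 0.
    rewrite /gg (ltNge 0 t) t0 mul0r mule0; apply: integral0_eq => w _.
    rewrite /F /g ltNge mul1r subr_le0 (le_trans t0 (nrm2_ge0 w)) mul0r mulr0//.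
  (* Dilation by t^(-1/2) carries |w|^2 < t onto the unit ball. Homogeneity of H contributes t^k,
     the power of t - |w|^2 contributes t^e, and the change of variable t^n. *)
  pose c : R[i] := ((Num.sqrt t)^-1)%:C.
  have st0 : 0 < Num.sqrt t by rewrite sqrtr_gt0.
  have c0 : c != 0.
    by apply/eqP => -[/eqP]; rewrite invr_eq0 gt_eqF.
  have nc : normc c ^- 2 = t.
    by rewrite normcR ger0_norm ?invr_ge0 ?sqrtr_ge0// exprVn invrK sqr_sqrtr// ltW.
  have nc2 : normc c ^+ 2 = t^-1 by rewrite -[LHS]invrK nc.
  pose q : R := t `^ (k%:R + e) * expR (- t).
  have q0 : 0 <= q by rewrite mulr_ge0 ?powR_ge0 ?expR_ge0.
  have FE w : F w t = q * f (cscale c w).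
    rewrite /F /f /g nrm2_cscale nc2 mul1r subr_gt0 (mulrC t^-1) (ltr_pdivrMr _ _ t0) mul1r.
    have [wt|_] := ltP (nrm2 w) t; last by rewrite !mul0r !mulr0.
    rewrite -[true%:R]/(1 : R) !mul1r addrK Hh ?invr_gt0//.
    have -> : 1 - nrm2 w / t = (t - nrm2 w) * t^-1 by rewrite mulrBl divff ?gt_eqF.
    rewrite powRM ?subr_ge0 ?invr_ge0 ?(ltW wt) ?(ltW t0)// -powR_inv1 ?(ltW t0)// -powRrM mulN1r.
    rewrite exprM exprVn (sqr_sqrtr (ltW t0)) exprVn.
    rewrite /q powRD; last by rewrite (gt_eqF t0) implybT.
    rewrite powR_mulrn ?(ltW t0)// powRN.
    have te : t `^ e != 0 by rewrite gt_eqF ?powR_gt0.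
    have tk : t ^+ k != 0 by rewrite expf_neq0 ?gt_eqF.
    have -> : expR (- t) = expR (- nrm2 w) * expR (- (t - nrm2 w)).
      by rewrite -expRD; congr expR; ring.
    by field; rewrite te tk.
  have mfc : measurable_fun setT (fun w => f (cscale c w)).
    exact: measurableT_comp mf (measurable_cscale c).
  transitivity (\int[lam n]_w (q * f (cscale c w))%:E)%E.
    by apply: eq_integral => w _; rewrite FE.
  rewrite (ge0_integralZ _ q0 mfc (fun=> f0 _)) (ge0_integral_Cn_scale c0 mf f0).
  rewrite nc muleA -EFinM muleC; congr (_ * _%:E)%E.
  rewrite /gg t0 mul1r /q mulrAC; congr (_ * _).
  rewrite -(powR_mulrn _ (ltW t0)) -powRD; last by rewrite (gt_eqF t0) implybT.
  by congr (_ `^ _); rewrite natrD; ring.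
exact: (etrans (esym E1) (etrans E E2)).
Qed.

End gaussian_to_ball.

(** * Roots of unity and the finite Parseval identity *)

Section parseval.
Context (R : realType).
Local Open Scope complex_scope.
Local Notation normc := ComplexField.Normc.normc.

Lemma sqr_normc_conj (z : R[i]) : (normc z ^+ 2)%:C = z * z^*.
Proof. by rewrite sqr_normcE; case: z => x y; simpc; congr (_ +i* _); ring. Qed.

(** X^n - 1 splits over the complex numbers and is separable, so it has n distinct roots; n distinct
    n-th roots of unity always include a primitive one. *)
Lemma complex_prim_root (n : nat) : (0 < n)%N -> {w : R[i] | n.-primitive_root w}.
Proof.
move=> n0; pose p : {poly R[i]} := 'X^n - 1.
have [r Dp] := closed_field_poly_normal p.
move: Dp; rewrite (monicP _) ?monicXnsubC// scale1r => Dp.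
have rn1 : all n.-unity_root r.
  apply/allP => z; rewrite -root_prod_XsubC -Dp; exact.
have sz_r : (n < (size r).+1)%N.
  by rewrite -(size_prod_XsubC r id) -Dp size_XnsubC.
apply/sigW; have [|w _ wP] := hasP (cyclic.has_prim_root n0 rn1 _ sz_r); last by exists w.
by rewrite -separable.separable_prod_XsubC -Dp cyclotomic.separable_Xn_sub_1// pnatr_eq0 -lt0n.
Qed.

Lemma normc_prim_root n (w : R[i]) : n.-primitive_root w -> normc w = 1.
Proof.
move=> wP; have n0 := prim_order_gt0 wP.
apply/eqP; rewrite -(pexpr_eq1 n0 (normc_ge0 w)).
by rewrite -normcX (prim_expr_order wP) normc1.
Qed.

(** When the squares are expanded, the term (k, l) carries the geometric sum of the powers of x =
    w^k conj(w)^l. For k = l it is N; otherwise x^N = 1 with x != 1, and it vanishes. *)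
Lemma parseval_prim_root N (w : R[i]) (p : 'I_N -> R[i]) : N.-primitive_root w ->
  \sum_(r < N) normc (\sum_(k < N) p k * (w ^+ r) ^+ k) ^+ 2 =
  N%:R * \sum_(k < N) normc (p k) ^+ 2.
Proof.
move=> wP; apply: (@complexI R).
have ww : w * w^* = 1 by rewrite -sqr_normc_conj (normc_prim_root wP) expr1n.
rewrite rmorph_sum rmorphM rmorph_nat rmorph_sum/=.
transitivity (\sum_(r < N) \sum_(k < N) \sum_(l < N)
    (p k * (p l)^*) * (w ^+ k * w^* ^+ l) ^+ r).
  apply: eq_bigr => r _; rewrite sqr_normc_conj rmorph_sum/= big_distrlr/=.
  apply: eq_bigr => k _; apply: eq_bigr => l _.
  rewrite rmorphM !rmorphXn/= exprMn -!exprM ![(r * _)%N]mulnC; ring.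
rewrite exchange_big/= mulr_sumr; apply: eq_bigr => k _.
rewrite exchange_big/= (bigD1 k)//= [X in _ + X]big1 ?addr0.
  under eq_bigr do rewrite -exprMn ww !expr1n mulr1.
  by rewrite sumr_const card_ord sqr_normc_conj mulr_natl.
move=> l lk; rewrite -mulr_sumr; set x := w ^+ k * w^* ^+ l.
suff -> : \sum_(i < N) x ^+ i = 0 by rewrite mulr0.
have x1 : x != 1.
  apply: contra lk => /eqP xE; apply/eqP/val_inj => /=.
  have : w ^+ k == w ^+ l.
    by apply/eqP; rewrite -[RHS]mul1r -xE /x -mulrA -exprMn [w^* * w]mulrC ww expr1n mulr1.
  by rewrite (eq_prim_root_expr wP) !modn_small// => /eqP.
have : x ^+ N - 1 = 0.
  by rewrite /x exprMn -!exprM ![(_ * N)%N]mulnC !exprM -rmorphXn/= (prim_expr_order wP)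
    rmorph1 !expr1n mulr1 subrr.
by rewrite subrX1 => /eqP; rewrite mulf_eq0 subr_eq0 (negbTE x1)/= => /eqP.
Qed.

End parseval.

(** * Averages over rotations and Gaussian moments in dimension one *)

Section gaussian_moments.
Context (R : realType).
Local Open Scope complex_scope.
Local Notation muC := (@lebesgue_measure_C R).
Local Notation lam := (lebesgue_measure_Cn R).
Local Notation normc := ComplexField.Normc.normc.

(** The finite replacement for averaging over a circle: the [g r] will be rotated copies of f and h
    their mean. The integrals may be infinite, so N is cancelled by multiplying with its inverse. *)
Lemma ge0_integral_average d (T : measurableType d) (mu : {measure set T -> \bar R})
    N (f h : T -> R) (g : nat -> T -> R) : (0 < N)%N ->
  (forall r, measurable_fun setT (g r)) -> (forall r x, 0 <= g r x) ->
  (forall r, \int[mu]_x (g r x)%:E = \int[mu]_x (f x)%:E)%E ->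
  measurable_fun setT h -> (forall x, 0 <= h x) ->
  (forall x, \sum_(r < N) g r x = N%:R * h x) ->
  (\int[mu]_x (f x)%:E = \int[mu]_x (h x)%:E)%E.
Proof.
move=> N0 mg g0 gf mh h0 gh.
have E : (N%:R%:E * \int[mu]_x (f x)%:E = N%:R%:E * \int[mu]_x (h x)%:E)%E.
  rewrite -(ge0_integralZ mu (ler0n _ N) mh h0).
  under [RHS]eq_integral do rewrite -gh.
  rewrite (ge0_integral_sumR mu N mg g0).
  under eq_bigr do rewrite gf.
  by rewrite sumr_const card_ord mule_natl.
have Nn : N%:R != 0 :> R by rewrite pnatr_eq0 -lt0n.
have NK (x : \bar R) : (N%:R^-1%:E * (N%:R%:E * x) = x)%E.
  by rewrite muleA -EFinM mulVf// mul1e.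
by rewrite -[LHS]NK E NK.
Qed.

Lemma prim_root_exp_neq0 n (w : R[i]) r : n.-primitive_root w -> w ^+ r != 0.
Proof.
move=> wP; rewrite expf_neq0//; apply/eqP => w0.
by have /eqP := normc_prim_root wP; rewrite w0 normc0 eq_sym oner_eq0.
Qed.

Lemma ge0_integral_C_average N (w : R[i]) (f h : R[i] -> R) : N.-primitive_root w ->
  measurable_fun setT f -> (forall z, 0 <= f z) ->
  measurable_fun setT h -> (forall z, 0 <= h z) ->
  (forall z, \sum_(r < N) f (w ^+ r * z) = N%:R * h z) ->
  (\int[muC]_z (f z)%:E = \int[muC]_z (h z)%:E)%E.
Proof.
move=> wP mf f0 mh h0 fh.
apply: (@ge0_integral_average _ _ muC N f h (fun r z => f (w ^+ r * z)) (prim_order_gt0 wP)) => //.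
- move=> r; apply: (measurableT_comp mf).
  by apply: measurable_mulC; [exact: measurable_cst|exact: measurable_id].
- move=> r; have w0 := prim_root_exp_neq0 r wP.
  rewrite (ge0_integral_C_mul w0 mf f0) normcX (normc_prim_root wP).
  by rewrite !expr1n invr1 mul1e.
Qed.

Lemma ge0_integral_Cn_average n N (w : R[i]) (f h : n.-tuple R[i] -> R) : N.-primitive_root w ->
  measurable_fun setT f -> (forall z, 0 <= f z) ->
  measurable_fun setT h -> (forall z, 0 <= h z) ->
  (forall z, \sum_(r < N) f (cscale (w ^+ r) z) = N%:R * h z) ->
  (\int[lam n]_z (f z)%:E = \int[lam n]_z (h z)%:E)%E.
Proof.
move=> wP mf f0 mh h0 fh.
apply: (@ge0_integral_average _ _ (lam n) N f h (fun r z => f (cscale (w ^+ r) z))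
  (prim_order_gt0 wP)) => //.
- by move=> r; exact: (measurableT_comp mf (measurable_cscale _)).
- move=> r; have w0 := prim_root_exp_neq0 r wP.
  rewrite (ge0_integral_Cn_scale w0 mf f0) normcX (normc_prim_root wP).
  by rewrite expr1n expr1n invr1 expr1n mul1e.
Qed.

Lemma integral_C1 (f : R[i] -> R) : measurable_fun setT f -> (forall z, 0 <= f z) ->
  (\int[lam 1]_t (f (thead t))%:E = \int[muC]_z (f z)%:E)%E.
Proof.
move=> mf f0; rewrite (@ge0_integral_CnS _ _ (fun t => f (thead t))) => [||//]; last first.
  exact: (measurableT_comp mf (measurable_tnth ord0)).
apply: eq_integral => z _; rewrite (@ge0_integral_Cn0 _ (fun t => f (thead (cons_pair (z, t))))).
  by rewrite /cons_pair/= theadE.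
rewrite (_ : (fun t : 0.-tuple R[i] => _) = cst (f z)); first exact: measurable_cst.
by apply/funext => t; rewrite theadE.
Qed.

Lemma indic_cball n (w : n.-tuple R[i]) : \1_(@cball R n) w = (nrm2 w < 1)%R%:R :> R.
Proof. by rewrite indicE; congr (nat_of_bool _)%:R; apply/idP/idP; rewrite inE. Qed.

Lemma measurable_ball_ind n :
  measurable_fun setT (fun w : n.-tuple R[i] => (nrm2 w < 1)%R%:R : R).
Proof. by apply: measurable_ltr_nat => //; exact: measurable_nrm2. Qed.

Lemma lam_cball n : lam n (@cball R n) = (\int[lam n]_w ((nrm2 w < 1)%R%:R)%:E)%E.
Proof.
rewrite -[X in lam n X]setIT -(integral_indic (lam n) measurableT); last first.
  exact: measurable_cball.
by apply: eq_integral => w _; rewrite indic_cball.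
Qed.

Let M (j : nat) : \bar R := (\int[lam 1]_w (nrm2 w ^+ j * expR (- nrm2 w))%:E)%E.
Let B (j : nat) : \bar R := (\int[lam 1]_w ((nrm2 w < 1)%R%:R * nrm2 w ^+ j)%:E)%E.

Let mnX n j : measurable_fun setT (fun w : n.-tuple R[i] => nrm2 w ^+ j).
Proof. by apply: measurable_funX; exact: measurable_nrm2. Qed.

Let nX0 n j (w : n.-tuple R[i]) : 0 <= nrm2 w ^+ j.
Proof. by rewrite exprn_ge0// nrm2_ge0. Qed.

Let hX n j x (w : n.-tuple R[i]) : 0 < x -> nrm2 (cscale x%:C w) ^+ j = x ^+ (2 * j) * nrm2 w ^+ j.
Proof. by move=> x0; rewrite nrm2_cscale normcR gtr0_norm// exprMn exprM. Qed.

Let ME j : M j = ((j.+1)`!%:R%:E * B j)%E.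
Proof.
have := @gaussian_ball R 1 j 0 (fun w => nrm2 w ^+ j) (@mnX 1 j) (@nX0 1 j) (fun x w => @hX 1 j
  x w).
rewrite add0r Gammae1 mul1e addr0 natr1 Gammae_nat -/(M j) => ->; congr (_ * _)%E.
by apply: eq_integral => w _; rewrite powRr0 mulr1.
Qed.

Let ME1 j : M j = ((j.+2)`!%:R%:E * \int[lam 1]_w ((nrm2 w < 1)%R%:R * (nrm2 w ^+ j * (1 - nrm2
  w)))%:E)%E.
Proof.
have := @gaussian_ball R 1 j 1 (fun w => nrm2 w ^+ j) (@mnX 1 j) (@nX0 1 j) (fun x w => @hX 1 j
  x w).
rewrite (_ : 1 + 1 = 2%:R)// Gammae_nat mul1e -/(M j) => ->; congr (_ * _)%E.
  by rewrite natr1 natr1 Gammae_nat.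
apply: eq_integral => w _; congr EFin; have [w1|_] := ltP (nrm2 w) 1; last by rewrite !mul0r.
by rewrite powRr1// subr_ge0 ltW.
Qed.

Let BS j : B j = (\int[lam 1]_w ((nrm2 w < 1)%R%:R * (nrm2 w ^+ j * (1 - nrm2 w)))%:E + B j.+1)%E.
Proof.
rewrite /B -ge0_integralDR.
- by apply: eq_integral => w _; congr EFin; rewrite exprS; ring.
- apply: measurable_funM; first exact: measurable_ball_ind.
  apply: measurable_funM; first exact: mnX.
  by apply: measurable_funB; [exact: measurable_cst|exact: measurable_nrm2].
- move=> w; have [w1|_] := ltP (nrm2 w) 1; last by rewrite mul0r.
  by rewrite mul1r mulr_ge0// subr_ge0 ltW.
- by apply: measurable_funM; [exact: measurable_ball_ind|exact: mnX].
- by move=> w; rewrite mulr_ge0.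
Qed.

(* The area of the unit disc.  Its value does not matter: it cancels in the
   normalized measure dv. *)
Definition kappa : R := fine (lam 1 (@cball R 1)).

Lemma kappa_gt0 : 0 < kappa.
Proof. by rewrite /kappa fine_gt0// lambda_cball_gt0 lambda_cball_fin. Qed.

(** Comparing e = 0 and e = 1 in [gaussian_ball] replaces polar coordinates: (j + 2) M j = (j + 2)!
    B j, and [BS] splits this into M j + M (j + 1). Finiteness is what allows M j to be
    cancelled. *)
Let M_rec j : M j \is a fin_num -> M j.+1 = (j.+1%:R%:E * M j)%E.
Proof.
move=> Mfin; pose D := (\int[lam 1]_w ((nrm2 w < 1)%R%:R * (nrm2 w ^+ j * (1 - nrm2 w)))%:E)%E.
have D0 : (0 <= D)%E.
  apply: integral_ge0 => w _; rewrite lee_fin.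
  have [w1|_] := ltP (nrm2 w) 1; last by rewrite mul0r.
  by rewrite mul1r mulr_ge0// subr_ge0 ltW.
have B0 n : (0 <= B n)%E by apply: integral_ge0 => w _; rewrite lee_fin mulr_ge0.
have E : (j.+2%:R%:E * M j = M j + M j.+1)%E.
  rewrite [in RHS]ME1 (ME j.+1) -ge0_muleDr// -/D -BS.
  by rewrite ME muleA -EFinM -natrM -factS.
have : (M j + j.+1%:R%:E * M j = M j + M j.+1)%E.
  by rewrite -E -[in RHS]nat1r EFinD ge0_muleDl ?lee_fin// mul1e.
rewrite 2!(addeC (M j)) => /(congr1 (fun x => x - M j)%E).
by rewrite !addeK.
Qed.

Lemma gaussian_moment_C j :
  (\int[muC]_z (normc z ^+ (2 * j) * expR (- normc z ^+ 2))%:E = (kappa * j`!%:R)%:E)%E.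
Proof.
transitivity (M j).
  rewrite -(@integral_C1 (fun z => normc z ^+ (2 * j) * expR (- normc z ^+ 2))).
  - by apply: eq_integral => w _; rewrite /nrm2 big_ord1 exprM.
  - apply: measurable_funM; first by apply: measurable_funX; exact: measurable_normc.
    by apply: measurable_expRx; apply: measurableT_comp => //; apply: measurable_funX;
      exact: measurable_normc.
  - by move=> z; rewrite mulr_ge0 ?expR_ge0// exprn_ge0// normc_ge0.
elim: j => [|j IH].
  (* [M 0] is the area of the unit disc; being finite, it starts the induction that feeds
     [M_rec]. *)
  rewrite ME mul1e mulr1 /kappa fineK; last first.
    by rewrite ge0_fin_numE ?lambda_cball_fin// ltW// lambda_cball_gt0.
  by rewrite lam_cball; apply: eq_integral => w _; rewrite expr0 mulr1.
by rewrite M_rec IH// -EFinM factS natrM mulrCA.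
Qed.

End gaussian_moments.

(** * Gaussian moments of the inner product on C^n *)

Section gaussian_moments_Cn.
Context (R : realType).
Local Open Scope complex_scope.
Local Notation muC := (@lebesgue_measure_C R).
Local Notation lam := (lebesgue_measure_Cn R).
Local Notation normc := ComplexField.Normc.normc.

Lemma Re_sum (I : Type) (r : seq I) (F : I -> R[i]) :
  complex.Re (\sum_(i <- r) F i) = \sum_(i <- r) complex.Re (F i).
Proof. exact: raddf_sum. Qed.

Lemma Im_sum (I : Type) (r : seq I) (F : I -> R[i]) :
  complex.Im (\sum_(i <- r) F i) = \sum_(i <- r) complex.Im (F i).
Proof. exact: raddf_sum. Qed.

Lemma measurable_sumC d (T : measurableType d) n (F : 'I_n -> T -> R[i]) :
  (forall j, measurable_fun setT (F j)) ->
  measurable_fun setT (fun x => \sum_(j < n) F j x).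
Proof.
move=> mF; apply: measurable_complexP.
- under eq_fun do rewrite Re_sum.
  by apply: measurable_sum => j; exact: measurable_ReP.
- under eq_fun do rewrite Im_sum.
  by apply: measurable_sum => j; exact: measurable_ImP.
Qed.

Lemma measurable_conjC d (T : measurableType d) (f : T -> R[i]) :
  measurable_fun setT f -> measurable_fun setT (fun x => (f x)^*).
Proof.
move=> mf; have -> : (fun x => (f x)^*) = fun x => complex.Re (f x) +i* - complex.Im (f x).
  by apply/funext => x; case: (f x).
by apply: measurable_mkC; [exact: measurable_ReP|apply: measurableT_comp => //;
  exact: measurable_ImP].
Qed.

Lemma measurable_inner d (T : measurableType d) n (f g : T -> n.-tuple R[i]) :
  measurable_fun setT f -> measurable_fun setT g ->
  measurable_fun setT (fun x => inner (f x) (g x)).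
Proof.
move=> mf mg; apply: measurable_sumC => j; apply: measurable_mulC.
  exact: (measurableT_comp (measurable_tnth j) mf).
by apply: measurable_conjC; exact: (measurableT_comp (measurable_tnth j) mg).
Qed.

Lemma normc_conj (z : R[i]) : normc z^* = normc z.
Proof. by case: z => a b; rewrite /= sqrrN. Qed.

Lemma normc_natr n : normc (n%:R : R[i]) = n%:R.
Proof. by rewrite -(rmorph_nat (@real_complex R)) normcR normr_nat. Qed.

(** The k-th power expands into k + 1 monomials in the phase v^r, which is the number of roots, so
    Parseval leaves only the squared moduli of the coefficients. *)
Lemma binomial_phase_average k (v b y : R[i]) : k.+1.-primitive_root v ->
  \sum_(r < k.+1) normc (b + y * v ^+ r) ^+ (2 * k) =
  k.+1%:R * \sum_(j < k.+1)
    ('C(k, j)%:R ^+ 2 * normc b ^+ (2 * (k - j)) * normc y ^+ (2 * j)).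
Proof.
move=> vP; pose p (j : 'I_k.+1) : R[i] := b ^+ (k - j) * y ^+ j *+ 'C(k, j).
transitivity (\sum_(r < k.+1) normc (\sum_(j < k.+1) p j * (v ^+ r) ^+ j) ^+ 2).
  apply: eq_bigr => r _; rewrite mulnC exprM -normcX exprDn; congr (normc _ ^+ 2).
  by apply: eq_bigr => j _; rewrite /p exprMn mulrA mulrnAl.
rewrite (parseval_prim_root p vP); congr (_ * _); apply: eq_bigr => j _.
rewrite /p -mulr_natl !normcM !normcX normc_natr !exprMn -!exprM.
by rewrite -mulrA ![(_ * 2)%N]mulnC.
Qed.

(** Induction on n. Rotating the first coordinate alone removes the cross terms of (z0 conj(x) +
    <z',t>)^k; the identity C(k,j)^2 j! (k-j)! = C(k,j) k! then reassembles the rest into the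
    binomial expansion of (|z0|^2 + |z'|^2)^k. *)
Lemma gaussian_moment n k (z : n.-tuple R[i]) :
  (\int[lam n]_w (normc (inner z w) ^+ (2 * k) * expR (- nrm2 w))%:E =
   (kappa R ^+ n * k`!%:R * nrm2 z ^+ k)%:E)%E.
Proof.
elim: n k z => [|n IH] k z.
  rewrite (@ge0_integral_Cn0 _ (fun w => normc (inner z w) ^+ (2 * k) * expR (- nrm2 w))).
    rewrite /inner /nrm2 !big_ord0 oppr0 expR0 mulr1 normc0 expr0 mul1r.
    (* In dimension 0 both sides are 0^k, with 0^0 = 1. *)
    by case: k => [|k]; rewrite ?muln0 ?expr0 ?mulr1// mulnS !expr0n mulr0.
  apply: measurable_funM.
    by apply: measurable_funX; apply: measurable_normc; apply: measurable_inner;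
      [exact: measurable_cst|exact: measurable_id].
  by apply: measurable_expRx; apply: measurableT_comp => //; exact: measurable_nrm2.
have [z0 [z' ->]] : exists z0 z', z = cons_pair (z0, z').
  by exists (thead z), [tuple of behead z]; exact: tuple_eta.
have mfn m (u : m.-tuple R[i]) l : measurable_fun setT (fun w => normc (inner u w) ^+ l * expR
  (- nrm2 w)).
  apply: measurable_funM.
    by apply: measurable_funX; apply: measurable_normc; apply: measurable_inner;
      [exact: measurable_cst|exact: measurable_id].
  by apply: measurable_expRx; apply: measurableT_comp => //; exact: measurable_nrm2.
have fn0 m (u w : m.-tuple R[i]) l : 0 <= normc (inner u w) ^+ l * expR (- nrm2 w).
  by rewrite mulr_ge0 ?expR_ge0// exprn_ge0// normc_ge0.
rewrite (ge0_integral_CnS (mfn _ _ _) (fun w => fn0 _ _ w _)).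
set f := fun w => normc (inner (cons_pair (z0, z')) w) ^+ (2 * k) * expR (- nrm2 w).
transitivity (\int[lam n]_t \int[muC]_x (f (cons_pair (x, t)))%:E)%E.
  apply: (ge0_fubini (lebesgue_measure_C (R:=R)) (lam n) (f := fun x t => f (cons_pair (x, t)))).
    apply: (measurableT_comp (mfn _ _ _)).
    by apply: measurable_cons_pair2; [exact: measurable_fst|exact: measurable_snd].
  by move=> x t; exact: fn0.
pose C (j : nat) : R := 'C(k, j)%:R ^+ 2 * normc z0 ^+ (2 * j) * (kappa R * j`!%:R).
transitivity (\int[lam n]_t (\sum_(j < k.+1) C j *
    (normc (inner z' t) ^+ (2 * (k - j)) * expR (- nrm2 t)))%:E)%E.
  apply: eq_integral => t _.
  have [v vP] := complex_prim_root R (ltn0Sn k).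
  (* The second argument of [inner] enters conjugated, so rotating by powers of the conjugate root
     produces powers of v. *)
  have wP : k.+1.-primitive_root (v^* : R[i]) by rewrite fmorph_primitive_root.
  pose D (j : nat) : R := 'C(k, j)%:R ^+ 2 * normc (inner z' t) ^+ (2 * (k - j)) *
    normc z0 ^+ (2 * j) * expR (- nrm2 t).
  pose m (j : nat) (x : R[i]) : R := normc x ^+ (2 * j) * expR (- normc x ^+ 2).
  have mm j : measurable_fun setT (m j).
    apply: measurable_funM; first by apply: measurable_funX; exact: measurable_normc.
    by apply: measurable_expRx; apply: measurableT_comp => //; apply: measurable_funX;
      exact: measurable_normc.
  have m0 j x : 0 <= m j x by rewrite mulr_ge0 ?expR_ge0// exprn_ge0// normc_ge0.
  have D0 j : 0 <= D j.
    by rewrite !mulr_ge0 ?expR_ge0 ?sqr_ge0// exprn_ge0// normc_ge0.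
  have mDm j : measurable_fun setT (fun x => D j * m j x).
    by apply: measurable_funM; [exact: measurable_cst|exact: mm].
  have Dm0 j x : 0 <= D j * m j x by rewrite mulr_ge0.
  rewrite (ge0_integral_C_average (h := fun x => \sum_(j < k.+1) D j * m j x) wP); last 5 first.
  - apply: (measurableT_comp (mfn _ _ _)).
    by apply: measurable_cons_pair2; [exact: measurable_id|exact: measurable_cst].
  - by move=> x; exact: fn0.
  - by apply: measurable_sum.
  - by move=> x; apply: sumr_ge0.
  - move=> x.
    transitivity (\sum_(r < k.+1) normc (inner z' t + z0 * x^* * v ^+ r) ^+ (2 * k) * expR (-
      (normc x ^+ 2 + nrm2 t))).
      apply: eq_bigr => r _; rewrite /f inner_cons nrm2_cons normcM normcX normc_conj.
      rewrite (normc_prim_root vP) expr1n mul1r; congr (normc _ ^+ _ * _).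
      by rewrite rmorphM rmorphXn/= conjCK addrC mulrAC mulrA.
    rewrite -mulr_suml (binomial_phase_average _ _ vP) -mulrA; congr (_ * _).
    rewrite mulr_suml; apply: eq_bigr => j _.
    rewrite /D /m normcM normc_conj exprMn opprD expRD; ring.
  rewrite (ge0_integral_sumR muC _ mDm Dm0) -sumEFin; apply: eq_bigr => j _.
  rewrite (ge0_integralZ muC (D0 j) (mm j) (m0 j)) gaussian_moment_C -EFinM.
  by congr EFin; rewrite /D /C; ring.
have C0 j : 0 <= C j.
  by rewrite !mulr_ge0 ?sqr_ge0 ?exprn_ge0 ?normc_ge0// ltW// kappa_gt0.
rewrite (@ge0_integral_sumR _ _ _ (lam n) k.+1 (fun j t => C j *
    (normc (inner z' t) ^+ (2 * (k - j)) * expR (- nrm2 t)))); last 2 first.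
- by move=> j; apply: measurable_funM; [exact: measurable_cst|exact: mfn].
- by move=> j t; rewrite mulr_ge0.
transitivity (\sum_(j < k.+1) (C j * (kappa R ^+ n * (k - j)`!%:R * nrm2 z' ^+ (k - j)))%:E)%E.
  apply: eq_bigr => j _.
  by rewrite (ge0_integralZ (lam n) (C0 j) (mfn _ _ _) (fun w => fn0 _ _ w _)) IH.
rewrite sumEFin; congr EFin; rewrite nrm2_cons addrC exprDn mulr_sumr.
apply: eq_bigr => j _; rewrite /C -(mulr_natl (nrm2 z' ^+ (k - j) * _)) (exprM (normc z0))
  (exprS (kappa R)).
have jk : (j <= k)%N by rewrite -ltnS ltn_ord.
rewrite -(bin_fact jk) !natrM; ring.
Qed.

End gaussian_moments_Cn.

(** * Weighted volumes and moments of the normalised ball measure *)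

Section ball_moments.
Context (R : realType).
Local Open Scope complex_scope.
Local Notation lam := (lebesgue_measure_Cn R).
Local Notation normc := ComplexField.Normc.normc.

Lemma measurable_expC d (T : measurableType d) (f : T -> R[i]) k :
  measurable_fun setT f -> measurable_fun setT (fun x => f x ^+ k).
Proof.
move=> mf; elim: k => [|k IH].
  by under eq_fun do rewrite expr0; exact: measurable_cst.
by under eq_fun do rewrite exprS; exact: measurable_mulC.
Qed.

Lemma integral_mrestr d (T : measurableType d) (mu : {measure set T -> \bar R})
    (D : set T) (mD : measurable D) (f : T -> R) :
  measurable_fun setT f -> (forall x, 0 <= f x) ->
  (\int[mrestr mu mD]_x (f x)%:E = \int[mu]_x (\1_D x * f x)%:E)%E.
Proof.
move=> mf f0.
have mD' : measurable (~` D) by exact: measurableC.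
rewrite -[X in integral _ X](setUv D) ge0_integral_setU//=; last 3 first.
- rewrite setUv; exact: measurableT_comp.
- by move=> x _; rewrite lee_fin.
- exact/disj_setPCl.
rewrite [X in (_ + X)%E](_ : _ = 0%E) ?adde0; last first.
  apply: null_set_integral => //.
  - exact: measurable_funTS (measurableT_comp _ mf).
  - by rewrite /= /mrestr setICl measure0.
transitivity (\int[mu]_(x in D) (f x)%:E)%E.
  by apply: eq_measure_integral => A mA AD; rewrite /= /mrestr setIidl.
rewrite integral_mkcond; apply: eq_integral => x _; rewrite patchE indicE.
by case: (x \in D); rewrite ?mul1r ?mul0r.
Qed.

Lemma ge0_integral_vball n (f : n.-tuple R[i] -> R) :
  measurable_fun setT f -> (forall x, 0 <= f x) ->
  (\int[@vball R n]_w (f w)%:E =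
   ((fine (lam n (@cball R n)))^-1)%:E * \int[lam n]_w ((nrm2 w < 1)%R%:R * f w)%:E)%E.
Proof.
move=> mf f0.
have k0 : 0 <= (fine (lam n (@cball R n)))^-1.
  by rewrite invr_ge0 fine_ge0// ltW// lambda_cball_gt0.
transitivity (\int[mscale (NngNum k0) (mrestr (lam n) (@measurable_cball R n))]_w (f w)%:E)%E.
  by apply: eq_measure_integral.
rewrite ge0_integral_mscale; last 3 first.
- exact: measurableT.
- exact: measurableT_comp.
- by move=> x _; rewrite lee_fin.
rewrite integral_mrestr//; congr (_ * _)%E.
by apply: eq_integral => w _; rewrite indic_cball.
Qed.

Let ltN10 : -1 < 0 :> R. Proof. by rewrite ltrN10. Qed.

Lemma gaussian_total n : (\int[lam n]_w (expR (- nrm2 w))%:E = (kappa R ^+ n)%:E)%E.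
Proof.
have := gaussian_moment 0 ([tuple of nseq n 0] : n.-tuple R[i]).
rewrite muln0 !expr0 fact0 !mulr1 => <-.
by apply: eq_integral => w _; rewrite mul1r.
Qed.

(** The instance H = 1, k = 0 of [gaussian_ball]; e > -1 makes both Gamma values finite. *)
Lemma ball_weight n (e : R) : -1 < e ->
  ((Gamma (e + 1) * kappa R ^+ n)%:E = (Gamma (n%:R + e + 1))%:E *
    \int[lam n]_w ((nrm2 w < 1)%R%:R * (1 - nrm2 w) `^ e)%:E)%E.
Proof.
move=> e1; have e10 : 0 < e + 1 by rewrite -ltrBlDr sub0r.
have ne0 : 0 < n%:R + e + 1 by rewrite -addrA ltr_wpDl.
have H0 (x : R) (w : n.-tuple R[i]) : 0 < x -> (1 : R) = x ^+ (2 * 0) * 1 by rewrite muln0 mulr1.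
have m1 : measurable_fun setT (fun _ : n.-tuple R[i] => 1 : R) by exact: measurable_cst.
have := @gaussian_ball R n 0 e (fun=> 1) m1 (fun=> ler01) H0.
rewrite addn0 (Gammae_Gamma e10) (Gammae_Gamma ne0).
under eq_integral do rewrite mul1r.
rewrite gaussian_total -EFinM => ->; congr (_ * _)%E.
by apply: eq_integral => w _; rewrite mul1r.
Qed.

(** The case e = 0 of [ball_weight]: the classical volume pi^n / n!, with [kappa] in place of pi. *)
Lemma lam_cball_kappa n : fine (lam n (@cball R n)) = kappa R ^+ n / n`!%:R.
Proof.
have fn : n`!%:R != 0 :> R by rewrite pnatr_eq0 -lt0n fact_gt0.
apply: (mulfI fn); rewrite mulrCA divff// mulr1.
have lfin : lam n (@cball R n) \is a fin_num.
  by rewrite ge0_fin_numE ?lambda_cball_fin// ltW// lambda_cball_gt0.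
apply: EFin_inj; rewrite EFinM fineK// lam_cball.
have := ball_weight n ltN10.
rewrite add0r addr0 natr1 Gamma_nat (_ : 1 = 1%:R)// Gamma_nat fact0 mul1r => ->.
by congr (_ * _)%E; apply: eq_integral => w _; rewrite powRr0 mulr1.
Qed.

Lemma vball_weight n (e : R) : -1 < e ->
  (\int[@vball R n]_w ((nrm2 w < 1)%R%:R * (1 - nrm2 w) `^ e)%:E =
   (Gamma (n%:R + 1) * Gamma (e + 1) / Gamma (n%:R + e + 1))%:E)%E.
Proof.
move=> e1.
have ne0 : 0 < n%:R + e + 1 by rewrite -addrA ltr_wpDl// -ltrBlDr sub0r.
have Gn := Gamma_gt0 ne0.
have kn : 0 < kappa R ^+ n by rewrite exprn_gt0// kappa_gt0.
have fn : n`!%:R != 0 :> R by rewrite pnatr_eq0 -lt0n fact_gt0.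
rewrite ge0_integral_vball; last 2 first.
- apply: measurable_funM; first exact: measurable_ball_ind.
  by apply: measurable_powRx; apply: measurable_funB; [exact: measurable_cst|
    exact: measurable_nrm2].
- by move=> w; rewrite mulr_ge0// powR_ge0.
have -> : (\int[lam n]_w ((nrm2 w < 1)%R%:R * ((nrm2 w < 1)%R%:R * (1 - nrm2 w) `^ e))%:E =
    ((Gamma (n%:R + e + 1))^-1 * (Gamma (e + 1) * kappa R ^+ n))%:E)%E.
  rewrite EFinM (ball_weight n e1) muleA -EFinM (mulVf (lt0r_neq0 Gn)) mul1e.
  by apply: eq_integral => w _; case: (_ < _); rewrite ?mul1r ?mul0r.
rewrite -EFinM lam_cball_kappa natr1 Gamma_nat; congr EFin; field.
by rewrite fn !lt0r_neq0.
Qed.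

(** The function w -> |<z,w>|^(2k) is homogeneous of degree 2k, so [gaussian_ball] with e = 0
    transfers its Gaussian integral to the ball. *)
Lemma ball_moment n k (z : n.-tuple R[i]) :
  (\int[lam n]_w ((nrm2 w < 1)%R%:R * normc (inner z w) ^+ (2 * k))%:E =
   (kappa R ^+ n * k`!%:R * nrm2 z ^+ k / (n + k)`!%:R)%:E)%E.
Proof.
have mH : measurable_fun setT (fun w => normc (inner z w) ^+ (2 * k)).
  by apply: measurable_funX; apply: measurable_normc; apply: measurable_inner;
    [exact: measurable_cst|exact: measurable_id].
have H0 w : 0 <= normc (inner z w) ^+ (2 * k) by rewrite exprn_ge0// normc_ge0.
have Hh x w : 0 < x -> normc (inner z (cscale x%:C w)) ^+ (2 * k) = x ^+ (2 * k) * normc (inner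
  z w) ^+ (2 * k).
  by move=> x0; rewrite inner_cscale normcM normc_conj normcR gtr0_norm// exprMn.
have := gaussian_ball 0 mH H0 Hh.
rewrite gaussian_moment add0r addr0 Gammae1 mul1e natr1 Gammae_nat => E.
have fn : (n + k)`!%:R != 0 :> R by rewrite pnatr_eq0 -lt0n fact_gt0.
rewrite mulrC EFinM E muleA -EFinM mulVf// mul1e.
by apply: eq_integral => w _; rewrite powRr0 mulr1.
Qed.

Lemma vball_series n N (c : nat -> R) (z : n.-tuple R[i]) :
  (\int[@vball R n]_w (normc (\sum_(k < N) (c k)%:C * inner z w ^+ k) ^+ 2)%:E =
   (\sum_(k < N) c k ^+ 2 * (k`!%:R * n`!%:R / (n + k)`!%:R) * nrm2 z ^+ k)%:E)%E.
Proof.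
(* The averaging uses a primitive root whose order is the number of terms, so the empty sum is
   treated apart. *)
case: N => [|N].
  rewrite big_ord0 integral0_eq// => w _.
  by rewrite big_ord0 normc0 expr0n.
have mi : measurable_fun setT (fun w => inner z w).
  by apply: measurable_inner; [exact: measurable_cst|exact: measurable_id].
have mS : measurable_fun setT (fun w => normc (\sum_(k < N.+1) (c k)%:C * inner z w ^+ k) ^+ 2).
  apply: measurable_funX; apply: measurable_normc; apply: measurable_sumC => k.
  apply: measurable_mulC; first exact: measurable_cst.
  exact: measurable_expC.
have [v vP] := complex_prim_root R (ltn0Sn N).
have wP : N.+1.-primitive_root (v^* : R[i]) by rewrite fmorph_primitive_root.
rewrite ge0_integral_vball; [|exact: mS|by move=> w; exact: sqr_ge0].
pose m k w : R := (nrm2 w < 1)%R%:R * normc (inner z w) ^+ (2 * k).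
have mm k : measurable_fun setT (m k).
  apply: measurable_funM; first exact: measurable_ball_ind.
  by apply: measurable_funX; exact: measurable_normc.
have m0 k w : 0 <= m k w by rewrite mulr_ge0// exprn_ge0// normc_ge0.
have mcm k : measurable_fun setT (fun w => c k ^+ 2 * m k w).
  by apply: measurable_funM; [exact: measurable_cst|exact: mm].
have cm0 k w : 0 <= c k ^+ 2 * m k w by rewrite mulr_ge0// sqr_ge0.
rewrite (ge0_integral_Cn_average (h := fun w => \sum_(k < N.+1) c k ^+ 2 * m k w) wP); first last.
- move=> w.
  transitivity (\sum_(r < N.+1) (nrm2 w < 1)%R%:R * normc (\sum_(k < N.+1) (c k)%:C * inner z w
    ^+ k * (v ^+ r) ^+ k) ^+ 2).
    apply: eq_bigr => r _; rewrite nrm2_cscale normcX normc_conj (normc_prim_root vP) !expr1n mul1r.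
    congr (_ * normc _ ^+ 2); apply: eq_bigr => k _.
    rewrite inner_cscale rmorphXn/= conjCK exprMn -mulrA; congr (_ * _); exact: mulrC.
  rewrite -mulr_sumr (parseval_prim_root (fun k => (c k)%:C * inner z w ^+ k) vP) mulrCA;
    congr (_ * _).
  rewrite mulr_sumr; apply: eq_bigr => k _.
  by rewrite /m normcM normcR exprMn normcX -exprM [(k * 2)%N]mulnC real_normK ?num_real// mulrCA.
- by move=> w; apply: sumr_ge0.
- exact: measurable_sum.
- by move=> w; rewrite mulr_ge0// sqr_ge0.
- by apply: measurable_funM; [exact: measurable_ball_ind|exact: mS].
rewrite (ge0_integral_sumR (lam n) _ mcm cm0).
transitivity (((fine (lam n (@cball R n)))^-1)%:E * \sum_(k < N.+1) (c k ^+ 2 * (kappa R ^+ n *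
  k`!%:R * nrm2 z ^+ k / (n + k)`!%:R))%:E)%E.
  congr (_ * _)%E; apply: eq_bigr => k _.
  by rewrite (ge0_integralZ (lam n) (sqr_ge0 _) (mm _) (m0 _)) ball_moment.
rewrite sumEFin -EFinM lam_cball_kappa mulr_sumr; congr EFin; apply: eq_bigr => k _.
have kn : kappa R ^+ n != 0 by rewrite gt_eqF// exprn_gt0// kappa_gt0.
have fn : n`!%:R != 0 :> R by rewrite pnatr_eq0 -lt0n fact_gt0.
have fnk : (n + k)`!%:R != 0 :> R by rewrite pnatr_eq0 -lt0n fact_gt0.
by field; rewrite fnk kn fn.
Qed.

End ball_moments.

(** * The Forelli-Rudin bound *)

Section forelli_rudin.
Context (R : realType) (n : nat).
Local Open Scope complex_scope.
Local Notation normc := ComplexField.Normc.normc.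

Definition bkernel (alpha : R) (z w : n.-tuple R[i]) : R :=
  normc (1 - inner z w) `^ (- alpha).

Lemma bkernel_ge0 alpha z w : 0 <= bkernel alpha z w.
Proof. exact: powR_ge0. Qed.

Lemma measurable_bkernel d (T : measurableType d) alpha (f g : T -> n.-tuple R[i]) :
  measurable_fun setT f -> measurable_fun setT g ->
  measurable_fun setT (fun x => bkernel alpha (f x) (g x)).
Proof.
move=> mf mg; apply: measurable_powRx; apply: measurable_normc.
have mi := measurable_inner mf mg.
have -> : (fun x => 1 - inner (f x) (g x)) =
    (fun x => (1 - complex.Re (inner (f x) (g x))) +i* (- complex.Im (inner (f x) (g x)))).
  by apply/funext => x; case: (inner _ _) => a b; simpc.
apply: measurable_mkC.
  by apply: measurable_funB; [exact: measurable_cst|exact: measurable_ReP].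
by apply: measurableT_comp => //; exact: measurable_ImP.
Qed.

(** Summing |z_j| |w_j| <= (|z_j|^2 + |w_j|^2) / 2 suffices here in place of the Cauchy-Schwarz
    inequality. *)
Lemma normc_inner_lt1 (z w : n.-tuple R[i]) : nrm2 z < 1 -> nrm2 w < 1 ->
  normc (inner z w) < 1.
Proof.
move=> z1 w1; apply: (@le_lt_trans _ _ ((nrm2 z + nrm2 w) / 2)); last by lra.
have nsum (F : 'I_n -> R[i]) : normc (\sum_(j < n) F j) <= \sum_(j < n) normc (F j).
  elim/big_ind2 : _ => [|x a y b xa yb|//]; first by rewrite normc0.
  exact: le_trans (le_normcD _ _) (lerD xa yb).
apply: le_trans (nsum _) _.
rewrite /nrm2 -big_split/= mulr_suml; apply: ler_sum => j _.
rewrite normcM normc_conj ler_pdivlMr//.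
by have := sqr_ge0 (normc (tnth z j) - normc (tnth w j)); lra.
Qed.

(** In terms of Gamma values this is [Gamma_midpoint] at be + k, halfway between b + k and n + k +
    1. Equality holds at k = 0, which fixes the constant. *)
Lemma sqr_binom_coef_le (be b : R) k : 0 < be -> 0 < b -> b + (n%:R + 1) = be + be ->
  binom_coef be k ^+ 2 * (k`!%:R * n`!%:R / (n + k)`!%:R) <=
  (Gamma (n%:R + 1) * Gamma b / Gamma be ^+ 2) * binom_coef b k.
Proof.
move=> be0 b0 bbe.
have bek : 0 < be + k%:R by rewrite ltr_wpDr.
have bk : 0 < b + k%:R by rewrite ltr_wpDr.
have E : b + k%:R + (n + k).+1%:R = be + k%:R + (be + k%:R).
  rewrite -natr1 natrD; lra.
have := Gamma_midpoint E bek bk (ltr0Sn _ _).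
rewrite !Gamma_addn// !Gamma_nat natr1 Gamma_nat.
have Gb := Gamma_gt0 b0; have Gbe := Gamma_gt0 be0.
have fn m : 0 < m`!%:R :> R by rewrite ltr0n fact_gt0.
have := binom_coef_ge0 k b0; have := binom_coef_ge0 k be0.
move: (binom_coef be k) (binom_coef b k) (Gamma b) (Gamma be) Gb Gbe (fn n) (fn k) (fn (n + k)%N).
move: (n`!%:R : R) (k`!%:R : R) ((n + k)`!%:R : R) => N K M c c' g g' g0 g'0 N0 K0 M0 c0 c'0 H.
rewrite mulrA ler_pdivrMr// (_ : N * g / g' ^+ 2 * c' * M = (N * g * c' * M) / g' ^+ 2); last first.
  by field; rewrite gt_eqF.
rewrite ler_pdivlMr ?exprn_gt0// -(ler_pM2l K0).
rewrite [leLHS](_ : _ = (K * c * g') ^+ 2 * N); last by ring.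
rewrite [leRHS](_ : _ = (K * c' * g * M) * N); last by ring.
by rewrite ler_pM2r.
Qed.

Lemma kernel_integral_le (alpha : R) (z : n.-tuple R[i]) :
  n%:R + 1 < alpha -> nrm2 z < 1 ->
  (\int[@vball R n]_w ((nrm2 w < 1)%R%:R * bkernel alpha z w)%:E <=
   (Gamma (n%:R + 1) * Gamma (alpha - (n%:R + 1)) / Gamma (alpha / 2) ^+ 2 *
    (1 - nrm2 z) `^ (- (alpha - (n%:R + 1))))%:E)%E.
Proof.
move=> na z1; set b := alpha - _; set be := alpha / 2.
have b0 : 0 < b by rewrite subr_gt0.
have n0 : 0 <= n%:R :> R by [].
have be0 : 0 < be by rewrite /be; lra.
pose S N w := normc (\sum_(k < N) (binom_coef be k)%:C * inner z w ^+ k) ^+ 2.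
have mi : measurable_fun setT (fun w => inner z w).
  by apply: measurable_inner; [exact: measurable_cst|exact: measurable_id].
have mS N : measurable_fun setT (S N).
  apply: measurable_funX; apply: measurable_normc; apply: measurable_sumC => k.
  by apply: measurable_mulC; [exact: measurable_cst|exact: measurable_expC].
have S0 N w : 0 <= S N w by exact: sqr_ge0.
pose f N w : \bar R := ((nrm2 w < 1)%R%:R * S N w)%:E.
have mf N : measurable_fun setT (f N).
  by apply/measurable_EFinP; apply: measurable_funM; [exact: measurable_ball_ind|exact: mS].
have f0 N w : (0 <= f N w)%E by rewrite lee_fin mulr_ge0.
(* The squared moduli of the partial sums converge pointwise on the ball but need not increase with
   N, hence Fatou's lemma rather than monotone convergence. *)
have := fatou (@vball R n) measurableT mf (fun N w _ => f0 N w).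
have -> : (\int[@vball R n]_w limn_einf (f^~ w) =
    \int[@vball R n]_w ((nrm2 w < 1)%R%:R * bkernel alpha z w)%:E)%E.
  apply: eq_integral => w _.
  suff fw : f^~ w @ \oo --> ((nrm2 w < 1)%R%:R * bkernel alpha z w)%:E.
    exact: (cvg_limn_einf_sup fw).1.
  have rc : (fun N => (nrm2 w < 1)%R%:R * S N w) @ \oo -->
      (nrm2 w < 1)%R%:R * bkernel alpha z w.
    have [w1|_] := ltP (nrm2 w) 1; last first.
      rewrite -[false%:R]/(0 : R) mul0r (_ : (fun N => _) = cst 0); first exact: cvg_cst.
      by apply/funext => N; rewrite mul0r.
    apply: cvgMr.
    have := cvg_sqr_normc_binomial (normc_inner_lt1 z1 w1) be0.
    rewrite -powR_mulrn ?normc_ge0// -powRrM.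
    by rewrite (_ : 2%:R * - be = - alpha); last by rewrite /be; field.
  by apply: cvg_EFin; first exact: nearW.
move=> /le_trans; apply.
have fle N : (\int[@vball R n]_w f N w <=
    (Gamma (n%:R + 1) * Gamma b / Gamma be ^+ 2 * (1 - nrm2 z) `^ (- b))%:E)%E.
  apply: (@le_trans _ _ (\int[@vball R n]_w (S N w)%:E)%E).
    apply: ge0_le_integralR.
    - by apply: measurable_funM; [exact: measurable_ball_ind|exact: mS].
    - by move=> w; rewrite mulr_ge0.
    - exact: mS.
    - by move=> w; case: (_ < _); rewrite ?mul1r ?mul0r.
  rewrite vball_series lee_fin.
  have C0 : 0 <= Gamma (n%:R + 1) * Gamma b / Gamma be ^+ 2.
    apply: mulr_ge0; last by rewrite invr_ge0; exact: sqr_ge0.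
    by apply: mulr_ge0; exact: Gamma_ge0.
  have z01 : 0 <= nrm2 z < 1 by rewrite nrm2_ge0 z1.
  apply: le_trans (ler_wpM2l C0 (sum_binom_coef_le N b0 z01)).
  rewrite mulr_sumr; apply: ler_sum => k _; rewrite [leRHS]mulrA.
  apply: ler_wpM2r; first by rewrite exprn_ge0// nrm2_ge0.
  apply: sqr_binom_coef_le => //.
  by rewrite /b /be subrK -mulrDl -mulr2n -[_ *+ 2]mulr_natr mulfK.
rewrite limn_einf_lim; apply: lime_le; first exact: is_cvg_einfs.
near=> m; apply: le_trans (fle m).
by apply: ereal_inf_lbound; exists m => //=.
Unshelve. all: by end_near. Qed.

End forelli_rudin.

(** * A Schur test with two exponents *)

Section fubini_prod.
Context d1 d2 (T1 : measurableType d1) (T2 : measurableType d2) (R : realType).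
Variables (m1 : {sigma_finite_measure set T1 -> \bar R})
  (m2 : {sigma_finite_measure set T2 -> \bar R}) (f : T1 -> T2 -> R).
Hypotheses (mf : measurable_fun setT (fun z => f z.1 z.2)) (f0 : forall x w, 0 <= f x w).

Lemma ge0_integral_prod1 :
  (\int[(m1 \x m2)%E]_z (f z.1 z.2)%:E = \int[m1]_x \int[m2]_w (f x w)%:E)%E.
Proof.
rewrite (fubini_tonelli1 (m1 := m1) (m2 := m2) (fun z => (f z.1 z.2)%:E)); first by [].
- exact/measurable_EFinP.
- by move=> z; rewrite lee_fin.
Qed.

Lemma ge0_integral_prod2 :
  (\int[(m1 \x m2)%E]_z (f z.1 z.2)%:E = \int[m2]_w \int[m1]_x (f x w)%:E)%E.
Proof.
rewrite (fubini_tonelli2 (m1 := m1) (m2 := m2) (fun z => (f z.1 z.2)%:E)); first by [].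
- exact/measurable_EFinP.
- by move=> z; rewrite lee_fin.
Qed.

Lemma measurable_partial_integral1 :
  measurable_fun setT (fun x => \int[m2]_w (f x w)%:E)%E.
Proof.
apply: (measurable_fun_fubini_tonelli_F (m2 := m2) (fun z => (f z.1 z.2)%:E)).
- exact/measurable_EFinP.
- by move=> z; rewrite lee_fin.
Qed.

Lemma measurable_partial_integral2 :
  measurable_fun setT (fun w => \int[m1]_x (f x w)%:E)%E.
Proof.
apply: (measurable_fun_fubini_tonelli_G (m1 := m1) (fun z => (f z.1 z.2)%:E)).
- exact/measurable_EFinP.
- by move=> z; rewrite lee_fin.
Qed.

End fubini_prod.

Section schur_test.
Context d (T : measurableType d) (R : realType).
Variable mu : {sigma_finite_measure set T -> \bar R}.
Variables (K : T -> T -> R) (J : T -> R) (A p s : R).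
Hypotheses (mK : measurable_fun setT (fun x => K x.1 x.2)) (K0 : forall x w, 0 <= K x w).
Hypotheses (mJ : measurable_fun setT J) (J0 : forall x, 0 <= J x).
Hypotheses (KJ : forall x, (\int[mu]_w (K x w)%:E <= (J x)%:E)%E).
Hypotheses (KJ' : forall w, (\int[mu]_x (K x w)%:E <= (J w)%:E)%E).
Hypotheses (p1 : 1 < p) (s1 : 1 < s) (A0 : 0 < A).
Let theta : R := 1 - s^-1 - p^-1.
Hypotheses (theta0 : 0 < theta).
Hypothesis JA : (\int[mu]_x ((J x / A) `^ theta^-1)%:E <= 1)%E.

Let p0 : 0 < p. Proof. exact: lt_trans ltr01 p1. Qed.
Let s0 : 0 < s. Proof. exact: lt_trans ltr01 s1. Qed.
Let pV : 0 < p^-1. Proof. by rewrite invr_gt0. Qed.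
Let sV : 0 < s^-1. Proof. by rewrite invr_gt0. Qed.
Let q0 : 0 < 1 - theta.
Proof. by rewrite /theta; move: pV sV; lra. Qed.

(** Young's inequality with exponents 1/(1 - theta) and 1/theta, applied to F^(r(1-theta)) and J /
    A. Both resulting integrals are at most 1, and their weights A (1 - theta) and A theta add up to
    A. *)
Lemma young_weight (F : T -> R) (r : R) : 0 < r -> measurable_fun setT F ->
  (forall x, 0 <= F x) -> (\int[mu]_x (F x `^ r)%:E <= 1)%E ->
  (\int[mu]_x (F x `^ (r * (1 - theta)) * J x)%:E <= A%:E)%E.
Proof.
move=> r0 mF F0 F1.
have mFr : measurable_fun setT (fun x => F x `^ r) by exact: measurable_powRx.
have mJA : measurable_fun setT (fun x => (J x / A) `^ theta^-1).
  by apply: measurable_powRx; apply: measurable_funM; [exact: mJ|exact: measurable_cst].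
have A1 : 0 <= A * (1 - theta) by rewrite mulr_ge0// ltW.
have A2 : 0 <= A * theta by rewrite mulr_ge0// ltW.
apply: (@le_trans _ _ (\int[mu]_x (A * (1 - theta) * F x `^ r +
    A * theta * (J x / A) `^ theta^-1)%:E)%E).
  apply: ge0_le_integralR.
  - by apply: measurable_funM => //; exact: measurable_powRx.
  - by move=> x; rewrite mulr_ge0// powR_ge0.
  - by apply: measurable_funD; apply: measurable_funM => //; exact: measurable_cst.
  - move=> x.
    have JA0 : 0 <= J x / A by rewrite divr_ge0// ltW.
    have q1 : 0 < (1 - theta)^-1 by rewrite invr_gt0.
    have t1 : 0 < theta^-1 by rewrite invr_gt0.
    have e1 : (1 - theta)^-1^-1 + theta^-1^-1 = 1 by rewrite !invrK subrK.
    have := conjugate_powR (powR_ge0 (F x) (r * (1 - theta))) JA0 q1 t1 e1.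
    rewrite -powRrM mulfK ?gt_eqF// !invrK => H.
    have -> : F x `^ (r * (1 - theta)) * J x = A * (F x `^ (r * (1 - theta)) * (J x / A)).
      by field; rewrite gt_eqF.
    rewrite -!mulrA -mulrDr; apply: ler_wpM2l; first exact: ltW.
    by rewrite (mulrC (1 - theta)) (mulrC theta).
rewrite ge0_integralDR; last 4 first.
- by apply: measurable_funM => //; exact: measurable_cst.
- by move=> x; rewrite mulr_ge0// powR_ge0.
- by apply: measurable_funM => //; exact: measurable_cst.
- by move=> x; rewrite mulr_ge0// powR_ge0.
rewrite (ge0_integralZ mu A1 mFr (fun=> powR_ge0 _ _)) (ge0_integralZ mu A2 mJA (fun=> powR_ge0
  _ _)).
apply: (@le_trans _ _ ((A * (1 - theta))%:E * 1 + (A * theta)%:E * 1)%E).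
  apply: leeD; apply: lee_wpmul2l.
  - by rewrite lee_fin.
  - exact: F1.
  - by rewrite lee_fin.
  - exact: JA.
by rewrite !mule1 -EFinD lee_fin -mulrDr subrK mulr1.
Qed.

Lemma schur_test (F G : T -> R) : measurable_fun setT F -> (forall x, 0 <= F x) ->
  measurable_fun setT G -> (forall x, 0 <= G x) ->
  (\int[mu]_x (F x `^ p)%:E <= 1)%E -> (\int[mu]_x (G x `^ s)%:E <= 1)%E ->
  (\int[mu]_x \int[mu]_w (F w * G x * K x w)%:E <= A%:E)%E.
Proof.
move=> mF F0 mG G0 F1 G1.
have YF := young_weight p0 mF F0 F1; have YG := young_weight s0 mG G0 G1.
(* Since 1 - theta = 1/p + 1/s, these are conjugate exponents, and [young_weight] bounds the
   integrals of F^P J and G^Q J. *)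
pose P := p * (1 - theta); pose Q := s * (1 - theta).
have P0 : 0 < P by rewrite mulr_gt0.
have Q0 : 0 < Q by rewrite mulr_gt0.
have PQ : P^-1 + Q^-1 = 1.
  rewrite /P /Q !invfM -mulrDl (_ : p^-1 + s^-1 = 1 - theta) ?mulfV ?gt_eqF//.
  by rewrite /theta; ring.
have mK1 x : measurable_fun setT (K x).
  have m2 : measurable_fun setT (fun w : T => (x, w)).
    by apply: measurable_fun_pair; [exact: measurable_cst|exact: measurable_id].
  exact: (measurableT_comp mK m2).
have mK2 w : measurable_fun setT (K^~ w).
  have m2 : measurable_fun setT (fun x : T => (x, w)).
    by apply: measurable_fun_pair; [exact: measurable_id|exact: measurable_cst].
  exact: (measurableT_comp mK m2).
pose U (x w : T) : R := F w `^ P / P * K x w.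
pose V (x w : T) : R := G x `^ Q / Q * K x w.
have mU : measurable_fun setT (fun z => U z.1 z.2).
  apply: measurable_funM; last exact: mK.
  apply: measurable_funM; last exact: measurable_cst.
  by apply: measurable_powRx; exact: (measurableT_comp mF measurable_snd).
have mV : measurable_fun setT (fun z => V z.1 z.2).
  apply: measurable_funM; last exact: mK.
  apply: measurable_funM; last exact: measurable_cst.
  by apply: measurable_powRx; exact: (measurableT_comp mG measurable_fst).
have FP0 w : 0 <= F w `^ P / P by rewrite divr_ge0 ?powR_ge0// ltW.
have GQ0 w : 0 <= G w `^ Q / Q by rewrite divr_ge0 ?powR_ge0// ltW.
have U0 x w : 0 <= U x w by rewrite mulr_ge0.
have V0 x w : 0 <= V x w by rewrite mulr_ge0.
have P1 : 0 <= P^-1 by rewrite invr_ge0 ltW.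
have Q1 : 0 <= Q^-1 by rewrite invr_ge0 ltW.
have mW (H : T -> R) r : measurable_fun setT H -> measurable_fun setT (fun w => H w `^ r * J w).
  by move=> mH; apply: measurable_funM; [exact: measurable_powRx|exact: mJ].
have W0 (H : T -> R) r w : 0 <= H w `^ r * J w by rewrite mulr_ge0 ?powR_ge0.
(* U depends on the first variable through the kernel only, so that variable is integrated first and
   J appears; V is treated with the roles exchanged. *)
have IU : (\int[(mu \x mu)%E]_z (U z.1 z.2)%:E <= (A / P)%:E)%E.
  rewrite (ge0_integral_prod2 mu mu mU U0).
  apply: (@le_trans _ _ (\int[mu]_w (P^-1 * (F w `^ P * J w))%:E)%E); last first.
    rewrite (ge0_integralZ mu P1 (mW F P mF) (W0 F P)) mulrC EFinM.
    by apply: lee_wpmul2l; [rewrite lee_fin|exact: YF].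
  apply: ge0_le_integral; first exact: measurableT.
  - by move=> w _; apply: integral_ge0 => x _; rewrite lee_fin.
  - exact: (measurable_partial_integral2 mu mU U0).
  - by apply/measurable_EFinP; apply: measurable_funM; [exact: measurable_cst|exact: mW].
  - move=> w _; rewrite /U (ge0_integralZ mu (FP0 w) (mK2 w) (fun x => K0 x w)).
    rewrite (_ : P^-1 * _ = F w `^ P / P * J w); last by ring.
    by rewrite (EFinM (F w `^ P / P)); apply: lee_wpmul2l; [rewrite lee_fin|exact: KJ'].
have IV : (\int[(mu \x mu)%E]_z (V z.1 z.2)%:E <= (A / Q)%:E)%E.
  rewrite (ge0_integral_prod1 mu mu mV V0).
  apply: (@le_trans _ _ (\int[mu]_w (Q^-1 * (G w `^ Q * J w))%:E)%E); last first.
    rewrite (ge0_integralZ mu Q1 (mW G Q mG) (W0 G Q)) mulrC EFinM.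
    by apply: lee_wpmul2l; [rewrite lee_fin|exact: YG].
  apply: ge0_le_integral; first exact: measurableT.
  - by move=> w _; apply: integral_ge0 => x _; rewrite lee_fin.
  - exact: (measurable_partial_integral1 mu mV V0).
  - by apply/measurable_EFinP; apply: measurable_funM; [exact: measurable_cst|exact: mW].
  - move=> x _; rewrite /V (ge0_integralZ mu (GQ0 x) (mK1 x) (fun w => K0 x w)).
    rewrite (_ : Q^-1 * _ = G x `^ Q / Q * J x); last by ring.
    by rewrite (EFinM (G x `^ Q / Q)); apply: lee_wpmul2l; [rewrite lee_fin|exact: KJ].
have mFGK : measurable_fun setT (fun z => F z.2 * G z.1 * K z.1 z.2).
  apply: measurable_funM; last exact: mK.
  by apply: measurable_funM; [exact: (measurableT_comp mF measurable_snd)|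
    exact: (measurableT_comp mG measurable_fst)].
have FGK0 x w : 0 <= F w * G x * K x w by rewrite !mulr_ge0.
rewrite -(@ge0_integral_prod1 _ _ _ _ _ mu mu (fun x w => F w * G x * K x w) mFGK FGK0).
apply: (@le_trans _ _ (\int[(mu \x mu)%E]_z (U z.1 z.2 + V z.1 z.2)%:E)%E).
  apply: ge0_le_integralR => //.
  - by apply: measurable_funD.
  - move=> z; rewrite /U /V -mulrDl; apply: ler_wpM2r => //.
    exact: conjugate_powR.
rewrite ge0_integralDR//.
apply: (le_trans (leeD IU IV)).
by rewrite -EFinD lee_fin -mulrDr PQ mulr1.
Qed.

End schur_test.

Section schur_scaled.
Context d (T : measurableType d) (R : realType).
Variable mu : {sigma_finite_measure set T -> \bar R}.

(* The norms of f and g may vanish, so they are normalised by a + e and b + e. *)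
Lemma le_of_forall_eps (B : \bar R) (A a b : R) : 0 <= A -> 0 <= a -> 0 <= b ->
  (forall e, 0 < e -> (B <= (A * (a + e) * (b + e))%:E)%E) -> (B <= (A * a * b)%:E)%E.
Proof.
move=> A0 a0 b0 H; apply/lee_addgt0Pr => e e0.
(* For 0 < u <= 1 the excess A u (a + b) + A u^2 is at most u A (a + b + 1), hence at most u c; the
   added 1 keeps c positive. *)
pose c := A * (a + b + 1) + 1.
have c0 : 0 < c by rewrite ltr_wpDl// mulr_ge0// !addr_ge0.
pose u := Num.min 1 (e / c).
have u0 : 0 < u by rewrite lt_min ltr01 divr_gt0.
have u1 : u <= 1 by rewrite ge_min lexx.
have uc : u * c <= e by rewrite -ler_pdivlMr// ge_min lexx orbT.
apply: (le_trans (H _ u0)); rewrite -EFinD lee_fin.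
have uu : A * (u * u) <= A * u.
  by rewrite ler_wpM2l// -[leRHS]mulr1 ler_wpM2l// ltW.
rewrite (_ : A * (a + u) * (b + u) = A * a * b + (A * u * (a + b) + A * (u * u))); last by ring.
rewrite lerD2l; apply: le_trans uc.
rewrite (_ : u * c = A * u * (a + b) + A * u + u); last by rewrite /c; ring.
by rewrite -addrA lerD2l ler_wpDr// ltW.
Qed.

Variables (K : T -> T -> R) (J : T -> R) (A p s : R).
Hypotheses (mK : measurable_fun setT (fun x => K x.1 x.2)) (K0 : forall x w, 0 <= K x w).
Hypotheses (mJ : measurable_fun setT J) (J0 : forall x, 0 <= J x).
Hypotheses (KJ : forall x, (\int[mu]_w (K x w)%:E <= (J x)%:E)%E).
Hypotheses (KJ' : forall w, (\int[mu]_x (K x w)%:E <= (J w)%:E)%E).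
Hypotheses (p1 : 1 < p) (s1 : 1 < s) (A0 : 0 < A).
Hypotheses (theta0 : 0 < 1 - s^-1 - p^-1).
Hypothesis JA : (\int[mu]_x ((J x / A) `^ (1 - s^-1 - p^-1)^-1)%:E <= 1)%E.

Let normalised (F : T -> R) (r a e : R) : 0 < r -> 0 <= a -> 0 < e ->
  measurable_fun setT F -> (forall x, 0 <= F x) ->
  (\int[mu]_x (F x `^ r)%:E <= (a `^ r)%:E)%E ->
  (\int[mu]_x (((a + e)^-1 * F x) `^ r)%:E <= 1)%E.
Proof.
move=> r0 a0 e0 mF F0 Fa; have ae : 0 < a + e by rewrite ltr_wpDl.
have ae1 : 0 <= (a + e)^-1 by rewrite invr_ge0 ltW.
under eq_integral do rewrite powRM//.
rewrite (ge0_integralZ mu (powR_ge0 _ _) (measurable_powRx _ mF) (fun=> powR_ge0 _ _)).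
apply: (@le_trans _ _ (((a + e)^-1 `^ r)%:E * (a `^ r)%:E)%E).
  by apply: lee_wpmul2l; [rewrite lee_fin powR_ge0|exact: Fa].
rewrite -EFinM -powRM// lee_fin.
apply: (@le_trans _ _ (1 `^ r)); last by rewrite powR1.
apply: ge0_ler_powR; [exact: ltW|by rewrite nnegrE mulr_ge0|by rewrite nnegrE|].
by rewrite mulrC ler_pdivrMr// mul1r lerDl ltW.
Qed.

Lemma schur_test_norm (F G : T -> R) (a b : R) : measurable_fun setT F -> (forall x, 0 <= F x) ->
  measurable_fun setT G -> (forall x, 0 <= G x) -> 0 <= a -> 0 <= b ->
  (\int[mu]_x (F x `^ p)%:E <= (a `^ p)%:E)%E ->
  (\int[mu]_x (G x `^ s)%:E <= (b `^ s)%:E)%E ->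
  (\int[mu]_x \int[mu]_w (F w * G x * K x w)%:E <= (A * a * b)%:E)%E.
Proof.
move=> mF F0 mG G0 a0 b0 Fa Gb; apply: le_of_forall_eps => //; first exact: ltW.
move=> e e0.
have ae : 0 < a + e by rewrite ltr_wpDl.
have be : 0 < b + e by rewrite ltr_wpDl.
have p0 := lt_trans ltr01 p1; have s0 := lt_trans ltr01 s1.
pose F' x := (a + e)^-1 * F x; pose G' x := (b + e)^-1 * G x.
have mF' : measurable_fun setT F' by apply: measurable_funM; [exact: measurable_cst|exact: mF].
have mG' : measurable_fun setT G' by apply: measurable_funM; [exact: measurable_cst|exact: mG].
have F'0 x : 0 <= F' x by rewrite mulr_ge0// invr_ge0 ltW.
have G'0 x : 0 <= G' x by rewrite mulr_ge0// invr_ge0 ltW.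
have H := schur_test mK K0 mJ J0 KJ KJ' p1 s1 A0 theta0 JA mF' F'0 mG' G'0
  (normalised p0 a0 e0 mF F0 Fa) (normalised s0 b0 e0 mG G0 Gb).
have mFGK : measurable_fun setT (fun z => F' z.2 * G' z.1 * K z.1 z.2).
  apply: measurable_funM; last exact: mK.
  by apply: measurable_funM; [exact: (measurableT_comp mF' measurable_snd)|
    exact: (measurableT_comp mG' measurable_fst)].
have FGK0 x w : 0 <= F' w * G' x * K x w by rewrite mulr_ge0// mulr_ge0.
have c0 : 0 <= (a + e) * (b + e) by rewrite mulr_ge0 ?ltW.
have E x w : F w * G x * K x w = (a + e) * (b + e) * (F' w * G' x * K x w).
  by rewrite /F' /G'; field; rewrite !gt_eqF.
have mcFGK : measurable_fun setT (fun z => (a + e) * (b + e) * (F' z.2 * G' z.1 * K z.1 z.2)).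
  by apply: measurable_funM; [exact: measurable_cst|exact: mFGK].
have cFGK0 x w : 0 <= (a + e) * (b + e) * (F' w * G' x * K x w) by rewrite mulr_ge0.
have -> : (\int[mu]_x \int[mu]_w (F w * G x * K x w)%:E =
    \int[(mu \x mu)%E]_z ((a + e) * (b + e) * (F' z.2 * G' z.1 * K z.1 z.2))%:E)%E.
  rewrite (@ge0_integral_prod1 _ _ _ _ _ mu mu
    (fun x w => (a + e) * (b + e) * (F' w * G' x * K x w)) mcFGK cFGK0).
  by apply: eq_integral => x _; apply: eq_integral => w _; rewrite E.
rewrite (ge0_integralZ _ c0 mFGK (fun z => FGK0 z.1 z.2)).
rewrite (@ge0_integral_prod1 _ _ _ _ _ mu mu (fun x w => F' w * G' x * K x w) mFGK FGK0).
rewrite (_ : A * (a + e) * (b + e) = ((a + e) * (b + e)) * A); last by ring.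
by rewrite (EFinM ((a + e) * (b + e)) A); apply: lee_wpmul2l; [rewrite lee_fin|exact: H].
Qed.

End schur_scaled.

(** * The bilinear form *)

Section complex_integral.
Context (R : realType) (n : nat).
Local Open Scope complex_scope.
Local Notation normc := ComplexField.Normc.normc.
Local Notation dv := (@vball R n).

(** If the right side is finite, the integral I is paired with its own direction (a, b) = I / |I|:
    |I| is the integral of a Re F + b Im F, which is at most |F| because a^2 + b^2 = 1. *)
Lemma normc_cintegral_le (F : n.-tuple R[i] -> R[i]) : measurable_fun setT F ->
  ((normc (cintegral F))%:E <= \int[dv]_z (normc (F z))%:E)%E.
Proof.
move=> mF.
have mN : measurable_fun setT (fun z => normc (F z)) by exact: measurable_normc.
have N0 : (0 <= \int[dv]_z (normc (F z))%:E)%E.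
  by apply: integral_ge0 => z _; rewrite lee_fin normc_ge0.
have [->|Noo] := eqVneq (\int[dv]_z (normc (F z))%:E)%E +oo%E; first exact: leey.
have iN : (dv).-integrable setT (EFin \o (fun z => normc (F z))).
  apply/integrableP; split; first exact: measurableT_comp.
  rewrite (_ : (\int[dv]_x _)%E = (\int[dv]_z (normc (F z))%:E)%E); first by rewrite ltey.
  by apply: eq_integral => z _; rewrite /= ger0_norm ?normc_ge0.
have iRe : (dv).-integrable setT (EFin \o (fun z => complex.Re (F z))).
  apply: (le_integrable measurableT) iN.
    exact: measurableT_comp (measurable_ReP mF).
  by move=> z _; rewrite lee_fin /= (ger0_norm (normc_ge0 _)) normr_Re_le.
have iIm : (dv).-integrable setT (EFin \o (fun z => complex.Im (F z))).
  apply: (le_integrable measurableT) iN.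
    exact: measurableT_comp (measurable_ImP mF).
  by move=> z _; rewrite lee_fin /= (ger0_norm (normc_ge0 _)) normr_Im_le.
rewrite -(@fineK _ (\int[dv]_z (normc (F z))%:E)%E); last by rewrite ge0_fin_numE// ltey.
rewrite lee_fin -/(Rintegral dv setT (fun z => normc (F z))).
set I := cintegral F; have [->|I0] := eqVneq (normc I) 0; first by rewrite fine_ge0.
have I1 : 0 < normc I by rewrite lt_def I0 normc_ge0.
pose a := complex.Re I / normc I; pose b := complex.Im I / normc I.
have ab : a ^+ 2 + b ^+ 2 = 1.
  rewrite /a /b !expr_div_n -mulrDl -sqr_normcE divff// expf_neq0//.
have NE : normc I = a * complex.Re I + b * complex.Im I.
  rewrite /a /b mulrAC (mulrAC (complex.Im I)) -mulrDl -!expr2 -sqr_normcE.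
  by field.
have Fab z : `|a * complex.Re (F z) + b * complex.Im (F z)| <= normc (F z).
  case: (F z) => u v /=; rewrite -sqrtr_sqr; apply: ler_wsqrtr.
  rewrite -subr_ge0 -[X in X - _]mul1r -ab.
  by rewrite (_ : _ - _ = (a * v - b * u) ^+ 2) ?sqr_ge0//; ring.
have iab : (dv).-integrable setT (EFin \o (fun z => a * complex.Re (F z) + b * complex.Im (F z))).
  apply: (le_integrable measurableT) iN.
    apply: measurableT_comp => //; apply: measurable_funD; apply: measurable_funM => //.
    - exact: measurable_ReP.
    - exact: measurable_ImP.
  by move=> z _; rewrite lee_fin /= (ger0_norm (normc_ge0 _)).
rewrite NE /I /cintegral/= -RintegralZl// -RintegralZl// -RintegralD//; last 2 first.
- exact: (integrableZl measurableT a iRe).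
- exact: (integrableZl measurableT b iIm).
apply: le_Rintegral => // z _.
exact: le_trans (ler_norm _) (Fab z).
Qed.

(** This holds even where [h z] is not integrable: the value is [fine] of the difference between the
    integrals of the positive and negative parts, each measurable in z by Tonelli's theorem. *)
Lemma measurable_Rintegral_param (h : n.-tuple R[i] -> n.-tuple R[i] -> R) :
  measurable_fun setT (fun p => h p.1 p.2) ->
  measurable_fun setT (fun z => \int[dv]_w h z w).
Proof.
move=> mh; pose k (p : n.-tuple R[i] * n.-tuple R[i]) : \bar R := (h p.1 p.2)%:E.
have mk : measurable_fun setT k by exact/measurable_EFinP.
have mF := measurable_fun_fubini_tonelli_F (m2 := dv) (k^\+)%E (measurable_funepos mk)
  (funepos_ge0 _).
have mG := measurable_fun_fubini_tonelli_F (m2 := dv) (k^\-)%E (measurable_funeneg mk)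
  (funeneg_ge0 _).
rewrite (_ : (fun z => _) = fine \o (fun z => fubini_F dv (k^\+)%E z - fubini_F dv (k^\-)%E z)%E).
  apply: measurableT_comp; first exact: fine_measurable.
  exact: (emeasurable_funB mF mG).
apply/funext => z; rewrite /Rintegral integralE /fubini_F/=.
by congr (fine (_ - _)%E); apply: eq_integral => w _; rewrite ?funeposE ?funenegE.
Qed.

Lemma measurable_cintegral_param (h : n.-tuple R[i] -> n.-tuple R[i] -> R[i]) :
  measurable_fun setT (fun p => h p.1 p.2) ->
  measurable_fun setT (fun z => cintegral (h z)).
Proof.
move=> mh; apply: measurable_mkC; apply: measurable_Rintegral_param.
- exact: measurable_ReP.
- exact: measurable_ImP.
Qed.

End complex_integral.

(** * The Schur test applied to the kernel on the ball *)

Section bilinear.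
Context (R : realType) (d : nat).
Local Open Scope complex_scope.
Local Notation normc := ComplexField.Normc.normc.
Local Notation dv := (@vball R d).
Local Notation Cd := (d.-tuple R[i]).

Lemma normc_integrand alpha (f g : Cd -> R[i]) z w :
  normc (integrand alpha f g z w) = normc (f w) * normc (g z) * bkernel alpha z w.
Proof.
rewrite /integrand !normcM /bkernel powRN -fmorphV normcR ger0_norm//.
by rewrite invr_ge0 powR_ge0.
Qed.

Lemma measurable_integrand alpha (f g : Cd -> R[i]) :
  measurable_fun setT f -> measurable_fun setT g ->
  measurable_fun setT (fun p => integrand alpha f g p.1 p.2).
Proof.
move=> mf mg; rewrite /integrand; apply: measurable_mulC.
  by apply: measurable_mulC; [exact: (measurableT_comp mf measurable_snd)|
    exact: (measurableT_comp mg measurable_fst)].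
have mK : measurable_fun setT (fun p : Cd * Cd => bkernel alpha p.1 p.2).
  by apply: measurable_bkernel; [exact: measurable_fst|exact: measurable_snd].
have := measurable_mkC mK (@measurable_cst _ _ _ _ setT (0 : R)).
congr measurable_fun; apply/funext => p.
by rewrite -fmorphV /bkernel powRN.
Qed.

Lemma inner_conj (z w : Cd) : inner w z = (inner z w)^*.
Proof.
rewrite /inner rmorph_sum; apply: eq_bigr => j _.
by rewrite rmorphM/= conjcK mulrC.
Qed.

Lemma bkernel_sym alpha (z w : Cd) : bkernel alpha z w = bkernel alpha w z.
Proof. by rewrite /bkernel (inner_conj z w) -(normc_conj (1 - inner z w)) rmorphB rmorph1. Qed.

Lemma vball_ae : {ae dv, forall w, nrm2 w < 1}.
Proof.
exists (~` (@cball R d)); split.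
- by apply: measurableC; exact: measurable_cball.
- have -> : vball (~` @cball R d) = (1 - vball (@cball R d))%E.
    by apply: probability_setC; exact: measurable_cball.
  by rewrite vball_cball subee.
- by move=> w /= nw; rewrite /cball/= => H; apply: nw.
Qed.

Lemma Lpnorm_pow (p : R) (f : Cd -> R[i]) : 0 < p -> in_Lp p f ->
  Lpnorm p f = (fine (Lpnorm p f))%:E /\
  (\int[dv]_x (normc (f x) `^ p)%:E = (fine (Lpnorm p f) `^ p)%:E)%E.
Proof.
move=> p0 [mf fp].
have E : Lpnorm p f = (fine (Lpnorm p f))%:E by rewrite fineK// ge0_fin_numE// Lnorm_ge0.
split; first exact: E.
rewrite -poweR_EFin -E /Lpnorm (poweR_Lnorm _ _ (lt0r_neq0 p0)).
by apply: eq_integral => x _; rewrite /= ger0_norm// normc_ge0.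
Qed.

Variables (p s alpha : R).
Hypotheses (p1 : 1 < p) (s1 : 1 < s) (da : d%:R + 1 < alpha).
Hypothesis psa : s^-1 + p^-1 + alpha < d%:R + 2.
Let theta : R := 1 - s^-1 - p^-1.
Let b : R := alpha - (d%:R + 1).
Let e : R := 1 / theta * (d%:R + 1 - alpha).
Let C0 : R := Gamma (d%:R + 1) * Gamma b / Gamma (alpha / 2) ^+ 2.
(** The integral of (1 - |z|^2)^e over the ball. With it, A = C0 W^theta is the constant for which
    (J / A)^(1/theta) has integral 1. *)
Let W : R := Gamma (d%:R + 1) * Gamma (e + 1) / Gamma (d%:R + e + 1).
Let A : R := C0 * W `^ theta.

Let b0 : 0 < b. Proof. by rewrite subr_gt0. Qed.
Let theta0 : 0 < theta.
Proof. by rewrite /theta; move: psa da; lra. Qed.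
Let bt : b < theta.
Proof. by rewrite /theta /b; move: psa; lra. Qed.
Let eE : e = - b / theta.
Proof. by rewrite /e /b; field; rewrite gt_eqF. Qed.
Let e1 : -1 < e.
Proof. by rewrite eE mulNr ltrN2 ltr_pdivrMr// mul1r. Qed.
Let d0 : 0 < d%:R + 1 :> R. Proof. by rewrite ltr_wpDl. Qed.
Let alpha0 : 0 < alpha / 2. Proof. by rewrite divr_gt0// (lt_trans d0). Qed.
Let e10 : 0 < e + 1. Proof. by rewrite -ltrBlDr sub0r. Qed.
Let de0 : 0 < d%:R + e + 1. Proof. by rewrite -addrA ltr_wpDl. Qed.
Let C00 : 0 < C0.
Proof.
apply: divr_gt0; first by apply: mulr_gt0; exact: Gamma_gt0.
by apply: exprn_gt0; exact: Gamma_gt0.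
Qed.
Let W0 : 0 < W.
Proof.
by apply: divr_gt0; [apply: mulr_gt0|]; exact: Gamma_gt0.
Qed.
Let A0 : 0 < A. Proof. by apply: mulr_gt0 => //; exact: powR_gt0. Qed.

Let ind (x : Cd) : R := (nrm2 x < 1)%R%:R.
(** The cutoffs let the Schur bounds hold at every point of C^d, although the kernel estimate is
    available only inside the ball. *)
Let K (x w : Cd) : R := ind x * (ind w * bkernel alpha x w).
Let J (x : Cd) : R := ind x * (C0 * (1 - nrm2 x) `^ (- b)).

Let ind0 x : 0 <= ind x. Proof. exact: ler0n. Qed.
Let K0 x w : 0 <= K x w.
Proof. by rewrite mulr_ge0// mulr_ge0// bkernel_ge0. Qed.
Let J0 x : 0 <= J x.
Proof. by rewrite mulr_ge0// mulr_ge0 ?powR_ge0// ltW. Qed.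
Let mind : measurable_fun setT ind. Proof. exact: measurable_ball_ind. Qed.
Let mJ : measurable_fun setT J.
Proof.
apply: measurable_funM; first exact: mind.
apply: measurable_funM; first exact: measurable_cst.
by apply: measurable_powRx; apply: measurable_funB; [exact: measurable_cst|exact: measurable_nrm2].
Qed.
Let mbk : measurable_fun setT (fun p : Cd * Cd => bkernel alpha p.1 p.2).
Proof. by apply: measurable_bkernel; [exact: measurable_fst|exact: measurable_snd]. Qed.
Let mK : measurable_fun setT (fun p => K p.1 p.2).
Proof.
apply: measurable_funM; first exact: (measurableT_comp mind measurable_fst).
by apply: measurable_funM; first exact: (measurableT_comp mind measurable_snd).
Qed.

Let KJ x : (\int[dv]_w (K x w)%:E <= (J x)%:E)%E.
Proof.
rewrite /K /J /ind; have [x1|_] := ltP (nrm2 x) 1; last first.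
  rewrite mul0r (_ : (\int[dv]_w _)%E = 0%E)//; apply: integral0_eq => w _.
  by rewrite mul0r.
rewrite mul1r; under eq_integral do rewrite mul1r.
exact: kernel_integral_le.
Qed.

Let KJ' w : (\int[dv]_x (K x w)%:E <= (J w)%:E)%E.
Proof.
apply: le_trans (KJ w); rewrite le_eqVlt; apply/orP; left; apply/eqP.
by apply: eq_integral => x _; rewrite /K bkernel_sym mulrCA.
Qed.

Let JA : (\int[dv]_x ((J x / A) `^ theta^-1)%:E <= 1)%E.
Proof.
have JE x : (J x / A) `^ theta^-1 = W^-1 * ((nrm2 x < 1)%R%:R * (1 - nrm2 x) `^ e).
  have t0 : theta^-1 != 0 by rewrite invr_eq0 gt_eqF.
  rewrite /J /ind; have [x1|_] := ltP (nrm2 x) 1; last first.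
    by rewrite !mul0r powR0// mulr0.
  have x0 : 0 <= 1 - nrm2 x by rewrite subr_ge0 ltW.
  rewrite -[true%:R]/(1 : R) !mul1r.
  (* C0 cancels; the power 1/theta then turns W^(-theta) into 1/W and the exponent -b into e. *)
  have -> : C0 * (1 - nrm2 x) `^ (- b) / A = (1 - nrm2 x) `^ (- b) * W `^ (- theta).
    rewrite /A (powRN W theta); have Wt : W `^ theta != 0 by rewrite gt_eqF// powR_gt0.
    by field; rewrite Wt gt_eqF.
  rewrite (powRM _ (powR_ge0 _ _) (powR_ge0 _ _)) -!powRrM -eE mulrC.
  by rewrite mulNr (divff (lt0r_neq0 theta0)) (powR_inv1 (ltW W0)).
have mg : measurable_fun setT (fun x : Cd => (nrm2 x < 1)%R%:R * (1 - nrm2 x) `^ e : R).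
  apply: measurable_funM; first exact: mind.
  by apply: measurable_powRx; apply: measurable_funB; [exact: measurable_cst|
    exact: measurable_nrm2].
have g0 (x : Cd) : 0 <= (nrm2 x < 1)%R%:R * (1 - nrm2 x) `^ e.
  by rewrite mulr_ge0 ?powR_ge0.
have W10 : 0 <= W^-1 by rewrite invr_ge0 ltW.
under eq_integral do rewrite JE.
rewrite (ge0_integralZ dv W10 mg g0) (vball_weight _ e1) -/W -EFinM.
by rewrite mulVf ?gt_eqF.
Qed.

Lemma bilinear_bound_holds : bilinear_bound d p s alpha A.
Proof.
move=> f g Lf Lg.
have p0 := lt_trans ltr01 p1; have s0 := lt_trans ltr01 s1.
have [fE fI] := Lpnorm_pow p0 Lf; have [gE gI] := Lpnorm_pow s0 Lg.
have [mf _] := Lf; have [mg _] := Lg.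
set a := fine (Lpnorm p f) in fE fI *; set c := fine (Lpnorm s g) in gE gI *.
have a0 : 0 <= a by rewrite fine_ge0// Lnorm_ge0.
have c0 : 0 <= c by rewrite fine_ge0// Lnorm_ge0.
pose F x := normc (f x); pose G x := normc (g x).
have mF : measurable_fun setT F by exact: measurable_normc.
have mG : measurable_fun setT G by exact: measurable_normc.
have F0 x : 0 <= F x by exact: normc_ge0.
have G0 x : 0 <= G x by exact: normc_ge0.
have fI' : (\int[dv]_x (F x `^ p)%:E <= (a `^ p)%:E)%E by rewrite fI.
have gI' : (\int[dv]_x (G x `^ s)%:E <= (c `^ s)%:E)%E by rewrite gI.
have H := schur_test_norm mK K0 mJ J0 KJ KJ' p1 s1 A0 theta0 JA mF F0 mG G0 a0 c0 fI' gI'.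
pose N z w : R := normc (integrand alpha f g z w).
have mi := measurable_integrand alpha mf mg.
have mN : measurable_fun setT (fun p => N p.1 p.2) by exact: measurable_normc.
have N0 z w : 0 <= N z w by exact: normc_ge0.
have mFGK : measurable_fun setT (fun z => F z.2 * G z.1 * K z.1 z.2).
  apply: measurable_funM; last exact: mK.
  by apply: measurable_funM; [exact: (measurableT_comp mF measurable_snd)|
    exact: (measurableT_comp mG measurable_fst)].
have FGK0 x w : 0 <= F w * G x * K x w by rewrite mulr_ge0// mulr_ge0.
(* The two integrands agree when both points lie in the ball, so equality almost everywhere is used
   once in z and once in w. *)
have NFGK : (\int[dv]_z \int[dv]_w (N z w)%:E = \int[dv]_z \int[dv]_w (F w * G z * K z w)%:E)%E.
  apply: ge0_ae_eq_integral; first exact: measurableT.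
  - exact: (measurable_partial_integral1 dv mN N0).
  - exact: (@measurable_partial_integral1 _ _ _ _ _ dv (fun z w => F w * G z * K z w) mFGK FGK0).
  - by move=> z _; apply: integral_ge0 => w _; rewrite lee_fin.
  - by move=> z _; apply: integral_ge0 => w _; rewrite lee_fin.
  apply: (filterS _ (vball_ae)) => z z1 _.
  have m2 : measurable_fun setT (fun w : Cd => (z, w)).
    by apply: measurable_fun_pair; [exact: measurable_cst|exact: measurable_id].
  apply: ge0_ae_eq_integral; first exact: measurableT.
  - apply: measurableT_comp => //; exact: (measurableT_comp mN m2).
  - apply: measurableT_comp => //; exact: (measurableT_comp mFGK m2).
  - by move=> w _; rewrite lee_fin.
  - by move=> w _; rewrite lee_fin.
  apply: (filterS _ (vball_ae)) => w w1 _.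
  by rewrite /N normc_integrand /K /ind z1 w1 !mul1r.
have NA : (\int[dv]_z \int[dv]_w (N z w)%:E <= (A * a * c)%:E)%E by rewrite NFGK.
split; first exact: le_lt_trans NA (ltry _).
(* The modulus is moved inside the outer integral, then inside the inner one. *)
rewrite fE gE -!EFinM; apply: le_trans NA.
have mc := measurable_cintegral_param mi.
apply: (le_trans (normc_cintegral_le mc)).
apply: ge0_le_integral; first exact: measurableT.
- by move=> z _; rewrite lee_fin normc_ge0.
- by apply: measurableT_comp => //; exact: measurable_normc.
- exact: (measurable_partial_integral1 dv mN N0).
- move=> z _; apply: normc_cintegral_le.
  have m2 : measurable_fun setT (fun w : Cd => (z, w)).
    by apply: measurable_fun_pair; [exact: measurable_cst|exact: measurable_id].
  exact: (measurableT_comp mi m2).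
Qed.

End bilinear.

Theorem corollary6p3 (R : realType) (d : nat) (p s alpha : R) :
  (1 <= d)%N -> 1 < p -> 1 < s ->
  d%:R + 1 < alpha -> alpha < d%:R + 2 ->
  s^-1 + p^-1 + alpha < d%:R + 2 ->
  (best_constant d p s alpha <=
   (Gamma (d%:R + 1) `^ (2 - s^-1 - p^-1) * Gamma (alpha - (d%:R + 1)) *
    Gamma (1 / (1 - s^-1 - p^-1) * (d%:R + 1 - alpha) + 1)
      `^ (1 - s^-1 - p^-1) /
    (Gamma (alpha / 2) ^+ 2 *
     Gamma (1 / (1 - s^-1 - p^-1) * (d%:R + 1 - alpha) + d%:R + 1)
      `^ (1 - s^-1 - p^-1)))%:E)%E.
Proof.
move=> _ p1 s1 da _ psa; apply: ereal_inf_lbound.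
eexists; first exact: (bilinear_bound_holds p1 s1 da psa).
congr EFin; set theta := 1 - s^-1 - p^-1; set e := 1 / theta * _.
have theta0 : 0 < theta by rewrite /theta; move: psa da; lra.
(* With b = alpha - d - 1, e + 1 = (theta - b) / theta, and theta - b > 0 is the last hypothesis. *)
have e1 : 0 < e + 1.
  rewrite /e mul1r addrC -subr_gt0 subr0 -[X in 0 < X + _](mulVf (lt0r_neq0 theta0)) -mulrDr.
  by rewrite mulr_gt0 ?invr_gt0// /theta; move: psa; lra.
have d0 : 0 <= d%:R :> R by [].
have d1 : 0 < d%:R + 1 :> R by lra.
have de1 : 0 < d%:R + e + 1 by lra.
have a2 : 0 < alpha / 2 by lra.
have Gd := Gamma_gt0 d1; have Ge := Gamma_gt0 e1.
have Gde := Gamma_gt0 de1; have Ga := Gamma_gt0 a2.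
(* One factor Gamma (d + 1) comes from the kernel bound, and its power theta from the integral of
   the weight. *)
rewrite (addrC e d%:R) (_ : 2 - s^-1 - p^-1 = 1 + theta); last by rewrite /theta; ring.
move: (Gamma (alpha - _)) (Gamma (alpha / 2)) (Gamma (d%:R + 1)) (Gamma (e + 1)) (Gamma (d%:R +
  e + 1)) Ga Gd Ge Gde => g ga gd ge gde ga0 gd0 ge0 gde0.
rewrite (@powRD _ gd 1 theta); last by rewrite (gt_eqF gd0) implybT.
rewrite (powRr1 (ltW gd0)) powRM; [|by rewrite mulr_ge0 ?ltW|by rewrite invr_ge0 ltW].
rewrite (powRM _ (ltW gd0) (ltW ge0)) -(powR_inv1 (ltW gde0)) -powRrM mulN1r powRN.
have gdet : gde `^ theta != 0 by rewrite gt_eqF// powR_gt0.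
by field; rewrite gdet gt_eqF.
Qed.
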